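(* Let $\mathfrak{g}$ be a root-reductive Lie algebra for which $\mathfrak{so}(V)$ is a direct summand of $[\mathfrak{g},\mathfrak{g}]$. The following statements hold for any maximal toral subalgebra $\mathfrak{t}\subseteq\mathfrak{g}$ (with $V^\alpha=V^\alpha(\mathfrak{t})$ for $\alpha\in\mathfrak{t}^*$): (1) If $\langle V^\alpha,V^\beta\rangle\neq 0$, then $\beta=-\alpha$. If furthermore $\alpha\neq 0$, then $\dim V^\alpha=\dim V^{-\alpha}=1$. (2) If $\langle\cdot,\cdot\rangle|_{V^\alpha\times V^{-\alpha}}=0$, then $V^\alpha\wedge V^{-\alpha}\subseteq\mathfrak{z}(\mathfrak{z}_{\mathfrak{so}(V)}(\mathfrak{t}))$. (3) $\langle\cdot,\cdot\rangle|_{V^0\times V^0}$ has rank $0$ or $1$, and $(\bigwedge^2V^0)\cap\mathfrak{t}=0$. (4) $\mathfrak{z}_{\mathfrak{so}(V)}(\mathfrak{t})$ is nilpotent of depth at most $2$. If $\mathfrak{g}=\mathfrak{so}(V)$, a subalgebra $\mathfrak{t}\subseteq\mathfrak{g}$ is maximal toral if and only if (3), (5), and (6) hold, where (5) $\operatorname{supp}V=-\operatorname{supp}V$ and $\dim V^\alpha=1$ for any $\alpha\in\operatorname{supp}V\setminus\{0\}$; (6) $\mathfrak{t}=\bigoplus_{\alpha\in I}V^\alpha\wedge V^{-\alpha}$, where $I\sqcup -I=\operatorname{supp}V\setminus\{0\}$.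
   Context: Everything is over $\mathbb{C}$. An inclusion of finite-dimensional reductive Lie algebras $\mathfrak{l}\subseteq\mathfrak{m}$ is a root inclusion if, for some Cartan subalgebra $\mathfrak{h}_{\mathfrak{m}}$ of $\mathfrak{m}$, $\mathfrak{l}\cap\mathfrak{h}_{\mathfrak{m}}$ is a Cartan subalgebra of $\mathfrak{l}$ and each $\mathfrak{l}\cap\mathfrak{h}_{\mathfrak{m}}$-root space of $\mathfrak{l}$ is also a root space of $\mathfrak{m}$. A Lie algebra is root-reductive if it is isomorphic to a union $\bigcup_{i\in\mathbb{Z}_{>0}}\mathfrak{g}_i$ of nested finite-dimensional reductive Lie algebras with respect to root inclusions for a fixed choice of nested Cartan subalgebras $\mathfrak{h}_i\subseteq\mathfrak{g}_i$ with $\mathfrak{h}_{i-1}=\mathfrak{h}_i\cap\mathfrak{g}_{i-1}$. An element of $\mathfrak{g}$ is semisimple if it is semisimple in some (equivalently every large enough) $\mathfrak{g}_i$ containing it, i.e. acts semisimply on $\mathfrak{g}_i$ by the adjoint action. A subalgebra is toral if all its elements are semisimple. $V$ is a countably infinite-dimensional vector space with a nondegenerate symmetric bilinear form $\langle\cdot,\cdot\rangle$. $V\otimes V$ is an associative algebra with $(v\otimes w)\cdot(v'\otimes w')=\langle v',w\rangle\,v\otimes w'$, acting on $V$ by $(v\otimes w)\cdot u=\langle u,w\rangle v$. Put $v\wedge w:=v\otimes w-w\otimes v$; $A\wedge B$ is the span of all $a\wedge b$ with $a\in A$, $b\in B$. $\mathfrak{so}(V):=\bigwedge^2V\subseteq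 V\otimes V$ with the commutator bracket. $V$ is regarded as a $[\mathfrak{g},\mathfrak{g}]$-module on which $\mathfrak{so}(V)$ acts naturally and all other direct summands of $[\mathfrak{g},\mathfrak{g}]$ act trivially, and it is endowed with a $\mathfrak{g}$-module structure extending this one for which $\langle\cdot,\cdot\rangle$ is $\mathfrak{g}$-invariant (for $\mathfrak{g}=\mathfrak{so}(V)$ this is the natural module). For a subalgebra $\mathfrak{t}\subseteq\mathfrak{g}$ and $\alpha\in\mathfrak{t}^*$, $V^\alpha=V^\alpha(\mathfrak{t}):=\{m\in V:\exists\, i\in\mathbb{Z}_{>0}\text{ such that }(x-\alpha(x)1)^i\cdot m=0\ \forall x\in\mathfrak{t}\}$, and $\operatorname{supp}V:=\{\alpha\in\mathfrak{t}^*:V^\alpha\neq 0\}$. $\mathfrak{z}_{\mathfrak{k}}(\mathfrak{a})$ is the set of elements of $\mathfrak{k}$ commuting with all of $\mathfrak{a}$; $\mathfrak{z}(\mathfrak{k})$ is the center of $\mathfrak{k}$. ''Nilpotent of depth at most $2$'' means $[[\mathfrak{k},\mathfrak{k}],\mathfrak{k}]=0$. *)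

(* Defs.v *)
From HB Require Import structures.
From mathcomp Require Import all_boot all_order all_algebra.
From mathcomp Require Import all_classical reals complex.

Set Implicit Arguments.
Unset Strict Implicit.
Unset Printing Implicit Defensive.

Import GRing.Theory.
Local Open Scope ring_scope.
Local Open Scope classical_set_scope.

Section LinearAlgebra.
Variables (F : fieldType) (U : lmodType F).
Implicit Types A B M : set U.

Definition subspace A : Prop :=
  A 0 /\ forall (a : F) (x y : U), A x -> A y -> A (a *: x + y).

Definition span A : set U := smallest subspace A.

Definition finite_dim A : Prop := exists s : seq U, A = span [set` s].

Definition dim_one A : Prop := exists2 v : U, v != 0 & A = span [set v].

Definition countably_infinite_dim : Prop :=
  exists e : nat -> U,
    span (range e) = setT /\
    forall (n : nat) (c : 'I_n -> F),
      \sum_(i < n) c i *: e i = 0 -> forall i, c i = 0.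

Definition internal_direct_sum A B M : Prop :=
  M = [set a + b | a in A & b in B] /\ A `&` B = [set 0].

Definition internal_direct_sum_family (J : Type) (I : set J) (A : J -> set U)
    (M : set U) : Prop :=
  M = span (\bigcup_(j in I) A j) /\
  forall j, I j -> A j `&` span (\bigcup_(k in I `\ j) A k) `<=` [set 0].

(* The dual space of A.  Functions [A -> F] are defined on the subtype of
   elements of A, so equality in the dual is Leibniz equality, and [0], [- f]
   are the pointwise operations. *)
Definition dual A : set (A -> F) :=
  [set f : A -> F | forall (a : F) (x y z : A),
     val z = a *: val x + val y -> f z = a * f x + f y].

End LinearAlgebra.

Section Forms.
Variables (F : fieldType) (V : lmodType F) (form : {biscalar V}).

Definition form_symmetric : Prop := forall v w, form v w = form w v.

Definition form_nondegenerate : Prop :=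
  forall v, (forall w, form v w = 0) -> v = 0.

Definition orthogonal_sets (A B : set V) : Prop :=
  forall a b, A a -> B b -> form a b = 0.

(* The rank of the restriction of the form to A x A, i.e. the dimension of the
   image of A in the dual of A: e induces a basis of A modulo the radical of
   the restricted form. *)
Definition restricted_rank (A : set V) (n : nat) : Prop :=
  exists2 e : 'I_n -> V, (forall i, A (e i)) &
    forall v, A v -> exists! c : {ffun 'I_n -> F},
      forall w, A w -> form (v - \sum_i c i *: e i) w = 0.

(* V (x) V with its associative product and its action on V determined by the
   form.  Fields [tens_span] and [tens_lift] are the universal property of the
   tensor product: uniqueness and existence of liftings of bilinear maps. *)
Record tensor_square := TensorSquare {
  tens_sort :> lmodType F;
  tens : {bilinear V -> V -> tens_sort};
  tens_span : span [set tens v w | v in [set: V] & w in [set: V]] = setT;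
  tens_lift : forall (U : lmodType F) (f : {bilinear V -> V -> U}),
    exists g : {linear tens_sort -> U}, forall v w, g (tens v w) = f v w;
  tens_mul : {bilinear tens_sort -> tens_sort -> tens_sort};
  tens_mulE : forall v w v' w',
    tens_mul (tens v w) (tens v' w') = form v' w *: tens v w';
  tens_act : {bilinear tens_sort -> V -> V};
  tens_actE : forall v w u, tens_act (tens v w) u = form u w *: v
}.

Variable T : tensor_square.

Definition tens_comm (x y : T) : T := tens_mul T x y - tens_mul T y x.

Definition wedge (v w : V) : T := tens T v w - tens T w v.

Definition wedge_set (A B : set V) : set T :=
  span [set wedge a b | a in A & b in B].

Definition so : set T := wedge_set setT setT.

End Forms.

Arguments wedge_set {F V form} T A B.
Arguments so {F V form} T.

HB.mixin Record Lmodule_isLieAlgebra (F : fieldType) L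
    of GRing.Lmodule F L := {
  lie : L -> L -> L;
  lie_bilinear : bilinear_for *:%R *:%R lie;
  lie_alternating : forall x, lie x x = 0;
  lie_jacobi : forall x y z,
    lie x (lie y z) + lie y (lie z x) + lie z (lie x y) = 0
}.

#[short(type="lieAlgType")]
HB.structure Definition LieAlgebra (F : fieldType) :=
  { L of GRing.Lmodule F L & Lmodule_isLieAlgebra F L }.

HB.instance Definition _ (F : fieldType) (L : lieAlgType F) :=
  bilinear_isBilinear.Build F L L L *:%R *:%R (@lie F L) (@lie_bilinear F L).

(* Subalgebras, ideals, ... are subsets of an ambient Lie algebra g. *)
Section LieAlgebras.
Variables (F : fieldType) (g : lieAlgType F).
Implicit Types a h k l m t : set g.

Definition subalgebra k : Prop :=
  subspace k /\ forall x y, k x -> k y -> k (lie x y).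

Definition lie_set a k : set g := span [set lie x y | x in a & y in k].

Definition ideal_of a k : Prop :=
  [/\ subspace a, a `<=` k & forall x y, k x -> a y -> a (lie x y)].

Definition centralizer k a : set g :=
  [set x | k x /\ forall y, a y -> lie x y = 0].

Definition center k : set g := centralizer k k.

Definition normalizer k a : set g :=
  [set x | k x /\ forall y, a y -> a (lie x y)].

Definition nilpotent k : Prop :=
  exists n, iter n (lie_set k) k = [set 0].

Definition nilpotent_depth_le2 k : Prop :=
  lie_set (lie_set k k) k = [set 0].

(* The adjoint action of the elements of a on m is semisimple. *)
Definition ad_semisimple a m : Prop :=
  let stable w := [/\ subspace w, w `<=` m &
                      forall x y, a x -> w y -> w (lie x y)] in
  forall w, stable w -> exists2 w', stable w' & internal_direct_sum w w' m.

Definition reductive k : Prop :=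
  [/\ subalgebra k, finite_dim k & ad_semisimple k k].

Definition cartan_subalgebra h m : Prop :=
  [/\ subalgebra h, h `<=` m, nilpotent h & normalizer m h = h].

Definition root_space h m (alpha : h -> F) : set g :=
  [set x | m x /\ forall y : h, lie (val y) x = alpha y *: x].

Definition is_root h m (alpha : h -> F) : Prop :=
  [/\ dual alpha, alpha <> 0 & root_space m alpha <> [set 0]].

Definition root_inclusion_wrt h l m : Prop :=
  [/\ l `<=` m, cartan_subalgebra h m, cartan_subalgebra (l `&` h) l &
      forall alpha : (l `&` h) -> F, is_root l alpha ->
        exists2 beta : h -> F, is_root m beta &
          root_space m beta = root_space l alpha].

(* The ambient Lie algebra g is root-reductive, as the union of the gs i with
   Cartan subalgebras hs i.  The chain is indexed from 0. *)
Definition root_reductive (gs hs : nat -> set g) : Prop :=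
  [/\ forall i, reductive (gs i),
      forall i, cartan_subalgebra (hs i) (gs i),
      forall i, hs i = gs i `&` hs i.+1,
      forall i, root_inclusion_wrt (hs i.+1) (gs i) (gs i.+1) &
      \bigcup_i gs i = [set: g]].

Definition semisimple_elt (gs : nat -> set g) (x : g) : Prop :=
  exists i, gs i x /\ ad_semisimple [set x] (gs i).

Definition toral (gs : nat -> set g) t : Prop :=
  subalgebra t /\ forall x, t x -> semisimple_elt gs x.

Definition maximal_toral (gs : nat -> set g) t : Prop :=
  toral gs t /\ forall t', toral gs t' -> t `<=` t' -> t' = t.

End LieAlgebras.

Section LieModules.
Variables (F : fieldType) (g : lieAlgType F) (V : lmodType F).

Definition lie_module (rho : {bilinear g -> V -> V}) : Prop :=
  forall x y v, rho (lie x y) v = rho x (rho y v) - rho y (rho x v).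

Definition invariant_form (rho : {bilinear g -> V -> V}) (form : {biscalar V})
    : Prop :=
  forall x v w, form (rho x v) w + form v (rho x w) = 0.

(* The generalized weight space of alpha; the exponent does not depend on x. *)
Definition weight_space (rho : {bilinear g -> V -> V}) (t : set g)
    (alpha : t -> F) : set V :=
  [set m | exists2 i, (0 < i)%N &
     forall x : t, iter i (fun u => rho (val x) u - alpha x *: u) m = 0].

Definition supp (rho : {bilinear g -> V -> V}) (t : set g) : set (t -> F) :=
  [set alpha | dual alpha /\ weight_space rho alpha <> [set 0]].

Arguments supp : clear implicits.

Variables (form : {biscalar V}) (T : tensor_square form).

(* iota identifies so(V) with an ideal of [g, g] that has the ideal k as a
   complement; only the restriction of iota to so(V) matters. *)
Definition so_direct_summand (iota : T -> g) (k : set g) : Prop :=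
  let gg := lie_set [set: g] [set: g] in
  [/\ forall (a : F) (x y : T), so T x -> so T y ->
        iota (a *: x + y) = a *: iota x + iota y,
      forall x y, so T x -> so T y -> iota x = iota y -> x = y,
      forall x y, so T x -> so T y ->
        iota (tens_comm x y) = lie (iota x) (iota y) &
      [/\ ideal_of (iota @` so T) gg, ideal_of k gg &
          internal_direct_sum (iota @` so T) k gg]].

Definition extends_natural_module (rho : {bilinear g -> V -> V})
    (iota : T -> g) (k : set g) : Prop :=
  (forall x v, so T x -> rho (iota x) v = tens_act T x v) /\
  (forall y v, k y -> rho y v = 0).

(* iota is the identification of so(V) with its image in g. *)
Section Properties.
Variables (iota : T -> g) (rho : {bilinear g -> V -> V}) (t : set g).

Local Notation "''V^' alpha" := (weight_space rho alpha)
  (at level 8, alpha at level 2, format "''V^' alpha").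
Local Notation zso := (centralizer (iota @` so T) t).

Definition weight_pairing : Prop :=
  forall alpha beta : t -> F, dual alpha -> dual beta ->
    ~ orthogonal_sets form 'V^alpha 'V^beta ->
    beta = - alpha /\
    (alpha <> 0 -> dim_one 'V^alpha /\ dim_one 'V^(- alpha)).

Definition isotropic_pairs_central : Prop :=
  forall alpha : t -> F, dual alpha ->
    orthogonal_sets form 'V^alpha 'V^(- alpha) ->
    iota @` wedge_set T 'V^alpha 'V^(- alpha) `<=` center zso.

Definition zero_weight_condition : Prop :=
  (restricted_rank form 'V^(0 : t -> F) 0 \/
   restricted_rank form 'V^(0 : t -> F) 1) /\
  (iota @` wedge_set T 'V^(0 : t -> F) 'V^(0 : t -> F)) `&` t = [set 0].

Definition centralizer_condition : Prop := nilpotent_depth_le2 zso.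

Definition support_condition : Prop :=
  supp rho t = [set - alpha | alpha in supp rho t] /\
  forall alpha : t -> F, (supp rho t `\ 0) alpha -> dim_one 'V^alpha.

Definition decomposition_condition : Prop :=
  exists I : set (t -> F),
    [/\ I `&` [set - alpha | alpha in I] = set0,
        I `|` [set - alpha | alpha in I] = supp rho t `\ 0 &
        internal_direct_sum_family I
          (fun alpha => iota @` wedge_set T 'V^alpha 'V^(- alpha)) t].

End Properties.
End LieModules.

Arguments supp {F g V} rho t.

(* Main.v *)
(** The key point is that an element semisimple in some [gs i] acts diagonalizably on
    the whole of [g].  To pass from [l = gs i] to [m = gs i.+1], note that the nilpotent
    part of [ad x] on [m] is a derivation, hence inner by Cartan's criterion, say equal
    to [ad n] where [n] centralizes [l].  Comparing the roots of [l] with those of [m]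
    shows that [n] lies in the Cartan subalgebra of [m], hence is central.

    Consequently toral subalgebras are abelian, act diagonalizably on [V], and a maximal
    one contains every element commuting with it that acts diagonalizably on [g].  For
    isotropic [v] in [V^alpha] and [w] in [V^(-alpha)] with [<v, w> <> 0] the element
    [v /\ w] is of this kind, so it belongs to [t], and its action on [V] forces
    [V^alpha] and [V^(-alpha)] to be lines if [alpha <> 0], and is contradictory if
    [alpha = 0].  The other claims follow because the centralizer of [t] in [so(V)] is
    spanned by the spaces [V^alpha /\ V^(-alpha)]. *)

Require Import Defs.
From HB Require Import structures.
From mathcomp Require Import all_boot all_order all_algebra.
From mathcomp Require Import all_classical reals complex.
From mathcomp Require Import zify ring.
(* Again, since [vector] shadows [span]. *)
Import Defs.

Set Implicit Arguments.
Unset Strict Implicit.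
Unset Printing Implicit Defensive.

Import GRing.Theory Num.Theory.
Local Open Scope ring_scope.
Local Open Scope classical_set_scope.

(** * Subspaces and operators *)

(** Cartan's criterion is used only for the adjoint action of [m] on itself: on a reductive [m] the
    radical of the trace form is the center. Positivity enters through conjugation: the operator
    equal to the conjugate of [c] on the generalized eigenspace of [c] is a polynomial in [ad x]
    and, conjugation being additive, a derivation. A derivation is shown to be inner if it kills the
    center and maps into [[m, m]]; the semisimple part of [ad x] does both, as a polynomial in
    [ad x] without constant term.

    On the module side, the obstacle is that [V] need not be the sum of its weight spaces. However,
    an element [s] of [so(V)] commuting with [t] has a finite-dimensional [t]-stable range, which is
    such a sum, and [s] lies in the exterior square of this range; this is how the centralizer of
    [t] becomes accessible.

    The exterior square of [V^0] is controlled by rank: as the form on [V^0] has rank at most 1,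
    products of two of its elements vanish on [V^0]. This yields depth 2, and in the converse it
    makes the part of a larger toral subalgebra outside [t] nilpotent, hence 0. *)

Section Subspaces.
Variables (F : fieldType) (U : lmodType F).
Implicit Types (A B : set U) (u v : U).

Lemma subspace0 A : subspace A -> A 0. Proof. by case. Qed.

Lemma subspaceZ A a u : subspace A -> A u -> A (a *: u).
Proof. by case=> A0 AL Au; rewrite -[_ *: _]addr0; apply: AL. Qed.

Lemma subspaceD A u v : subspace A -> A u -> A v -> A (u + v).
Proof. by case=> A0 AL Au Av; rewrite -[u]scale1r; apply: AL. Qed.

Lemma subspaceN A u : subspace A -> A u -> A (- u).
Proof. by move=> sA Au; rewrite -scaleN1r; apply: subspaceZ. Qed.

Lemma subspaceB A u v : subspace A -> A u -> A v -> A (u - v).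
Proof. by move=> sA Au Av; apply: subspaceD => //; apply: subspaceN. Qed.

Lemma subspace_sum A (I : Type) (r : seq I) (P : pred I) (f : I -> U) :
  subspace A -> (forall i, P i -> A (f i)) -> A (\sum_(i <- r | P i) f i).
Proof.
move=> sA Af; elim/big_ind : _ => //; first exact: subspace0.
by move=> u v; apply: subspaceD.
Qed.

Lemma subspaceI A B : subspace A -> subspace B -> subspace (A `&` B).
Proof.
move=> sA sB; split; first by split; apply: subspace0.
move=> a x y [Ax Bx] [Ay By]; split; apply: subspaceD => //; exact: subspaceZ.
Qed.

Lemma subspaceT : subspace [set: U]. Proof. by split. Qed.

Lemma subspace_set0 : subspace [set 0 : U].
Proof. by split=> // a x y /= -> ->; rewrite scaler0 addr0. Qed.

Lemma span_subspace A : subspace (span A).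
Proof.
split=> [|a x y Ax Ay] B [sB AB]; first exact: subspace0.
by apply: subspaceD => //; [apply: subspaceZ => //; apply: Ax|apply: Ay].
Qed.
Hint Resolve span_subspace : core.

Lemma spanZ A a u : span A u -> span A (a *: u).
Proof. by move=> Au; apply: (@subspaceZ (span A)). Qed.

Lemma spanD A u v : span A u -> span A v -> span A (u + v).
Proof. by move=> Au Av; apply: (@subspaceD (span A)). Qed.

Lemma span_sum A (I : Type) (r : seq I) (P : pred I) (f : I -> U) :
  (forall i, P i -> span A (f i)) -> span A (\sum_(i <- r | P i) f i).
Proof. by move=> Af; apply: (@subspace_sum (span A)). Qed.

Lemma sub_span A : A `<=` span A.
Proof. by move=> x Ax B [_]; apply. Qed.

Lemma span_min A B : subspace B -> A `<=` B -> span A `<=` B.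
Proof. by move=> sB AB x; apply. Qed.

Lemma spanS A B : A `<=` B -> span A `<=` span B.
Proof. by move=> AB; apply: span_min => // x /AB; apply: sub_span. Qed.

Lemma span0 A : A `<=` [set 0] -> span A = [set 0].
Proof.
move=> A0; apply/seteqP; split; first by apply: span_min => //; exact: subspace_set0.
by move=> _ ->; apply: subspace0.
Qed.

(** As [A] absorbs scalars, a linear combination is a plain sum over a list, which suits inductions
    on the number of terms. *)
Lemma span_sumP A u : (forall a x, A x -> A (a *: x)) -> span A u ->
  exists2 s : seq U, {in s, forall x, A x} & u = \sum_(x <- s) x.
Proof.
move=> AZ; pose B := [set u | exists2 s : seq U,
  {in s, forall x, A x} & u = \sum_(x <- s) x].
apply: (@span_min _ B) => [|x Ax]; last first.
  by exists [:: x]; rewrite ?big_seq1// => y; rewrite inE => /eqP->.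
split; first by exists [::]; rewrite ?big_nil.
move=> a x y [s As ->] [t At ->]; exists (map ( *:%R a) s ++ t).
  move=> z; rewrite mem_cat => /orP[/mapP[w ws ->]|]; last exact: At.
  by apply: AZ; apply: As.
by rewrite big_cat big_map scaler_sumr.
Qed.

Lemma span_seqP (s : seq U) u :
  span [set` s] u <-> exists c : 'rV[F]_(size s), u = \sum_i c 0 i *: s`_i.
Proof.
split; last first.
  move=> [c ->]; apply: span_sum => // i _; apply: spanZ.
  have si : s`_i \in s by apply: mem_nth.
  by apply: sub_span.
pose B := [set u | exists c : 'rV[F]_(size s), u = \sum_i c 0 i *: s`_i].
apply: (@span_min _ B) => [|x /= xs]; last first.
  have xi : (index x s < size s)%N by rewrite index_mem.
  exists (delta_mx 0 (Ordinal xi)); rewrite (bigD1 (Ordinal xi))//= big1.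
    by rewrite mxE !eqxx scale1r addr0 nth_index.
  by move=> i ine; rewrite mxE (negPf ine) andbF scale0r.
split; first by exists 0; rewrite big1// => i _; rewrite mxE scale0r.
move=> a _ _ [c ->] [d ->]; exists (a *: c + d).
by rewrite scaler_sumr -big_split; apply: eq_bigr => i _; rewrite !mxE scalerDl scalerA.
Qed.

Lemma finite_dim_subspace A : finite_dim A -> subspace A.
Proof. by case=> s ->. Qed.

Definition coordinates n (A : set U) (e : 'rV[F]_n -> U) :=
  [/\ linear e, injective e & range e = A].

Lemma lin0 (W : lmodType F) (f : U -> W) : linear f -> f 0 = 0.
Proof. by move=> lf; have := lf (-1) 0 0; rewrite scaleN1r oppr0 addr0 scaleN1r addNr. Qed.
Lemma linD (W : lmodType F) (f : U -> W) u v : linear f -> f (u + v) = f u + f v.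
Proof. by move=> lf; have := lf 1 u v; rewrite !scale1r. Qed.
Lemma linZ (W : lmodType F) (f : U -> W) a u : linear f -> f (a *: u) = a *: f u.
Proof. by move=> lf; have := lf a u 0; rewrite (lin0 lf) !addr0. Qed.
Lemma linN (W : lmodType F) (f : U -> W) u : linear f -> f (- u) = - f u.
Proof. by move=> lf; rewrite -scaleN1r linZ// scaleN1r. Qed.
Lemma linB (W : lmodType F) (f : U -> W) u v : linear f -> f (u - v) = f u - f v.
Proof. by move=> lf; rewrite linD// linN. Qed.
Lemma lin_sum (W : lmodType F) (f : U -> W) (I : Type) (r : seq I) (P : pred I) (h : I -> U) :
  linear f -> f (\sum_(i <- r | P i) h i) = \sum_(i <- r | P i) f (h i).
Proof.
move=> lf; apply: (big_morph f); last exact: lin0.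
by move=> u v; apply: linD.
Qed.

End Subspaces.
#[export] Hint Resolve span_subspace : core.

Section Dim.
Variables (F : fieldType) (U : lmodType F).
Implicit Types (A B : set U) (u v : U).

(** A spanning list of minimal length is a basis: a nontrivial relation would allow one entry to be
    dropped. *)
Lemma finite_dimP A : finite_dim A -> exists n (e : 'rV[F]_n -> U), coordinates A e.
Proof.
move=> [s0 defA]; pose P k := `[< exists2 s : seq U, size s = k & A = span [set` s] >].
have exP : exists k, P k by exists (size s0); apply/asboolP; exists s0.
case: (ex_minnP exP) => k /asboolP[s sk As] mink {exP s0 defA}.
exists (size s), (fun c : 'rV[F]_(size s) => \sum_i c 0 i *: s`_i); split.
- move=> a c d; rewrite scaler_sumr -big_split.
  by apply: eq_bigr => i _; rewrite !mxE scalerDl scalerA.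
- move=> c d; apply: contra_eq => /eqP cd.
  have /rV0Pn[j dj] : c - d != 0 by rewrite subr_eq0; apply/eqP.
  apply/eqP => /eqP; rewrite -subr_eq0 -sumrB => /eqP E.
  have {}E : \sum_i (c - d) 0 i *: s`_i = 0.
    by rewrite -[RHS]E; apply: eq_bigr => i _; rewrite !mxE scalerBl.
  pose s' := take j s ++ drop j.+1 s.
  have sS : {subset s' <= s}.
    by move=> x; rewrite mem_cat => /orP[/mem_take|/mem_drop].
  have rs (i : 'I_(size s)) : i != j -> span [set` s'] s`_i.
    move=> ij; apply: sub_span; rewrite /= mem_cat.
    have [ltij|leji] := ltnP i j.
      by rewrite -(nth_take 0 ltij) mem_nth// size_take ltn_ord.
    have {ij}ltji : (j < i)%N by rewrite ltn_neqAle eq_sym (inj_eq val_inj) ij.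
    apply/orP; right; rewrite -(subnKC ltji) -nth_drop mem_nth// size_drop.
    by rewrite ltn_sub2r// (leq_ltn_trans ltji).
  have : P (size s').
    apply/asboolP; exists s' => //; rewrite As; apply/seteqP; split; last first.
      by apply: spanS => x /= /sS.
    apply: span_min => // x /= xs.
    have xi : (index x s < size s)%N by rewrite index_mem.
    have {xs}-> : x = s`_(Ordinal xi) by rewrite /= nth_index.
    have [->|] := eqVneq (Ordinal xi) j; last exact: rs.
    have -> : s`_j = - ((c - d) 0 j)^-1 *: \sum_(i | i != j) (c - d) 0 i *: s`_i.
      move: E; rewrite (bigD1 j)//= => /eqP; rewrite addrC addr_eq0 => /eqP->.
      by rewrite scalerN scaleNr opprK scalerA mulVf// scale1r.
    apply: spanZ; apply: span_sum => i ij.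
    by apply: spanZ; apply: rs.
  move=> /mink; rewrite -sk size_cat size_drop size_take ltn_ord.
  by have := ltn_ord j; lia.
- rewrite As; apply/seteqP; split=> u.
    by move=> [c _ <-]; apply/span_seqP; exists c.
  by move=> /span_seqP[c ->]; exists c.
Qed.

End Dim.

Section PolynomialAction.
Variables (F : fieldType) (U : lmodType F).
Implicit Types (A B : set U) (u v : U) (f h : U -> U) (p q : {poly F}) (c : F).

Definition papply p f u : U := \sum_(i < size p) p`_i *: iter i f u.

Definition gen_eigen f c u := exists k, papply (('X - c%:P) ^+ k) f u = 0.

Definition stable A f := forall u, A u -> A (f u).

Lemma linear_iter f k : linear f -> linear (iter k f).
Proof. by move=> lf; elim: k => [|k IH] a x y //=; rewrite IH lf. Qed.

Lemma papply_wide p f u n : (size p <= n)%N ->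
  papply p f u = \sum_(i < n) p`_i *: iter i f u.
Proof.
move=> pn; rewrite /papply (big_ord_widen n (fun i => p`_i *: iter i f u))//.
rewrite big_mkcond /=; apply: eq_bigr => i _.
by case: ltnP => // /(nth_default 0)->; rewrite scale0r.
Qed.

Lemma papply_linear p f : linear f -> linear (papply p f).
Proof.
move=> lf a x y; rewrite /papply scaler_sumr -big_split; apply: eq_bigr => i _.
by rewrite /= (linear_iter i lf) scalerDr !scalerA mulrC.
Qed.

Lemma papply0 f u : papply 0 f u = 0.
Proof. by rewrite /papply size_poly0 big_ord0. Qed.

Lemma papplyD p q f u : papply (p + q) f u = papply p f u + papply q f u.
Proof.
set n := maxn (size p) (size q).
rewrite !(@papply_wide _ _ _ n) ?leq_maxl ?leq_maxr ?size_polyD//.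
by rewrite -big_split; apply: eq_bigr => i _; rewrite coefD scalerDl.
Qed.

Lemma papplyZ a p f u : papply (a *: p) f u = a *: papply p f u.
Proof.
rewrite (@papply_wide _ _ _ (size p)) ?size_scale_leq// /papply scaler_sumr.
by apply: eq_bigr => i _; rewrite coefZ scalerA.
Qed.

Lemma papplyC c f u : papply c%:P f u = c *: u.
Proof.
by rewrite (@papply_wide _ _ _ 1) ?size_polyC_leq1// big_ord1 coefC.
Qed.

Lemma papplyN p f u : papply (- p) f u = - papply p f u.
Proof. by rewrite -[in LHS]scaleN1r papplyZ scaleN1r. Qed.

Lemma papplyB p q f u : papply (p - q) f u = papply p f u - papply q f u.
Proof. by rewrite papplyD papplyN. Qed.

Lemma papplyMX p f u : papply (p * 'X) f u = papply p f (f u).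
Proof.
rewrite (@papply_wide _ _ _ (size p).+1); last first.
  by have [->|p0] := eqVneq p 0; rewrite ?mul0r ?size_poly0// size_mulX.
rewrite big_ord_recl coefMX eqxx scale0r add0r; apply: eq_bigr => i _.
by rewrite coefMX /= -iterSr.
Qed.

Lemma papplyX f u : papply 'X f u = f u.
Proof. by rewrite -['X]mul1r papplyMX -polyC1 papplyC scale1r. Qed.

Lemma papplyXsubC c f u : papply ('X - c%:P) f u = f u - c *: u.
Proof. by rewrite papplyB papplyX papplyC. Qed.

Lemma papplyM p q f u : linear f -> papply (p * q) f u = papply p f (papply q f u).
Proof.
move=> lf; elim/poly_ind: p u => [|p c IH] u; first by rewrite mul0r !papply0.
rewrite mulrDl -mulrA ['X * q]mulrC mulrA !papplyD papplyMX IH papplyMX.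
rewrite papplyC mul_polyC papplyZ; congr (papply p f _ + _).
elim/poly_ind: q {IH} u => [|q d IH] u; first by rewrite !papply0 (lin0 lf).
by rewrite !papplyD !papplyC !papplyMX IH (linD _ _ lf) (linZ _ _ lf).
Qed.

Lemma papply_stable A p f u : subspace A -> stable A f -> A u -> A (papply p f u).
Proof.
move=> sA Af Au; apply: subspace_sum => // i _; apply: subspaceZ => //.
by elim: (nat_of_ord i) => //= k IH; apply: Af.
Qed.

Lemma papply_comm A p f h u : linear h -> stable A f ->
  (forall v, A v -> h (f v) = f (h v)) -> A u ->
  h (papply p f u) = papply p f (h u).
Proof.
move=> lh Af hf Au; rewrite (lin_sum _ _ _ lh); apply: eq_bigr => i _.
rewrite (linZ _ _ lh); congr (_ *: _).
elim: (nat_of_ord i) => //= k <-; apply: hf.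
by elim: k => //= k; apply: Af.
Qed.

Lemma papply_eigen p f c u : linear f -> f u = c *: u -> papply p f u = p.[c] *: u.
Proof.
move=> lf fu; rewrite horner_coef scaler_suml; apply: eq_bigr => i _.
rewrite -scalerA; congr (_ *: _); elim: (nat_of_ord i) => [|k IH] /=.
  by rewrite expr0 scale1r.
by rewrite IH (linZ _ _ lf) fu scalerA -exprSr.
Qed.

Lemma papply_dvd p q f u : linear f -> p %| q -> papply p f u = 0 -> papply q f u = 0.
Proof.
move=> lf /dvdpP[r ->] pu; rewrite papplyM// pu.
exact/lin0/papply_linear.
Qed.

Lemma papply_coprime p q f u : linear f -> coprimep p q ->
  papply p f u = 0 -> papply q f u = 0 -> u = 0.
Proof.
move=> lf /Bezout_eq1_coprimepP[[a b] /= ab1] pu qu.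
rewrite -[u]scale1r -(papplyC 1 f u) polyC1 -ab1 papplyD !papplyM// pu qu.
by rewrite !(lin0 (papply_linear _ lf)) addr0.
Qed.

Lemma gen_eigen_iterP f c u :
  linear f -> gen_eigen f c u <-> exists k, iter k (fun v => f v - c *: v) u = 0.
Proof.
move=> lf; have E k : papply (('X - c%:P) ^+ k) f u = iter k (fun v => f v - c *: v) u.
  elim: k => [|k IH]; first by rewrite expr0 -polyC1 papplyC scale1r.
  by rewrite exprS papplyM// IH papplyXsubC.
by split=> -[k]; [rewrite E|rewrite -E]; exists k.
Qed.

Lemma gen_eigen_eigen f c u : linear f -> f u = c *: u -> gen_eigen f c u.
Proof. by move=> lf fu; exists 1; rewrite expr1 papplyXsubC fu subrr. Qed.

Lemma gen_eigen_shift f c u : linear f -> gen_eigen f c (f u - c *: u) -> gen_eigen f c u.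
Proof. by move=> lf [k E]; exists k.+1; rewrite exprSr papplyM// papplyXsubC. Qed.

Lemma gen_eigen0 f c : linear f -> gen_eigen f c 0.
Proof. by move=> lf; exists 0; rewrite (lin0 (papply_linear _ lf)). Qed.

Lemma gen_eigen_subspace f c : linear f -> subspace [set u | gen_eigen f c u].
Proof.
move=> lf; split; first exact: gen_eigen0.
move=> a x y [k kx] [l ly]; exists (k + l)%N.
rewrite (papply_linear _ lf) exprD [in X in a *: X]mulrC !papplyM// kx ly.
by rewrite !(lin0 (papply_linear _ lf)) scaler0 addr0.
Qed.

Lemma coprimep_exp_XsubC c d k l : c != d ->
  coprimep (('X - c%:P) ^+ k) (('X - d%:P) ^+ l).
Proof.
move=> cd; apply/coprimep_expl/coprimep_expr.
by rewrite coprimep_XsubC2// subr_eq0 eq_sym.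
Qed.

Lemma prod_XsubC_split c (rs : seq F) :
  \prod_(z <- rs) ('X - z%:P) =
  ('X - c%:P) ^+ (count_mem c rs) * \prod_(z <- rs | z != c) ('X - z%:P).
Proof.
elim: rs => [|z rs IH]; first by rewrite !big_nil expr0 mulr1.
rewrite !big_cons IH /=; have [->|zc] := eqVneq z c.
  by rewrite add1n exprS mulrA.
by rewrite add0n mulrCA.
Qed.

Lemma coprimep_prod_ne c k (rs : seq F) :
  coprimep (('X - c%:P) ^+ k) (\prod_(z <- rs | z != c) ('X - z%:P)).
Proof.
elim/big_ind: _ => [|p q cp cq|z zc]; first exact: coprimep1.
  by rewrite coprimepMr cp.
by rewrite -['X - z%:P]expr1 coprimep_exp_XsubC// eq_sym.
Qed.

(** What the claimed power leaves of [u] is killed both by a power of [X - c] and by the product of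
    the other factors, which are coprime. *)
Lemma gen_eigen_count f c u (rs : seq F) : linear f ->
  papply (\prod_(z <- rs) ('X - z%:P)) f u = 0 -> gen_eigen f c u ->
  papply (('X - c%:P) ^+ count_mem c rs) f u = 0.
Proof.
move=> lf rsu [k cku].
apply: (@papply_coprime (('X - c%:P) ^+ k) (\prod_(z <- rs | z != c) ('X - z%:P)) f) => //.
- exact: coprimep_prod_ne.
- by rewrite -papplyM// mulrC papplyM// cku (lin0 (papply_linear _ lf)).
- by rewrite -papplyM// mulrC -prod_XsubC_split.
Qed.

Lemma gen_eigen_exponent f c u (rs : seq F) : linear f ->
  papply (\prod_(z <- rs) ('X - z%:P)) f u = 0 -> gen_eigen f c u ->
  papply (('X - c%:P) ^+ size rs) f u = 0.
Proof.
move=> lf rsu cu; apply: papply_dvd (gen_eigen_count lf rsu cu) => //.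
by rewrite dvdp_exp2l// count_size.
Qed.

(** Primary decomposition: a Bezout relation splits [u] into a vector killed by a power of [X - c]
    and one killed by the remaining factors, to which induction applies. *)
Lemma gen_eigen_span f u (rs : seq F) A : linear f -> subspace A -> stable A f -> A u ->
  papply (\prod_(z <- rs) ('X - z%:P)) f u = 0 ->
  span [set w | A w /\ exists c, gen_eigen f c w] u.
Proof.
move=> lf sA Af; have [n] := ubnP (size rs); elim: n => // n IH in rs u *.
case: rs => [|c rs] rsn Au.
  by rewrite big_nil -polyC1 papplyC scale1r => ->; apply: subspace0.
rewrite (prod_XsubC_split c); set m := count_mem _ _; set q := (\prod_(z <- _ | _) _).
have /Bezout_eq1_coprimepP[[a b] /= ab1] : coprimep (('X - c%:P) ^+ m) q.
  exact: coprimep_prod_ne.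
move=> E; rewrite -[u]scale1r -(papplyC 1 f u) polyC1 -ab1 papplyD.
apply: spanD.
  apply: (IH [seq z <- rs | z != c]).
  - by rewrite size_filter (leq_ltn_trans (count_size _ _)).
  - exact: papply_stable.
  - have -> : \prod_(z <- [seq z <- rs | z != c]) ('X - z%:P) = q.
      by rewrite big_filter /q big_cons eqxx.
    by rewrite -papplyM// [q * _]mulrC -mulrA papplyM// E (lin0 (papply_linear _ lf)).
apply: sub_span; split; first exact: papply_stable.
exists c; exists m; rewrite -papplyM// mulrCA papplyM// E.
exact/lin0/papply_linear.
Qed.

(* The Chinese remainder theorem makes any function of the eigenvalue a
   polynomial in the operator. *)
Lemma poly_interpolation (rs : seq F) (phi : F -> F) N : uniq rs ->
  exists p, forall c, c \in rs -> ('X - c%:P) ^+ N %| p - (phi c)%:P.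
Proof.
elim: rs => [|c rs IH] /=; first by exists 0.
move=> /andP[crs /IH[p0 Hp0]]; pose q := \prod_(d <- rs) ('X - d%:P) ^+ N.
have /Bezout_eq1_coprimepP[[a b] /= ab1] : coprimep (('X - c%:P) ^+ N) q.
  rewrite /q big_seq; elim/big_ind: _ => [|p r cp cr|z zrs]; first exact: coprimep1.
    by rewrite coprimepMr cp.
  by apply: coprimep_exp_XsubC; apply: contraNneq crs => ->.
(* [b * q] is 1 modulo the new power and 0 modulo the old ones, so only the value at [c] is
   corrected. *)
exists (p0 + ((phi c)%:P - p0) * (b * q)) => d; rewrite inE => /orP[/eqP->|drs].
  have -> : b * q = 1 - a * ('X - c%:P) ^+ N by rewrite -ab1 [a * _ + _]addrC addrK.
  rewrite mulrBr mulr1 addrA [p0 + _]addrC subrK addrAC subrr add0r.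
  by rewrite mulrA -mulNr dvdp_mulIr.
rewrite addrAC dvdp_add ?Hp0// !dvdp_mull//.
by rewrite /q (big_rem d)//= dvdp_mulIl.
Qed.

End PolynomialAction.

Section Coordinates.
Variables (F : fieldType) (U : lmodType F) (n : nat) (A : set U) (e : 'rV[F]_n -> U).
Hypothesis Ae : coordinates A e.
Implicit Types (B C : set U) (u : U) (f h : U -> U).

Let el : linear e. Proof. by case: Ae. Qed.
Let ei : injective e. Proof. by case: Ae. Qed.
Let Ar : range e = A. Proof. by case: Ae. Qed.

Lemma coordinates_mem v : A (e v). Proof. by rewrite -Ar; exists v. Qed.

Lemma coordinates_ex u : A u -> exists v, u = e v.
Proof. by rewrite -Ar => -[v _ <-]; exists v. Qed.

(** Take a matrix of maximal rank with row space inside [B]: adjoining a vector of [B] cannot raise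
    its rank. *)
Lemma subspace_mx B : subspace B ->
  exists M : 'M[F]_n, forall v, B (e v) <-> (v <= M)%MS.
Proof.
move=> sB; pose P k := `[< exists2 M : 'M[F]_n, \rank M = k &
  forall v, (v <= M)%MS -> B (e v) >].
have P0 : exists k, P k.
  exists 0; apply/asboolP; exists 0; first exact: mxrank0.
  by move=> v; rewrite submx0 => /eqP->; rewrite (lin0 el); apply: subspace0.
have Pn k : P k -> (k <= n)%N by move=> /asboolP[M <- _]; apply: rank_leq_row.
case: (ex_maxnP P0 Pn) => k /asboolP[M Mk MB] maxk; exists M => v; split; last exact: MB.
move=> Bv; have /maxk : P (\rank (M + v)%MS).
  apply/asboolP; exists (M + v)%MS => // w /sub_addsmxP[[x y] /= ->].
  rewrite (linD _ _ el); apply: subspaceD => //; first by apply/MB/submxMl.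
  rewrite [y]mx11_scalar mul_scalar_mx (linZ _ _ el); exact: subspaceZ.
rewrite -Mk => rk; apply: submx_trans (addsmxSr M v) _.
have /andP[_ //] : (M == M + v)%MS.
by rewrite -(mxrank_leqif_eq (addsmxSl M v)) eqn_leq rk mxrankS// addsmxSl.
Qed.

Definition coord u : 'rV[F]_n := xget 0 [set v | e v = u].

Lemma coordK u : A u -> e (coord u) = u.
Proof. by move=> /coordinates_ex[v ->]; apply: (@xgetPex _ 0 [set w | e w = e v]); exists v. Qed.

Lemma eK v : coord (e v) = v.
Proof. by apply: ei; rewrite coordK//; exact: coordinates_mem. Qed.

Definition operator_mx f : 'M[F]_n := \matrix_i coord (f (e (delta_mx 0 i))).

Lemma operator_mxE f v : linear f -> stable A f -> e (v *m operator_mx f) = f (e v).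
Proof.
move=> lf Af; rewrite [in RHS](row_sum_delta v) mulmx_sum_row.
rewrite (lin_sum _ _ _ el) (lin_sum _ _ _ el) (lin_sum _ _ _ lf).
apply: eq_bigr => i _; rewrite !(linZ _ _ el) (linZ _ _ lf) rowK coordK//.
exact/Af/coordinates_mem.
Qed.

Lemma operator_mx_uniq f M : (forall v, e (v *m M) = f (e v)) -> operator_mx f = M.
Proof.
by move=> Mf; apply/row_matrixP => i; rewrite rowK -Mf eK rowE.
Qed.

Lemma operator_mx_comp f h : linear f -> linear h -> stable A f -> stable A h ->
  operator_mx (f \o h) = operator_mx h *m operator_mx f.
Proof.
by move=> *; apply: operator_mx_uniq => v; rewrite mulmxA !operator_mxE.
Qed.

Lemma operator_mx_exp f k v : linear f -> stable A f ->
  e (v *m operator_mx f ^+ k) = iter k f (e v).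
Proof.
move=> lf Af; elim: k v => [|k IH] v; first by rewrite expr0 mulmx1.
by rewrite exprS mulmxA IH iterSr operator_mxE.
Qed.

End Coordinates.

(** The dimension has the form [n.+1] because [horner_mx] lives in the ring of matrices of positive
    size. *)
Lemma operator_mx_horner (F : fieldType) (U : lmodType F) n (A : set U)
    (e : 'rV[F]_n.+1 -> U) f p v : coordinates A e -> linear f -> stable A f ->
  e (v *m horner_mx (operator_mx e f) p) = papply p f (e v).
Proof.
move=> Ae lf Af; have [el _ _] := Ae.
rewrite -[p in LHS]coefK poly_def rmorph_sum mulmx_sumr.
rewrite (lin_sum _ _ _ el); apply: eq_bigr => i _.
rewrite -mul_polyC rmorphM/= horner_mx_C rmorphXn/= horner_mx_X.
by rewrite [_%:M * _]mul_scalar_mx -scalemxAr (linZ _ _ el) (operator_mx_exp Ae).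
Qed.

Section FiniteDim.
Variables (F : fieldType) (U : lmodType F).
Implicit Types (A B C : set U) (u : U) (f h : U -> U).

Lemma finite_dimS A B : finite_dim A -> subspace B -> B `<=` A -> finite_dim B.
Proof.
move=> /finite_dimP[n [e Ae]] sB BA; have [M MB] := subspace_mx Ae sB.
have [el _ _] := Ae.
exists [seq e (row i M) | i <- enum 'I_n]; apply/seteqP; split=> u.
  move=> Bu; have [v uv] := coordinates_ex Ae (BA _ Bu).
  move: Bu; rewrite uv => /MB/submxP[w ->]; rewrite mulmx_sum_row (lin_sum _ _ _ el).
  apply: span_sum => i _; rewrite (linZ _ _ el); apply: spanZ; apply: sub_span => /=.
  by apply/mapP; exists i; rewrite ?mem_enum.
apply: span_min => // x /= /mapP[i _ ->]; apply/MB; exact: row_sub.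
Qed.

(** A strictly monotone measure is all that inductions on subspaces and choices of maximal subspaces
    require. *)
Lemma finite_dim_rank A : finite_dim A -> exists d : set U -> nat, forall B C,
  subspace B -> subspace C -> B `<=` C -> C `<=` A ->
  (d B <= d C)%N /\ (~ C `<=` B -> (d B < d C)%N).
Proof.
move=> /finite_dimP[n [e Ae]].
have /choice[M MP] : forall B, exists M : 'M[F]_n, subspace B ->
    forall v, B (e v) <-> (v <= M)%MS.
  move=> B; have [sB|nsB] := pselect (subspace B); last by exists 0.
  by have [M ?] := subspace_mx Ae sB; exists M.
exists (fun B => \rank (M B)) => B C sB sC BC CA.
have MBC : (M B <= M C)%MS.
  by apply/row_subP => i; apply/MP => //; apply: BC; apply/MP => //; exact: row_sub.
split=> [|nCB]; first exact: mxrankS.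
rewrite ltn_neqAle mxrankS// andbT (mxrank_leqif_eq MBC); apply/negP => /andP[_ MCB].
apply: nCB => u Cu; have [v uv] := coordinates_ex Ae (CA _ Cu).
by move: Cu; rewrite uv => /(MP _ sC) vC; apply/(MP _ sB)/(submx_trans vC).
Qed.

Lemma finite_dim_ind A (P : set U -> Prop) : finite_dim A ->
  (forall B, subspace B -> B `<=` A ->
    (forall C, subspace C -> C `<=` B -> ~ B `<=` C -> P C) -> P B) -> P A.
Proof.
move=> fA IH; have sA := finite_dim_subspace fA.
have [d dP] := finite_dim_rank fA.
have H k : forall B, (d B < k)%N -> subspace B -> B `<=` A -> P B.
  elim: k => // k IHk B; rewrite ltnS => dB sB BA; apply: IH => // C sC CB nBC.
  apply: IHk => //; last exact: subset_trans BA.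
  by apply: leq_trans dB; apply: (dP _ _ sC sB CB BA).2.
exact: (H (d A).+1).
Qed.

Lemma finite_dim_max A (Q : set (set U)) : finite_dim A ->
  (forall B, Q B -> subspace B /\ B `<=` A) -> (exists B, Q B) ->
  exists2 B, Q B & forall C, Q C -> B `<=` C -> C `<=` B.
Proof.
move=> fA QA exQ; have sA := finite_dim_subspace fA.
have [d dP] := finite_dim_rank fA.
pose P k := `[< exists2 B, Q B & d B = k >].
have P0 : exists k, P k by case: exQ => B QB; exists (d B); apply/asboolP; exists B.
have PA k : P k -> (k <= d A)%N.
  by move=> /asboolP[B /QA[sB BA] <-]; apply: (dP _ _ sB sA BA _).1.
case: (ex_maxnP P0 PA) => k /asboolP[B QB Bk] maxk; exists B => // C QC BC.
have [sB BA] := QA _ QB; have [sC CA] := QA _ QC.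
have /maxk : P (d C) by apply/asboolP; exists C.
apply: contraPP => nCB; have := (dP _ _ sB sC BC CA).2 nCB.
by rewrite Bk ltnNge => /negP.
Qed.

Lemma operator_mxE_ext n A (e : 'rV[F]_n -> U) f h : coordinates A e ->
  (forall u, A u -> f u = h u) -> operator_mx e f = operator_mx e h.
Proof.
move=> Ae fh; apply/row_matrixP => i; rewrite !rowK fh//.
exact: coordinates_mem Ae _.
Qed.

(** In coordinates the functional kills the kernel of the Gram matrix [K], hence belongs to its row
    space. The form may be degenerate, as the trace form of a reductive algebra is. *)
Lemma functional_represented A (B : U -> U -> F) (l : U -> F) : finite_dim A ->
  (forall x y a z, A x -> A y -> A z -> B (a *: x + y) z = a * B x z + B y z) ->
  (forall x y a z, A x -> A y -> A z -> B z (a *: x + y) = a * B z x + B z y) ->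
  (forall x y a, A x -> A y -> l (a *: x + y) = a * l x + l y) ->
  (forall y, A y -> (forall x, A x -> B x y = 0) -> l y = 0) ->
  exists2 n, A n & forall y, A y -> l y = B n y.
Proof.
move=> /finite_dimP[n [e Ae]] Bl Br ll rad; have [el _ _] := Ae.
have em := coordinates_mem Ae.
have Blin z : A z -> linear (fun w => (B (e w) z : F^o)).
  by move=> Az a x y; rewrite el Bl.
have Brlin z : A z -> linear (fun w => (B z (e w) : F^o)).
  by move=> Az a x y; rewrite el Br.
have llin : linear (fun w => (l (e w) : F^o)) by move=> a x y; rewrite el ll.
pose K := \matrix_(i < n, j < n) B (e (delta_mx 0 i)) (e (delta_mx 0 j)).
pose L := \col_(i < n) l (e (delta_mx 0 i)).
have KE (u v : 'rV_n) : B (e u) (e v) = (u *m K *m v^T) 0 0.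
  rewrite {1}(row_sum_delta u) (lin_sum _ _ _ (Blin _ (em v))).
  rewrite -mulmxA mxE; apply: eq_bigr => i _; rewrite (linZ _ _ (Blin _ (em v))).
  congr (_ * _); rewrite {1}(row_sum_delta v) (lin_sum _ _ _ (Brlin _ (em _))) mxE.
  by apply: eq_bigr => j _; rewrite (linZ _ _ (Brlin _ (em _))) !mxE mulrC.
have LE (v : 'rV_n) : l (e v) = (v *m L) 0 0.
  rewrite {1}(row_sum_delta v) (lin_sum _ _ _ llin) mxE.
  by apply: eq_bigr => i _; rewrite (linZ _ _ llin) !mxE.
have /submxP[w Lw] : (L^T <= K)%MS.
  rewrite submxE; apply/eqP/row_matrixP => i; rewrite row0; apply/rowP => j; rewrite [RHS]mxE.
  rewrite ord1 row_id; set y := (col j (cokermx K))^T.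
  have -> : (L^T *m cokermx K) 0 j = (y *m L) 0 0.
    by rewrite !mxE; apply: eq_bigr => k _; rewrite !mxE mulrC.
  rewrite -LE; apply: rad; first exact: coordinates_mem Ae _.
  move=> x /(coordinates_ex Ae)[v ->]; rewrite KE /y trmxK -mulmxA.
  by rewrite colE [K *m _]mulmxA mulmx_coker mul0mx mulmx0 mxE.
exists (e w); first exact: coordinates_mem Ae _.
move=> y /(coordinates_ex Ae)[v ->]; by rewrite LE KE -Lw -trmx_mul [RHS]mxE.
Qed.

End FiniteDim.

(** By Schur's theorem the matrix is similar to a triangular one; [t] is its diagonal. *)
Lemma trace_horner (F : numClosedFieldType) n (M : 'M[F]_n.+1) :
  exists t : 'I_n.+1 -> F,
    (forall a, eigenvalue M a <-> exists i, a = t i) /\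
    forall q, \tr (horner_mx M q) = \sum_i q.[t i].
Proof.
have [P /unitarymx_unit Pu Ptrig] := Schur M (ltn0Sn n).
have [T [Ttrig MT]] : exists T : 'M[F]_n.+1, is_trig_mx T /\ M = invmx P *m T *m P.
  exists (P *m M *m invmx P); split; first by rewrite -mxred.conjumx.
  by rewrite !mulmxA mulVmx// mul1mx -mulmxA mulVmx// mulmx1.
exists (fun i => T i i); split=> [a|q]; last first.
  rewrite {1}MT horner_mx_uconjC// mxtrace_mulC mulmxA mulmxV// mul1mx.
  suff H p : is_trig_mx (horner_mx T p) /\ forall i, horner_mx T p i i = p.[T i i].
    by rewrite /mxtrace; apply: eq_bigr => i _; rewrite (H q).2.
  elim/poly_ind: p => [|p c [IH1 IH2]].
    rewrite rmorph0; split; first exact: mx0_is_trig.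
    by move=> i; rewrite mxE horner0.
  move/is_trig_mxP: (IH1) => IH; move/is_trig_mxP: (Ttrig) => TT.
  rewrite rmorphD rmorphM /= horner_mx_X horner_mx_C; split=> [|i].
    apply/is_trig_mxP => i j ij; rewrite !mxE big1 ?add0r => [|k _].
      by rewrite -val_eqE /= (ltn_eqF ij).
    have [ik|ki] := ltnP i k; first by rewrite IH// mul0r.
    by rewrite TT ?mulr0// (leq_ltn_trans ki).
  rewrite !mxE eqxx mulr1n hornerMXaddC (bigD1 i)//= IH2 big1 ?addr0// => k ki.
  have [ik|] := ltnP i k; first by rewrite IH// mul0r.
  by rewrite leq_eqVlt (inj_eq val_inj) (negPf ki) => /= lki; rewrite TT ?mulr0.
have detE : \det (M - a%:M) = \prod_i (T i i - a).
  have -> : M - a%:M = invmx P *m (T - a%:M) *m P.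
    by rewrite mulmxBr mulmxBl -MT mul_mx_scalar -scalemxAl mulVmx// scalemx1.
  rewrite !det_mulmx mulrAC -det_mulmx mulVmx// det1 mul1r det_trig; last first.
    apply/is_trig_mxP => i j ij; move/is_trig_mxP: Ttrig => /(_ i j ij) Tij.
    by rewrite !mxE Tij -val_eqE /= (ltn_eqF ij) subr0.
  by apply: eq_bigr => i _; rewrite !mxE eqxx.
rewrite /eigenvalue /eigenspace kermx_eq0 row_free_unit unitmxE detE unitfE negbK.
split=> [/prodf_eq0[i _]|[i ->]]; first by rewrite subr_eq0 => /eqP<-; exists i.
by apply/prodf_eq0; exists i; rewrite ?subrr.
Qed.

(** * Operators over an algebraically closed field, and their traces *)

Section ClosedField.
Variables (F : numClosedFieldType) (U : lmodType F).
Implicit Types (A B : set U) (u v : U) (f h : U -> U) (p q : {poly F}) (c : F).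

Definition operator A f := linear f /\ stable A f.

Definition nil_on A f := forall u, A u -> exists k, iter k f u = 0.

Lemma papply_XsubC0_exp f k u : linear f -> papply (('X - 0%:P) ^+ k) f u = iter k f u.
Proof.
move=> lf; elim: k u => [|k IH] u; first by rewrite expr0 -polyC1 papplyC scale1r.
by rewrite exprSr papplyM// IH papplyXsubC scale0r subr0 iterSr.
Qed.

Lemma nil_onP A f : linear f -> nil_on A f <-> forall u, A u -> gen_eigen f 0 u.
Proof.
move=> lf; by split=> nf u /nf[k] E; exists k; rewrite papply_XsubC0_exp in E *.
Qed.

Lemma annihilating_poly A f : finite_dim A -> operator A f ->
  exists rs : seq F, forall u, A u -> papply (\prod_(z <- rs) ('X - z%:P)) f u = 0.
Proof.
move=> /finite_dimP[[|n] [e Ae]] [lf Af]; have [el _ _] := Ae.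
  exists [::] => u /(coordinates_ex Ae)[v ->].
  by rewrite [v]thinmx0 (lin0 el) (lin0 (papply_linear _ lf)).
have [rs E] := closed_field_poly_normal (char_poly (operator_mx e f)).
exists rs => u /(coordinates_ex Ae)[v ->].
rewrite -(operator_mx_horner _ _ Ae)//; move: E.
rewrite (monicP (char_poly_monic _)) scale1r => <-.
by rewrite Cayley_Hamilton mulmx0 (lin0 el).
Qed.

Lemma span_gen_eigen A f u : finite_dim A -> operator A f -> A u ->
  span [set w | A w /\ exists c, gen_eigen f c w] u.
Proof.
move=> fA oA Au; have [rs rsA] := annihilating_poly fA oA; case: oA => lf Af.
by apply: (gen_eigen_span (rs := rs)) => //; [exact: finite_dim_subspace|exact: rsA].
Qed.

Lemma poly_of_operator A f (phi : F -> F) : finite_dim A -> operator A f ->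
  exists p, p.[0] = phi 0 /\
    forall c u, A u -> gen_eigen f c u -> papply p f u = phi c *: u.
Proof.
move=> fA oA; have [rs rsA] := annihilating_poly fA oA; case: oA => lf Af.
(* The point 0 is added to force [p.[0] = phi 0] even when 0 is not among the roots; this needs a
   positive exponent, hence the successor. *)
have [p pP] := poly_interpolation phi (size rs).+1 (undup_uniq (0 :: rs)).
exists p; split=> [|c u Au cu].
  have := pP 0; rewrite mem_undup mem_head => /(_ isT).
  move=> /(dvdp_trans (dvdp_exp2l _ (isT : (1 <= (size rs).+1)%N))).
  by rewrite expr1 dvdp_XsubCl /root hornerD hornerN hornerC subr_eq0 => /eqP.
have ku := gen_eigen_exponent lf (rsA _ Au) cu.
have [crs|crs] := boolP (c \in rs); last first.
  have -> : u = 0.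
    case: cu => k cu; apply: (papply_coprime lf _ cu (rsA _ Au)).
    have -> : \prod_(z <- rs) ('X - z%:P) = \prod_(z <- rs | z != c) ('X - z%:P).
      rewrite [in LHS]big_seq [in RHS]big_seq_cond; apply: eq_bigl => z.
      by case: (boolP (z \in rs)) => //= zrs; apply/esym; apply: contraNneq crs => <-.
    exact: coprimep_prod_ne.
  by rewrite (lin0 (papply_linear _ lf)) scaler0.
apply/eqP; rewrite -subr_eq0 -(papplyC _ f) -papplyB; apply/eqP.
apply: papply_dvd ku => //; apply: dvdp_trans (pP c _).
  by rewrite dvdp_exp2l.
by rewrite mem_undup inE crs orbT.
Qed.

Lemma nil_on_uniform A f : finite_dim A -> operator A f -> nil_on A f ->
  exists N, forall u, A u -> iter N f u = 0.
Proof.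
move=> fA oA nf; have [rs rsA] := annihilating_poly fA oA; have [lf Af] := oA.
exists (size rs) => u Au; have /nil_onP gf := nf.
have := gen_eigen_exponent lf (rsA _ Au) (gf lf _ Au).
by rewrite papply_XsubC0_exp.
Qed.

Lemma nil_on_comp A f h : finite_dim A -> operator A f -> operator A h ->
  (forall u, A u -> f (h u) = h (f u)) -> nil_on A f -> nil_on A (f \o h).
Proof.
move=> fA of_ oh fh /(nil_on_uniform fA of_)[N fN]; have [lf Af] := of_; have [lh Ah] := oh.
have Ait k v : A v -> A (iter k f v) by move=> Av; elim: k => //= k; apply: Af.
have comm k v : A v -> f (iter k h v) = iter k h (f v).
  by move=> Av; elim: k => //= k <-; rewrite fh//; elim: k => //= k; apply: Ah.
move=> u Au; exists N; suff -> : iter N (f \o h) u = iter N h (iter N f u).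
  by rewrite fN//; elim: (N) => //= k ->; exact: lin0.
by elim: N {fN} => //= k ->; apply: (comm k.+1); apply: Ait.
Qed.

Lemma gen_eigen_last A f c u : operator A f -> subspace A -> A u -> u != 0 ->
  gen_eigen f c u -> exists v, [/\ A v, v != 0 & f v = c *: v].
Proof.
move=> [lf Af] sA Au u0 cu.
have ex : exists k, papply (('X - c%:P) ^+ k) f u == 0 by case: cu => k /eqP; exists k.
case: (ex_minnP ex) => -[|k]; first by rewrite expr0 -polyC1 papplyC scale1r (negPf u0).
move=> /eqP E mink; exists (papply (('X - c%:P) ^+ k) f u); split.
- exact: papply_stable.
- by apply/negP => /mink; rewrite ltnn.
- by apply/eqP; rewrite -subr_eq0 -papplyXsubC -papplyM// -exprS E.
Qed.

Lemma eigenvector_exists A f u : finite_dim A -> operator A f -> A u -> u != 0 ->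
  exists c v, [/\ A v, v != 0 & f v = c *: v].
Proof.
move=> fA oA Au u0; have sA := finite_dim_subspace fA.
have [[w [Aw [c cw]] w0]|H] := pselect (exists2 w, A w /\ (exists c, gen_eigen f c w) & w != 0).
  by exists c; apply: gen_eigen_last cw.
have := span_gen_eigen fA oA Au; rewrite span0; first by move=> /eqP; rewrite (negPf u0).
by move=> w Aw; apply/eqP/negPn/negP => w0; apply: H; exists w.
Qed.

(** The properties of the trace used below, so that no coordinates appear in the Lie theory. The
    field [trace_conj] is the positivity behind Cartan's criterion. *)
Record trace_on A (tr : (U -> U) -> F) : Prop := TraceOn {
  trace_ext : forall f h, (forall u, A u -> f u = h u) -> tr f = tr h;
  trace_lin : forall a f h, operator A f -> operator A h ->
    tr (fun u => a *: f u + h u) = a * tr f + tr h;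
  trace_comm : forall f h, operator A f -> operator A h -> tr (f \o h) = tr (h \o f);
  trace_nil : forall f, operator A f -> nil_on A f -> tr f = 0;
  trace_conj : forall f s, operator A f -> operator A s ->
    (forall c u, A u -> gen_eigen f c u -> s u = c^* *: u) ->
    tr (f \o s) = 0 -> nil_on A f
}.

Lemma trace_exists A : finite_dim A -> exists tr, trace_on A tr.
Proof.
move=> fA; have /finite_dimP[[|n] [e Ae]] := fA; have [el _ _] := Ae.
  exists (fun=> 0); split=> //; first by move=> a f h; rewrite mulr0 addr0.
  by move=> f s _ _ _ _ u /(coordinates_ex Ae)[v ->]; exists 0; rewrite /= [v]thinmx0 (lin0 el).
have eigenP f c : operator A f -> eigenvalue (operator_mx e f) c ->
    exists v, [/\ A v, v != 0 & f v = c *: v].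
  move=> [lf Af] /eigenvalueP[v Ev v0]; exists (e v); split.
  - exact: coordinates_mem Ae _.
  - by apply: contra_neq v0 => ev; case: (Ae) => _ ei _; apply: ei; rewrite ev (lin0 el).
  - by rewrite -(operator_mxE Ae)// Ev (linZ _ _ el).
have eigenP' f c u : operator A f -> A u -> u != 0 -> f u = c *: u ->
    eigenvalue (operator_mx e f) c.
  move=> [lf Af] /(coordinates_ex Ae)[v ->] ev0 fv; apply/eigenvalueP; exists v.
    by case: (Ae) => _ ei _; apply: ei; rewrite (operator_mxE Ae)// fv (linZ _ _ el).
  by apply: contra_neq ev0 => ->; rewrite (lin0 el).
exists (fun f => \tr (operator_mx e f)); split.
- by move=> f h fh; rewrite (operator_mxE_ext Ae fh).
- move=> a f h [lf Af] [lh Ah]; rewrite -linearZ -linearD; congr (\tr _).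
  apply: (operator_mx_uniq Ae) => v.
  rewrite mulmxDr -scalemxAr (linD _ _ el) (linZ _ _ el).
  by rewrite !(operator_mxE Ae).
- move=> f h [lf Af] [lh Ah].
  rewrite (operator_mx_comp Ae lf lh Af Ah) (operator_mx_comp Ae lh lf Ah Af).
  exact: mxtrace_mulC.
- move=> f oA nf; have [lf Af] := oA; have [t [tP trP]] := trace_horner (operator_mx e f).
  rewrite -(horner_mx_X (operator_mx e f)) trP big1// => i _; rewrite hornerX.
  have /eigenP[//|v [Av v0 fv]] : eigenvalue (operator_mx e f) (t i) by apply/tP; exists i.
  have [k] := nf _ Av.
  have -> : iter k f v = (t i) ^+ k *: v.
    elim: k => [|k IH]; first by rewrite expr0 scale1r.
    by rewrite /= IH (linZ _ _ lf) fv scalerA -exprSr.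
  by move=> /eqP; rewrite scaler_eq0 (negPf v0) orbF expf_eq0 => /andP[_ /eqP].
- move=> f s oA [ls As] sP; have [lf Af] := oA.
  have [p [_ pP]] := poly_of_operator (fun c => c^*) fA oA.
  have sp u : A u -> s u = papply p f u.
    move=> Au; have sub : subspace [set w | s w = papply p f w].
      split; first by rewrite /= (lin0 ls) (lin0 (papply_linear _ lf)).
      by move=> a x y /= Ex Ey; rewrite ls (papply_linear _ lf) Ex Ey.
    apply: (span_min sub _ (span_gen_eigen fA oA Au)) => w /= [Aw [c cw]].
    by rewrite (sP _ _ Aw cw) (pP _ _ Aw cw).
  have -> : operator_mx e (f \o s) = horner_mx (operator_mx e f) (p * 'X).
    apply: (operator_mx_uniq Ae) => v; rewrite (operator_mx_horner _ _ Ae)//.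
    have Aev := coordinates_mem Ae v.
    rewrite papplyMX /= sp//; apply: esym; apply: (papply_comm (A := A)) => //.
  have [t [tP trP]] := trace_horner (operator_mx e f).
  rewrite trP => tr0.
  have t0 i : t i = 0.
    have E j : (p * 'X).[t j] = `|t j| ^+ 2.
      have /eigenP[//|v [Av v0 fv]] : eigenvalue (operator_mx e f) (t j) by apply/tP; exists j.
      have := pP _ _ Av (gen_eigen_eigen lf fv); rewrite (papply_eigen _ lf fv).
      move=> /eqP; rewrite -subr_eq0 -scalerBl scaler_eq0 (negPf v0) orbF subr_eq0.
      by move=> /eqP ptj; rewrite hornerMX ptj mulrC normCK.
    (* The trace is a sum of squared moduli of eigenvalues, so each eigenvalue vanishes. *)
    move/eqP: tr0; rewrite psumr_eq0 => [/allP/(_ i)|j _]; last by rewrite E exprn_ge0.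
    by rewrite mem_index_enum => /(_ isT); rewrite E expf_eq0 normr_eq0 => /andP[_ /eqP].
  apply/nil_onP => // u Au.
  have sub : forall w, A w /\ (exists c, gen_eigen f c w) -> gen_eigen f 0 w.
    move=> w [Aw [c cw]]; have [->|w0] := eqVneq w 0; first exact: gen_eigen0.
    have [v [Av v0 fv]] := gen_eigen_last oA (finite_dim_subspace fA) Aw w0 cw.
    have /tP[i ci] := eigenP' _ _ _ oA Av v0 fv.
    by rewrite t0 in ci; rewrite -ci.
  have [rs rsA] := annihilating_poly fA oA.
  exists (size rs).
  have subK : subspace [set w | papply (('X - 0%:P) ^+ size rs) f w = 0].
    split; first by rewrite /= (lin0 (papply_linear _ lf)).
    by move=> a x y /= Ex Ey; rewrite (papply_linear _ lf) Ex Ey scaler0 addr0.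
  apply: (span_min subK _ (span_gen_eigen fA oA Au)) => w Aw /=.
  by apply: gen_eigen_exponent (rsA _ Aw.1) (sub _ Aw).
Qed.

End ClosedField.

(** * Diagonalizable operators and joint eigenvectors *)

Section Diagonalizable.
Variables (F : fieldType) (U : lmodType F).
Implicit Types (A B : set U) (u v w : U) (f h : U -> U) (c : F).

(** Stated through spans, it applies to infinite-dimensional spaces, in particular to [ad x] on all
    of [g] and to the action on [V]. *)
Definition diag_on A f := forall u, A u -> span [set w | A w /\ exists c, f w = c *: w] u.

(** Being killed by a split polynomial with simple roots does not refer to [A]; this is what makes
    diagonalizability pass to stable subspaces. *)
Lemma span_eigenP A f u : subspace A -> linear f -> stable A f ->
  span [set w | A w /\ exists c, f w = c *: w] u <->
  A u /\ exists2 rs : seq F, uniq rs & papply (\prod_(z <- rs) ('X - z%:P)) f u = 0.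
Proof.
move=> sA lf Af; split=> [Eu|[Au [rs rsu rs0]]].
  split; first by apply: (span_min sA _ Eu) => w [].
  have [|s sE ->] := span_sumP _ Eu.
    move=> a w [Aw [c wc]]; split; first exact: subspaceZ.
    by exists c; rewrite (linZ _ _ lf) wc !scalerA mulrC.
  have [rs ur rss] : exists2 rs : seq F, uniq rs &
      forall w, w \in s -> exists2 c, c \in rs & f w = c *: w.
    elim: s sE {Eu u} => [|w s IH] sE; first by exists [::].
    have [|rs ur rss] := IH; first by move=> v vs; apply: sE; rewrite inE vs orbT.
    have [_ [c wc]] := sE w (mem_head _ _).
    exists (undup (c :: rs)); first exact: undup_uniq.
    move=> v; rewrite inE => /orP[/eqP->|/rss[d drs dv]].
      by exists c; rewrite // mem_undup mem_head.
    by exists d; rewrite // mem_undup inE drs orbT.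
  exists rs => //; rewrite (lin_sum _ _ _ (papply_linear _ lf)) big_seq big1// => w ws.
  have [c crs wc] := rss _ ws; rewrite (papply_eigen _ lf wc) horner_prod.
  by rewrite (big_rem c crs) /= hornerXsubC subrr mul0r scale0r.
pose B := A `&` [set w | papply (\prod_(z <- rs) ('X - z%:P)) f w = 0].
have sB : subspace B.
  apply: subspaceI => //; split; first by rewrite /= (lin0 (papply_linear _ lf)).
  by move=> a x y /= Ex Ey; rewrite (papply_linear _ lf) Ex Ey scaler0 addr0.
have Bf : stable B f.
  move=> w [Aw Ew]; split; first exact: Af.
  by rewrite /= -(papply_comm (A := A))// Ew (lin0 lf).
have Bu : B u by split.
apply: spanS (gen_eigen_span lf sB Bf Bu rs0) => w [[Aw Ew] [c cw]]; split => //; exists c.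
have := gen_eigen_count lf Ew cw; rewrite count_uniq_mem//.
case: (c \in rs); rewrite ?expr1 ?expr0.
  by rewrite papplyXsubC => /eqP; rewrite subr_eq0 => /eqP.
by rewrite -polyC1 papplyC scale1r => ->; rewrite (lin0 lf) scaler0.
Qed.

Lemma diag_onS A B f : subspace A -> subspace B -> linear f -> stable A f -> stable B f ->
  B `<=` A -> diag_on A f -> diag_on B f.
Proof.
move=> sA sB lf Af Bf BA dA u Bu; apply/span_eigenP => //; split => //.
by have /dA/span_eigenP[] := BA _ Bu.
Qed.

Lemma diag_on_gen A f c u : subspace A -> linear f -> stable A f -> diag_on A f ->
  A u -> gen_eigen f c u -> f u = c *: u.
Proof.
move=> sA lf Af dA Au cu; have /span_eigenP[//|//|//|_ [rs ur rs0]] := dA _ Au.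
have := gen_eigen_count lf rs0 cu; rewrite count_uniq_mem//.
case: (c \in rs); rewrite ?expr1 ?expr0.
  by rewrite papplyXsubC => /eqP; rewrite subr_eq0 => /eqP.
by rewrite -polyC1 papplyC scale1r => ->; rewrite (lin0 lf) scaler0.
Qed.

Lemma eigenspace_subspace A f c : subspace A -> linear f ->
  subspace (A `&` [set w | f w = c *: w]).
Proof.
move=> sA lf; apply: subspaceI => //; split; first by rewrite /= (lin0 lf) scaler0.
by move=> a x y /= Ex Ey; rewrite lf Ex Ey scalerDr !scalerA mulrC.
Qed.

Lemma diag_on_comm A f h a : subspace A -> linear f -> linear h ->
  stable A f -> stable A h -> (forall u, A u -> f (h u) = h (f u)) ->
  diag_on A f -> diag_on A h -> diag_on A (fun u => f u + a *: h u).
Proof.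
move=> sA lf lh Af Ah fh df dh u Au; apply: (span_min _ _ (df _ Au)) => // w [Aw [c wc]].
pose B := A `&` [set w | f w = c *: w].
have sB : subspace B by apply: eigenspace_subspace.
have Bh : stable B h.
  by move=> v [Av vc]; split; [exact: Ah|rewrite /= fh// vc (linZ _ _ lh)].
have dB : diag_on B h by apply: (diag_onS sA) => // v [].
have := dB w; move=> /(_ (conj Aw wc)); apply: spanS => v [[Av vc] [d vd]].
by split => //; exists (c + a * d); rewrite vc vd scalerDl scalerA.
Qed.

End Diagonalizable.

Section JointEigenvectors.
Variables (F : fieldType) (U : lmodType F) (I : Type) (P : set I) (op : I -> U -> U).
Implicit Types (A B J : set U) (u v w : U).

Definition joint_eigen A : set U :=
  [set w | A w /\ forall x, P x -> exists c, op x w = c *: w].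

(** Induction on the dimension: an operator of the family that is not scalar on [B] has proper
    eigenspaces that span [B], and the other operators preserve them. The family may be infinite. *)
Lemma joint_eigen_span A u : finite_dim A -> (forall x, P x -> linear (op x)) ->
  (forall x, P x -> stable A (op x)) -> (forall x, P x -> diag_on A (op x)) ->
  (forall x y v, P x -> P y -> A v -> op x (op y v) = op y (op x v)) ->
  A u -> span (joint_eigen A) u.
Proof.
move=> fA lin Ast dA comm; have sA := finite_dim_subspace fA.
suff H : (forall x, P x -> stable A (op x)) -> forall u, A u -> span (joint_eigen A) u.
  by move=> Au; apply: H.
clear u; apply: (@finite_dim_ind _ _ A (fun B =>
  (forall x, P x -> stable B (op x)) -> forall u, B u -> span (joint_eigen B) u)) fA _.
move=> B sB BA IH Bst u Bu.
have [scal|] := pselect (forall x, P x -> exists c, forall v, B v -> op x v = c *: v).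
  apply: sub_span; split => // x Px; have [c cP] := scal x Px; exists c; exact: cP.
move=> /existsNP[x /not_implyP[Px nscal]].
have dB : diag_on B (op x).
  by apply: (diag_onS sA) => //; [exact: lin|exact: Ast|exact: Bst|exact: dA].
apply: (span_min _ _ (dB _ Bu)) => // w [Bw [c wc]].
pose C := B `&` [set v | op x v = c *: v].
have : span (joint_eigen C) w.
  apply: IH => //.
  - by apply: eigenspace_subspace => //; exact: lin.
  - by move=> v [].
  - by move=> BC; apply: nscal; exists c => v /BC[].
  - move=> y Py v [Bv vc]; split; first exact: Bst.
    by rewrite /= comm ?vc ?(linZ _ _ (lin _ Py))//; apply: BA.
by apply: spanS => v [[Bv _] vJ]; split.
Qed.

Lemma span_weight0 J u : (forall x, P x -> linear (op x)) ->
  (forall a w, J w -> J (a *: w)) ->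
  (forall w x, J w -> P x -> exists c, op x w = c *: w) ->
  span J u -> (forall x, P x -> op x u = 0) ->
  span (J `&` [set w | forall x, P x -> op x w = 0]) u.
Proof.
move=> lin JZ Je /(span_sumP JZ)[s sJ ->]; have [n] := ubnP (size s).
elim: n => // n IH in s sJ *; rewrite ltnS => sn s0.
have [all0|] := pselect (forall w, w \in s -> forall x, P x -> op x w = 0).
  by rewrite big_seq; apply: span_sum => w ws; apply: sub_span; split; [exact: sJ|exact: all0].
move=> /existsNP[w /not_implyP[ws /existsNP[x /not_implyP[Px xw]]]].
have /choice[c cP] : forall v, exists c, v \in s -> op x v = c *: v.
  move=> v; have [vs|] := boolP (v \in s); last by exists 0.
  by have [c E] := Je _ _ (sJ _ vs) Px; exists c.
have cw0 : c w != 0 by apply: contra_notN xw => /eqP c0; rewrite cP// c0 scale0r.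
(* The right side is the sum minus [(c w)^-1] times its image under [op x]. That image is 0, while
   the term of [w] cancels, so the list gets shorter. *)
have E : \sum_(v <- s) v = \sum_(v <- [seq (1 - c v / c w) *: v | v <- rem w s]) v.
  have : op x (\sum_(v <- s) v) = 0 by apply: s0.
  rewrite (lin_sum _ _ _ (lin _ Px)) (big_rem w ws) /= cP// => /eqP.
  rewrite addrC addr_eq0 => /eqP E; rewrite big_map (big_rem w ws) /=.
  rewrite -[X in X + _ = _]scale1r -(mulVf cw0) -scalerA.
  rewrite -[c w *: w]opprK -E scalerN scaler_sumr -sumrN -big_split big_seq [RHS]big_seq.
  apply: eq_bigr => v /mem_rem vs; rewrite cP//= mulVf// scalerA scalerBl scale1r addrC. 
  by rewrite [_^-1 * _]mulrC.
rewrite E; apply: IH.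
- by move=> v /mapP[v' /mem_rem v's ->]; apply/JZ/sJ.
- by rewrite size_map size_rem//; case: (s) ws sn => //= ? ? _ /leq_trans-> .
- by move=> y Py; rewrite -E s0.
Qed.

End JointEigenvectors.

(** All eigenvalues are roots of one annihilating polynomial. Applied to strings of vectors
    [(ad e)^k w], whose eigenvalues form an arithmetic progression. *)
Lemma eigenvalues_finite (F : numClosedFieldType) (U : lmodType F) (A : set U)
    (f : U -> U) (v : nat -> U) (c : nat -> F) : finite_dim A -> operator A f ->
  injective c -> (forall k, A (v k)) -> (forall k, f (v k) = c k *: v k) ->
  exists k, v k = 0.
Proof.
move=> fA oA ci Av vc; have [rs rsA] := annihilating_poly fA oA; have [lf Af] := oA.
apply: contrapT => v0.
have crs k : c k \in rs.
  have := rsA _ (Av k); rewrite (papply_eigen _ lf (vc k)) => /eqP.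
  rewrite scaler_eq0 => /orP[|/eqP vk]; last by case: v0; exists k.
  by rewrite -/(root _ _) root_prod_XsubC.
have : (size (map c (iota 0 (size rs).+1)) <= size rs)%N.
  apply: uniq_leq_size; first by rewrite map_inj_uniq ?iota_uniq.
  by move=> _ /mapP[k _ ->].
by rewrite size_map size_iota ltnn.
Qed.

(** * Engel's theorem and reductive Lie algebras *)

Section LieBasics.
Variables (F : fieldType) (g : lieAlgType F).
Implicit Types (x y z u v : g) (a k m : set g).

Lemma lie_linear x : linear (lie x).
Proof. by case: (@lie_bilinear F g) => _ /(_ x). Qed.

Lemma lie_linearl y : linear (fun x => lie x y).
Proof. by case: (@lie_bilinear F g) => /(_ y). Qed.

Lemma lieDr x y z : lie x (y + z) = lie x y + lie x z.
Proof. exact: linD (lie_linear x). Qed.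
Lemma lieDl x y z : lie (x + y) z = lie x z + lie y z.
Proof. exact: linD (lie_linearl z). Qed.
Lemma lieBr x y z : lie x (y - z) = lie x y - lie x z.
Proof. exact: linB (lie_linear x). Qed.
Lemma lieBl x y z : lie (x - y) z = lie x z - lie y z.
Proof. exact: linB (lie_linearl z). Qed.
Lemma lieZr x (c : F) y : lie x (c *: y) = c *: lie x y.
Proof. exact: linZ (lie_linear x). Qed.
Lemma lieZl x (c : F) y : lie (c *: x) y = c *: lie x y.
Proof. exact: linZ (lie_linearl y). Qed.
Lemma lie0r x : lie x 0 = 0. Proof. exact: lin0 (lie_linear x). Qed.
Lemma lie0l x : lie 0 x = 0. Proof. exact: lin0 (lie_linearl x). Qed.
Lemma lieNr x y : lie x (- y) = - lie x y. Proof. exact: linN (lie_linear x). Qed.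
Lemma lieNl x y : lie (- x) y = - lie x y. Proof. exact: linN (lie_linearl y). Qed.

Lemma lieC x y : lie x y = - lie y x.
Proof.
have := lie_alternating (x + y); rewrite lieDr !lieDl !lie_alternating addr0 add0r.
by move=> /eqP; rewrite addrC addr_eq0 => /eqP.
Qed.

Lemma lieJ x y z : lie x (lie y z) = lie (lie x y) z + lie y (lie x z).
Proof.
have /eqP := lie_jacobi x y z; rewrite (lieC z (lie x y)) (lieC z x) lieNr.
by rewrite subr_eq0 subr_eq => /eqP.
Qed.

Lemma lie_lie x y z : lie (lie x y) z = lie x (lie y z) - lie y (lie x z).
Proof. by rewrite lieJ addrK. Qed.

Lemma lie_eq0C x y : lie x y = 0 -> lie y x = 0.
Proof. by move=> xy; rewrite lieC xy oppr0. Qed.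

Lemma subspace_lie_ker y : subspace [set x | lie x y = 0].
Proof.
split; first exact: lie0l.
by move=> a u v /= Eu Ev; rewrite lieDl lieZl Eu Ev scaler0 addr0.
Qed.

Lemma centralizer_subspace k a : subspace k -> subspace (centralizer k a).
Proof.
move=> sk; split; first by split; [exact: subspace0|move=> y _; exact: lie0l].
move=> c x y [kx xa] [ky ya]; split.
  by apply: subspaceD => //; apply: subspaceZ.
by move=> z az; rewrite lieDl lieZl xa// ya// scaler0 addr0.
Qed.

Lemma lie_set_subspace a k : subspace (lie_set a k).
Proof. exact: span_subspace. Qed.

Lemma lie_setS a a' k k' : a `<=` a' -> k `<=` k' -> lie_set a k `<=` lie_set a' k'.
Proof.
move=> aa' kk'; apply: spanS => _ [x ax [y ky <-]].
by exists x; [exact: aa'|exists y; [exact: kk'|]].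
Qed.

Lemma sub_lie_set a k x y : a x -> k y -> lie_set a k (lie x y).
Proof. by move=> ax ky; apply: sub_span; exists x => //; exists y. Qed.

Lemma lie_set_min a k (A : set g) : subspace A ->
  (forall x y, a x -> k y -> A (lie x y)) -> lie_set a k `<=` A.
Proof. by move=> sA H; apply: span_min => // _ [x ax [y ky <-]]; apply: H. Qed.

End LieBasics.
#[export] Hint Resolve lie_set_subspace : core.

Section Engel.
Variables (F : fieldType) (g : lieAlgType F).
Implicit Types (x y z u v : g) (a k m : set g).

(** Engel's theorem for the action of [k] on [U / W], phrased without the quotient: the class of [u]
    is nonzero and annihilated by [k]. *)
Let engel_prop k := forall U W : set g,
  subalgebra k -> subspace U -> subspace W -> W `<=` U -> ~ U `<=` W ->
  (forall x u, k x -> U u -> U (lie x u)) -> (forall x u, k x -> W u -> W (lie x u)) ->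
  (forall x u, k x -> U u -> exists n, W (iter n (lie x) u)) ->
  (forall x y, k x -> k y -> exists n, iter n (lie x) y = 0) ->
  exists u, [/\ U u, ~ W u & forall x, k x -> W (lie x u)].

Lemma engel k : finite_dim k -> engel_prop k.
Proof.
move=> fk; apply: (finite_dim_ind fk) => h sh hk IH U W [_ hh] sU sW WU nUW hU hW nU nh.
have fh : finite_dim h := finite_dimS fk sh hk.
have [h0|] := pselect (h `<=` [set 0]).
  have [u [Uu nWu]] : exists u, U u /\ ~ W u.
    by apply: contrapT => H; apply: nUW => u Uu; apply: contrapT => nWu; apply: H; exists u.
  by exists u; split=> // x /h0->; rewrite lie0l; apply: subspace0.
(* For a maximal proper subalgebra [k'], the induction hypothesis on [h / k'] yields [z] normalizing
   [k'], so that [h] is spanned by [z] and [k']. *)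
move=> nh0; pose Q k' := [/\ subalgebra k', k' `<=` h & ~ h `<=` k'].
have [||k' [[sk' kk'] k'h nhk'] maxk'] := finite_dim_max (Q := Q) fh.
- by move=> B [[sB _] Bh _].
- exists [set 0]; split=> //; last by move=> x ->; exact: subspace0.
  by split; [exact: subspace_set0|move=> x y -> _; rewrite /= lie0l].
have algk' : subalgebra k' by [].
have [||||z [hz nk'z k'z]] := IH _ sk' k'h nhk' h k' algk' sh sk' k'h nhk'.
- by move=> x u /k'h hx hu; apply: hh.
- exact: kk'.
- move=> x u /k'h hx hu; have [n E] := nh _ _ hx hu; exists n; rewrite E; exact: subspace0.
- by move=> x y /k'h hx /k'h; apply: nh.
pose k'' := [set a *: z + x | a in [set: F] & x in k'].
have hk'' : h `<=` k''.
  suff : ~ ~ h `<=` k'' by move=> /contrapT.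
  move=> nhk''; apply: nk'z; apply: (maxk' k''); last by exists 1 => //; exists 0;
    rewrite ?scale1r ?addr0//; exact: subspace0.
  - split=> //; last first.
      by move=> _ [a _ [x /k'h hx <-]]; apply: subspaceD => //; apply: subspaceZ.
    split; first split.
    + by exists 0 => //; exists 0; rewrite ?scale0r ?addr0//; exact: subspace0.
    + move=> c _ _ [a _ [x k'x <-]] [b _ [y k'y <-]]; exists (c * a + b) => //.
      exists (c *: x + y); first by apply: subspaceD => //; apply: subspaceZ.
      by rewrite scalerDr scalerDl scalerA addrACA.
    + move=> _ _ [a _ [x k'x <-]] [b _ [y k'y <-]]; exists 0 => //.
      exists (a *: lie z y - b *: lie z x + lie x y); last first.
        rewrite scale0r add0r lieDl !lieDr !lieZl !lieZr lie_alternating !scaler0 add0r.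
        by rewrite (lieC x z) scalerN addrA.
      have k'lz v : k' v -> k' (lie z v).
        by move=> k'v; rewrite lieC; apply: subspaceN => //; apply: k'z.
      apply: subspaceD => //; last exact: kk'.
      by apply: subspaceB => //; apply: subspaceZ => //; apply: k'lz.
  - by move=> x k'x; exists 0 => //; exists x; rewrite ?scale0r ?add0r.
have [||||u [Uu nWu k'u]] := IH _ sk' k'h nhk' U W algk' sU sW WU nUW.
- by move=> x u /k'h; apply: hU.
- by move=> x u /k'h; apply: hW.
- by move=> x u /k'h; apply: nU.
- by move=> x y /k'h hx /k'h; apply: nh.
(* All the [u_ n] are annihilated by [k'] modulo [W], since [z] normalizes [k']; the last one
   outside [W] is also annihilated by [z]. *)
pose u_ n := iter n (lie z) u.
have U'u_ n : U (u_ n) /\ forall x, k' x -> W (lie x (u_ n)).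
  elim: n => [//|n [IHU IHk']]; split=> [|x k'x]; first exact: hU.
  rewrite lieJ; apply: subspaceD => //; first by apply: IHk'; apply: k'z.
  by apply: hW => //; apply: IHk'.
have exn : exists n, `[< W (u_ n) >] by have [n Wn] := nU _ _ hz Uu; exists n; apply/asboolP.
case: (ex_minnP exn) => -[|n] /asboolP Wn minn; first by case: nWu.
exists (u_ n); have [Un k'n] := U'u_ n; split=> //.
  by move=> /asboolP/minn; rewrite ltnn.
move=> _ /hk''[a _ [x k'x <-]]; rewrite lieDl lieZl.
by apply: subspaceD => //; [exact: subspaceZ|exact: k'n].
Qed.

End Engel.

Lemma subspace_preim (F : fieldType) (U W : lmodType F) (f : U -> W) (B : set W) :
  linear f -> subspace B -> subspace [set u | B (f u)].
Proof.
move=> lf sB; split; first by rewrite /= (lin0 lf); exact: subspace0.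
by move=> a x y /= Bx By; rewrite lf; apply: subspaceD => //; apply: subspaceZ.
Qed.

Lemma subspace_ker (F : fieldType) (U W : lmodType F) (f : U -> W) :
  linear f -> subspace [set u | f u = 0].
Proof. by move=> lf; have := subspace_preim lf (@subspace_set0 F W). Qed.

Lemma subspace_kerF (F : fieldType) (U : lmodType F) (A : set U) (f : U -> F) :
  subspace A -> (forall a x y, A x -> A y -> f (a *: x + y) = a * f x + f y) ->
  subspace [set u | A u /\ f u = 0].
Proof.
move=> sA lf; have A0 := subspace0 sA; split.
  by split => //; have := lf (-1) 0 0 A0 A0; rewrite scaler0 addr0 mulN1r addNr.
move=> a x y /= [Ax Ex] [Ay Ey]; rewrite lf// Ex Ey mulr0 addr0.
by split => //; apply: subspaceD => //; apply: subspaceZ.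
Qed.

Lemma linear_add (F : fieldType) (U W : lmodType F) (f h : U -> W) :
  linear f -> linear h -> linear (fun u => f u + h u).
Proof. by move=> lf lh a x y; rewrite lf lh scalerDr addrACA. Qed.

Lemma linear_sub (F : fieldType) (U W : lmodType F) (f h : U -> W) :
  linear f -> linear h -> linear (fun u => f u - h u).
Proof. by move=> lf lh a x y; rewrite lf lh scalerBr opprD addrACA. Qed.

(** By the Leibniz rule, [D3 - (c + d)] applies [D1 - c] to one argument or [D2 - d] to the other.
    The statement is general because it serves for the bracket, for wedges and for the invariant
    form. *)
Lemma gen_eigen_bilinear (F : fieldType) (U1 U2 U3 : lmodType F) (B : U1 -> U2 -> U3)
    (A1 : set U1) (A2 : set U2) (D1 : U1 -> U1) (D2 : U2 -> U2) (D3 : U3 -> U3) c d u v :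
  (forall u, linear (B u)) -> (forall v, linear (fun u => B u v)) ->
  subspace A1 -> subspace A2 -> linear D1 -> linear D2 -> linear D3 ->
  stable A1 D1 -> stable A2 D2 ->
  (forall u v, A1 u -> A2 v -> D3 (B u v) = B (D1 u) v + B u (D2 v)) ->
  A1 u -> A2 v -> gen_eigen D1 c u -> gen_eigen D2 d v -> gen_eigen D3 (c + d) (B u v).
Proof.
move=> Br Bl sA1 sA2 l1 l2 l3 A1D A2D dD Au Av [k ku] [l lv]; exists (k + l)%N.
have [N] := ubnP (k + l)%N; elim: N => // N IH in k l u v Au Av ku lv *.
rewrite ltnS => kl.
case: k ku kl => [|k] ku kl.
  move: ku; rewrite expr0 -polyC1 papplyC scale1r => ->.
  by rewrite (lin0 (Bl v)) (lin0 (papply_linear _ l3)).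
case: l lv kl => [|l] lv kl.
  move: lv; rewrite expr0 -polyC1 papplyC scale1r => ->.
  by rewrite (lin0 (Br u)) (lin0 (papply_linear _ l3)).
rewrite addSn exprSr papplyM// papplyXsubC dD//.
have -> : B (D1 u) v + B u (D2 v) - (c + d) *: B u v =
    B (D1 u - c *: u) v + B u (D2 v - d *: v).
  rewrite (linB _ _ (Bl v)) (linB _ _ (Br u)) (linZ _ _ (Bl v)) (linZ _ _ (Br u)).
  by rewrite scalerDl opprD addrACA.
rewrite (linD _ _ (papply_linear _ l3)).
rewrite exprSr papplyM// papplyXsubC in ku.
have lv' := lv; rewrite exprSr papplyM// papplyXsubC in lv'.
have AD1 : A1 (D1 u - c *: u) by apply: subspaceB => //; [exact: A1D|exact: subspaceZ].
have AD2 : A2 (D2 v - d *: v) by apply: subspaceB => //; [exact: A2D|exact: subspaceZ].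
rewrite IH ?add0r// addnS -addSn IH//.
  by rewrite exprSr papplyM// papplyXsubC in ku *.
by rewrite addSnnS.
Qed.

Section Derivations.
Variables (F : numClosedFieldType) (g : lieAlgType F) (m : set g).
Hypotheses (fm : finite_dim m) (am : subalgebra m).
Implicit Types (x y z u v : g) (a k : set g) (D : g -> g) (c d : F).

Let sm : subspace m. Proof. by case: am. Qed.

Definition derivation D := forall x y, m x -> m y -> D (lie x y) = lie (D x) y + lie x (D y).

Lemma operator_ad x : m x -> operator m (lie x).
Proof. by move=> mx; split; [exact: lie_linear|move=> y my; apply am.2]. Qed.

Lemma ad_derivation x : derivation (lie x).
Proof. by move=> u v _ _; rewrite lieJ. Qed.

Lemma gen_eigen_bracket D c d u v : operator m D -> derivation D -> m u -> m v ->
  gen_eigen D c u -> gen_eigen D d v -> gen_eigen D (c + d) (lie u v).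
Proof.
move=> [lD mD] dD; apply: gen_eigen_bilinear => //.
- exact: lie_linear.
- exact: lie_linearl.
Qed.

(** Generalized eigenspaces for [c] and [d] bracket into that for [c + d], so additivity of [phi] is
    the Leibniz rule. Taken with the identity for the semisimple part, and with conjugation for
    Cartan's criterion. *)
Lemma spectral_derivation x (phi : F -> F) : m x ->
  (forall c d, phi (c + d) = phi c + phi d) ->
  exists2 p, p.[0] = 0 & operator m (papply p (lie x)) /\
    derivation (papply p (lie x)) /\
    forall c u, m u -> gen_eigen (lie x) c u -> papply p (lie x) u = phi c *: u.
Proof.
move=> mx phiD; have [lx mlx] := operator_ad mx.
have [p [p0 pP]] := poly_of_operator phi fm (operator_ad mx).
exists p; first by have := phiD 0 0; rewrite p0 addr0 => /eqP; rewrite addrC -subr_eq subrr => /eqP.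
have lS := papply_linear p lx.
split; first by split => // u mu; apply: papply_stable.
split=> // u v mu mv; pose S := papply p (lie x).
have {}lS : linear S := lS.
have H w c : m w -> gen_eigen (lie x) c w -> forall v, m v ->
    S (lie w v) = lie (S w) v + lie w (S v).
  move=> mw cw; clear v mv => v mv.
  have sub : subspace [set v | S (lie w v) - (lie (S w) v + lie w (S v)) = 0].
    apply: (subspace_ker (f := fun v => S (lie w v) - (lie (S w) v + lie w (S v)))).
    by apply: linear_sub; last apply: linear_add; move=> e a b; rewrite ?lS ?lie_linear ?lS.
  apply/eqP; rewrite -subr_eq0; apply/eqP.
  apply: (span_min sub _ (span_gen_eigen fm (operator_ad mx) mv)) => z [mz [d dz]] /=.
  rewrite /S (pP _ _ mw cw) (pP _ _ mz dz) (pP (c + d)); last first.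
  - exact: gen_eigen_bracket (operator_ad mx) (ad_derivation x) mw mz cw dz.
  - by apply am.2.
  by rewrite lieZl lieZr -scalerDl phiD subrr.
have sub : subspace [set u | S (lie u v) - (lie (S u) v + lie u (S v)) = 0].
  apply: (subspace_ker (f := fun u => S (lie u v) - (lie (S u) v + lie u (S v)))).
  by apply: linear_sub; last apply: linear_add; move=> e a b; rewrite ?lie_linearl ?lS ?lie_linearl.
apply/eqP; rewrite -subr_eq0; apply/eqP.
apply: (span_min sub _ (span_gen_eigen fm (operator_ad mx) mu)) => z [mz [d dz]] /=.
by rewrite (H z d)// subrr.
Qed.

Lemma spectral_diff_nil x p : m x ->
  (forall c u, m u -> gen_eigen (lie x) c u -> papply p (lie x) u = c *: u) ->
  nil_on m (fun u => lie x u - papply p (lie x) u).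
Proof.
move=> mx pP; have [lx mlx] := operator_ad mx; have lS := papply_linear p lx.
set N := fun u => _; have lN : linear N.
  by move=> a u v; rewrite /N lx lS scalerBr opprD addrACA.
apply/nil_onP => // u mu.
apply: (span_min (gen_eigen_subspace 0 lN) _ (span_gen_eigen fm (operator_ad mx) mu)).
move=> w [mw [c [k kw]]] /=; elim: k => [|k IH] in w mw kw *.
  by move: kw; rewrite expr0 -polyC1 papplyC scale1r => ->; apply: gen_eigen0.
have cw : gen_eigen (lie x) c w by exists k.+1.
apply: gen_eigen_shift => //; rewrite scale0r subr0 /N (pP c)//.
apply: IH; first by apply: subspaceB => //; [exact: mlx|exact: subspaceZ].
by rewrite exprSr papplyM// papplyXsubC in kw.
Qed.

End Derivations.

(** * Cartan's criterion and inner derivations of a reductive Lie algebra *)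

Section Reductive.
Variables (F : numClosedFieldType) (g : lieAlgType F) (m : set g).
Hypothesis red : reductive m.
Implicit Types (x y z u v : g) (a b k : set g) (D : g -> g) (c d : F).

Let am : subalgebra m. Proof. by case: red. Qed.
Let sm : subspace m. Proof. by case: am. Qed.
Let fm : finite_dim m. Proof. by case: red. Qed.
Let mlie x y : m x -> m y -> m (lie x y). Proof. by case: am => _; apply. Qed.
Let oad x : m x -> operator m (lie x). Proof. exact: operator_ad. Qed.

Lemma ideal_complement a : ideal_of a m ->
  exists2 b, ideal_of b m & internal_direct_sum a b m.
Proof. by case: red => _ _ /(_ a) H /H[b Hb ab]; exists b. Qed.

Lemma ideal_disjoint_comm a b x y : ideal_of a m -> ideal_of b m ->
  a `&` b = [set 0] -> a x -> b y -> lie x y = 0.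
Proof.
move=> [sa am' Ia] [sb bm Ib] ab ax yb.
have : (a `&` b) (lie x y).
  split; last by apply: Ib => //; exact: am'.
  by rewrite lieC; apply: subspaceN => //; apply: Ia => //; exact: bm.
by rewrite ab.
Qed.

Lemma center_ideal : ideal_of (center m) m.
Proof.
split; first exact: centralizer_subspace.
  by move=> x [].
move=> x y mx [my yc]; rewrite lieC yc// oppr0.
by apply: subspace0; exact: centralizer_subspace.
Qed.

Lemma derived_sub a b : a `<=` m -> b `<=` m -> lie_set a b `<=` m.
Proof. by move=> am' bm; apply: lie_set_min => // x y /am' mx /bm; apply: mlie. Qed.

(** An ideal complementary to the center contains every bracket, as central components drop out. *)
Lemma center_derived u : center m u -> lie_set m m u -> u = 0.
Proof.
move=> cu; have [b [sb bm Ib] [mE cb0]] := ideal_complement center_ideal.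
suff sub : lie_set m m `<=` b.
  by move=> /sub bu; have : (center m `&` b) u by []; rewrite cb0.
apply: lie_set_min => // x y; rewrite [X in X x]mE [X in X y]mE.
move=> [z [mz zc] [x' bx' <-]] [w [mw wc] [y' by' <-]].
rewrite lieDl zc ?add0r; last first.
  by apply: subspaceD => //; apply: bm.
rewrite lieDr [lie x' w]lieC wc ?oppr0 ?add0r; last exact: bm.
by apply: Ib => //; apply: bm.
Qed.

Lemma derived_ideal a : ideal_of a m -> ideal_of (lie_set a m) m.
Proof.
move=> [sa am' Ia]; split; [exact: lie_set_subspace|exact: derived_sub|].
move=> x y mx.
apply: (lie_set_min (subspace_preim (lie_linear x) (lie_set_subspace a m))) => u v au mv.
rewrite /= lieJ; apply: spanD; apply: sub_lie_set => //; first exact: Ia.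
exact: mlie.
Qed.

Section Trace.
Variable tr : (g -> g) -> F.
Hypothesis Htr : trace_on m tr.

Lemma operator_comp f h : operator m f -> operator m h -> operator m (f \o h).
Proof.
move=> [lf mf] [lh mh]; split; last by move=> u /mh /mf.
by move=> a x y /=; rewrite lh lf.
Qed.

Lemma operator_sub f h : operator m f -> operator m h -> operator m (fun u => f u - h u).
Proof.
move=> [lf mf] [lh mh]; split; first exact: linear_sub.
by move=> u mu; apply: subspaceB => //; [apply: mf|apply: mh].
Qed.

Lemma trace_sub f h : operator m f -> operator m h ->
  tr (fun u => f u - h u) = tr f - tr h.
Proof.
move=> of_ oh; rewrite -mulN1r addrC -(trace_lin Htr)//.
by apply: (trace_ext Htr) => u _; rewrite scaleN1r addrC.
Qed.

Lemma trace_zero f : (forall u, m u -> f u = 0) -> tr f = 0.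
Proof.
move=> f0; rewrite (trace_ext Htr (h := fun=> 0))//; apply: (trace_nil Htr).
  split; first by move=> a x y; rewrite scaler0 addr0.
  by move=> u _; exact: subspace0.
by move=> u _; exists 1.
Qed.

Lemma trace_bracket f h s : operator m f -> operator m h -> operator m s ->
  tr ((fun u => f (h u) - h (f u)) \o s) = tr (f \o (fun u => h (s u) - s (h u))).
Proof.
move=> of_ oh os; rewrite (trace_sub (f := f \o h \o s) (h := h \o f \o s)); last first.
- exact/operator_comp/os/operator_comp.
- exact/operator_comp/os/operator_comp.
have [lf _] := of_.
rewrite [RHS](trace_ext Htr (h := fun u => (f \o h \o s) u - (f \o s \o h) u)); last first.
  by move=> u _ /=; rewrite (linB _ _ lf).
rewrite trace_sub; [|exact/operator_comp/os/operator_comp|exact/operator_comp/oh/operator_comp].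
by congr (_ - _); exact: (trace_comm Htr oh (operator_comp of_ os)).
Qed.

Definition killing x y := tr (lie x \o lie y).

Lemma killing_sym x y : m x -> m y -> killing x y = killing y x.
Proof. by move=> mx my; apply: (trace_comm Htr); apply: oad. Qed.

Lemma killing_linl x y z c : m x -> m y -> m z ->
  killing (c *: x + y) z = c * killing x z + killing y z.
Proof.
move=> mx my mz; rewrite -(trace_lin Htr); try by apply: operator_comp; apply: oad.
by apply: (trace_ext Htr) => u _ /=; rewrite lieDl lieZl.
Qed.

Lemma killing_linr x y z c : m x -> m y -> m z ->
  killing z (c *: x + y) = c * killing z x + killing z y.
Proof.
move=> mx my mz; rewrite killing_sym ?killing_linl ?[killing z _]killing_sym//.
by apply: subspaceD => //; apply: subspaceZ.
Qed.

Lemma killing_inv x y z : m x -> m y -> m z ->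
  killing (lie x y) z = killing x (lie y z).
Proof.
move=> mx my mz; rewrite /killing -[RHS](trace_ext Htr
  (f := lie x \o (fun u => lie y (lie z u) - lie z (lie y u)))); last first.
  by move=> u _ /=; rewrite lie_lie.
rewrite -trace_bracket; try exact: oad.
by apply: (trace_ext Htr) => u _ /=; rewrite lie_lie.
Qed.

Lemma killing_kerl y : m y -> subspace [set x | m x /\ killing x y = 0].
Proof. by move=> my; apply: subspace_kerF => // a u v mu mv; apply: killing_linl. Qed.

Lemma killing_kerr x : m x -> subspace [set y | m y /\ killing x y = 0].
Proof. by move=> mx; apply: subspace_kerF => // a u v mu mv; apply: killing_linr. Qed.

(* The complex conjugate of the semisimple part of [ad x], a polynomial in
   [ad x] and a derivation: its trace against [ad x] is the sum of the squared
   moduli of the eigenvalues. *)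
Lemma conjugate_part x : m x -> exists p,
  [/\ operator m (papply p (lie x)), derivation m (papply p (lie x)) &
   tr (lie x \o papply p (lie x)) = 0 -> nil_on m (lie x)].
Proof.
move=> mx.
have [|p _ [op_ [dp pP]]] := spectral_derivation fm am (phi := fun c => c^*) mx.
  by move=> c d; rewrite rmorphD.
by exists p; split=> //; apply: (trace_conj Htr) => //; exact: oad.
Qed.

Lemma trace_derived_vanish a b (s : g -> g) x : a `<=` m -> b `<=` m -> operator m s ->
  (forall y z, a y -> b z -> tr (lie (lie y z) \o s) = 0) -> lie_set a b x ->
  tr (lie x \o s) = 0.
Proof.
move=> am' bm os H abx.
have sub : subspace [set x | m x /\ tr (lie x \o s) = 0].
  apply: subspace_kerF => // c u v mu mv.
  rewrite -(trace_lin Htr); try by apply: operator_comp => //; apply: oad.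
  by apply: (trace_ext Htr) => w _ /=; rewrite lieDl lieZl.
have [] // := lie_set_min sub _ abx => y z ay bz; split; last exact: H.
by apply: mlie; [exact: am'|exact: bm].
Qed.

(** Let [s] be the conjugate part of [ad x]. Since [s] commutes with [ad z], the trace of [ad
    [y, z]] times [s] is that of [ad y] times [[ad z, s] = 0]; so [ad x] has trace 0 against [s]. *)
Lemma nil_of_central_bracket a x : a `<=` m -> lie_set a a x ->
  (forall y, a y -> lie x y = 0) -> nil_on m (lie x).
Proof.
move=> am' aax xa; have mx : m x by apply: derived_sub aax.
have [p [op_ _ pP]] := conjugate_part mx; apply: pP.
apply: (trace_derived_vanish am' am') aax => // y z ay az.
have [my mz] := (am' _ ay, am' _ az).
rewrite (trace_ext Htr (h := (fun u => lie y (lie z u) - lie z (lie y u)) \o papply p (lie x)));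
  last by move=> u _ /=; rewrite lie_lie.
rewrite trace_bracket//; try exact: oad.
apply: trace_zero => u mu /=.
rewrite (@papply_comm _ _ m p (lie x) (lie z) u) ?subrr ?lie0r//.
- exact: lie_linear.
- by case: (oad mx).
- by move=> v _; rewrite lieJ (lie_eq0C (xa _ az)) lie0l add0r.
Qed.

Definition killing_radical := [set x | m x /\ forall y, m y -> killing x y = 0].

Lemma killing_radical_ideal : ideal_of killing_radical m.
Proof.
split.
- split; first by split; [exact: subspace0|move=> y my; have [_] := subspace0 (killing_kerl my)].
  move=> c x y [mx kx] [my ky]; split; first by apply: subspaceD => //; apply: subspaceZ.
  by move=> z mz; rewrite killing_linl// kx// ky// mulr0 addr0.
- by move=> x [].
- move=> x y mx [my ky]; split; first exact: mlie.
  move=> z mz; rewrite killing_sym; [|exact: mlie|done]; rewrite -killing_inv//.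
  by rewrite killing_sym ?ky//; exact: mlie.
Qed.

(** With [r] the radical, the ideal [[r, m]] is ad-nilpotent by Cartan's criterion; Engel's theorem
    then shows that it vanishes. *)
Lemma killing_radical_center : killing_radical `<=` center m.
Proof.
have Ir := killing_radical_ideal; set r := killing_radical in Ir *.
have [sr rm rI] := Ir; have I1 := derived_ideal Ir.
have nil1 x : lie_set r m x -> nil_on m (lie x).
  move=> r1x; have mx : m x by apply: derived_sub r1x.
  have [p [op_ dp pP]] := conjugate_part mx; apply: pP.
  apply: (trace_derived_vanish rm (@subset_refl _ m)) r1x => // y z ry mz.
  have my := rm _ ry; have [lp mp] := op_.
  rewrite (trace_ext Htr (h := (fun u => lie y (lie z u) - lie z (lie y u)) \o papply p (lie x)));
    last by move=> u _ /=; rewrite lie_lie.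
  rewrite trace_bracket//; try exact: oad.
  (* The conjugate part is a derivation, so its commutator with [ad z] is inner, and the trace
     becomes a value of the form at [y] in the radical. *)
  rewrite (trace_ext Htr (h := lie y \o lie (- papply p (lie x) z))); last first.
    move=> u mu /=; rewrite (dp z u)// opprD addrC -addrA addNr addr0 lieNl.
    by rewrite -lieNr.
  by case: ry => _; apply; apply: subspaceN => //; apply: mp.
set r1 := lie_set r m in I1 nil1.
have [s1 r1m I1'] := I1.
(* Otherwise Engel gives a nonzero [w] in [r1] commuting with [r1]. It also commutes with a
   complementary ideal, so it is central and a sum of brackets, hence 0. *)
have r1r1 : r1 `<=` [set 0].
  apply: contrapT => nr1.
  have [|||||||||w [r1w w0 wr1]] :=
    engel (k := r1) (U := r1) (W := [set 0]) _ _ _ (@subspace_set0 _ _).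
  - exact: finite_dimS fm _ _.
  - by split=> // x y /r1m; apply: I1'.
  - done.
  - by move=> x ->; apply: subspace0.
  - exact: nr1.
  - by move=> x u /r1m; apply: I1'.
  - by move=> x u _ ->; rewrite /= lie0r.
  - by move=> x u r1x /r1m/(nil1 _ r1x)[n]; exists n.
  - by move=> x u r1x /r1m/(nil1 _ r1x)[n]; exists n.
  apply: w0; apply: center_derived; last by move: r1w; apply: lie_setS.
  split; first exact: r1m.
  have [b Ib [mE r1b]] := ideal_complement I1.
  move=> y; rewrite [X in X y]mE => -[y1 r1y [y2 by2 <-]].
  by rewrite lieDr (ideal_disjoint_comm I1 Ib r1b r1w by2) addr0; apply/lie_eq0C/wr1.
move=> x rx; split; first exact: rm.
by move=> y my; apply: r1r1; apply: sub_lie_set.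
Qed.

End Trace.

(** Represent [y] to [tr (D \o ad y)] by [n] through the trace form; it vanishes on the radical
    because [D] kills the center... The form then vanishes on all [D u - [n, u]], which are
    therefore central, and 0 because they lie in [[m, m]]. *)
Lemma derivation_inner D : operator m D -> derivation m D ->
  (forall z, center m z -> D z = 0) -> (forall u, m u -> lie_set m m (D u)) ->
  exists2 n, m n & forall u, m u -> D u = lie n u.
Proof.
move=> oD dD Dz Dm; have [lD mD] := oD; have [tr Htr] := trace_exists fm.
have [|||y my rady|n mn nP] := @functional_represented _ _ m (killing tr)
  (fun y => tr (D \o lie y)) fm.
- by move=> x y a z mx my mz; rewrite killing_linl.
- by move=> x y a z mx my mz; rewrite killing_linr.
- move=> x y a mx my; rewrite -(trace_lin Htr); try by apply: operator_comp => //; apply: oad.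
  by apply: (trace_ext Htr) => u _ /=; rewrite lieDl lieZl lD.
- have [_ yc] : center m y.
    by apply: (killing_radical_center Htr); split=> // x mx; rewrite (killing_sym Htr)// rady.
  by apply: (trace_zero Htr) => u mu /=; rewrite yc// (lin0 lD).
exists n => // u mu; apply/eqP; rewrite -subr_eq0; apply/eqP.
have mE : m (D u - lie n u) by apply: subspaceB => //; [apply: mD|apply: mlie].
apply: center_derived; last first.
  by apply: (@subspaceB _ _ (lie_set m m)) => //; [exact: Dm|exact: sub_lie_set].
apply: (killing_radical_center Htr); split=> // b mb.
pose E := fun u => D u - lie n u.
have oE : operator m E by apply: operator_sub => //; exact: oad.
rewrite /killing (trace_ext Htr (h := (fun v => E (lie u v) - lie u (E v)) \o lie b)); last first.
  move=> v mv /=; move: (lie b v) (mlie mb mv) => w mw.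
  rewrite /E dD// lieBl lieBr lie_lie !opprB [_ + _ - lie n _]addrAC.
  by rewrite -[RHS]addrA [X in _ = _ + X]addrCA subrr addr0 -[RHS]addrA [X in _ = _ + X]addrC.
rewrite (trace_bracket Htr)//; try exact: oad.
rewrite (trace_ext Htr
  (h := fun v => (D \o lie (lie u b)) v - (lie n \o lie (lie u b)) v)); last first.
  by move=> v _ /=; rewrite /E -!lie_lie.
rewrite (trace_sub Htr); try by apply: operator_comp => //; apply: oad => //; apply: mlie.
by rewrite -/(killing tr n (lie u b)) -nP ?subrr//; exact: mlie.
Qed.

(** Jordan decomposition inside a reductive algebra, where [s] is determined up to the center. *)
Lemma inner_semisimple_part x : m x -> exists s,
  [/\ m s, nil_on m (lie (x - s)) &
   forall c u, m u -> gen_eigen (lie x) c u -> lie s u = c *: u].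
Proof.
move=> mx; have [lx mlx] := oad mx.
have [//|p p0 [op_ [dp pP]]] := spectral_derivation fm am (phi := fun c => c) mx.
have [||s ms sE] := derivation_inner op_ dp.
- move=> z [mz zc]; rewrite (pP 0) ?scale0r//; apply: gen_eigen_eigen => //.
  by rewrite scale0r lieC zc// oppr0.
(* As [p] has no constant term, [p (ad x)] ends with a bracket by [x], so its values lie in
   [[m, m]]. *)
- have /factor_theorem[q qE] : root p 0 by apply/eqP.
  move=> u mu; rewrite qE polyC0 subr0 papplyMX.
  apply: (@papply_stable _ _ (lie_set m m)) => //; last exact: sub_lie_set.
  by move=> v /(derived_sub (@subset_refl _ m) (@subset_refl _ m)); apply: sub_lie_set.
exists s; split=> //; last by move=> c u mu cu; rewrite -sE// (pP c).
move=> u mu.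
have [n nE] := spectral_diff_nil fm am mx pP mu; exists n; rewrite -nE.
elim: n {nE} u mu => // n IH u mu.
rewrite !iterSr; have -> : lie (x - s) u = lie x u - papply p (lie x) u.
  by rewrite lieBl sE.
by apply: IH; apply: subspaceB => //; [apply: mlie|case: op_ => _; apply].
Qed.

End Reductive.

(** * Cartan subalgebras and root inclusions *)

(* [x] maps [y^(k+1) w] to a nonzero multiple of [y^k w]. *)
Lemma sl2_negative_weight (F : numClosedFieldType) (g : lieAlgType F)
    (x y h w : g) (a : F) :
  a != 0 -> lie x y = h -> lie h y = - a *: y -> lie h w = - a *: w ->
  lie y (lie x w) = 0 -> (exists n, iter n (lie y) w = 0) -> w = 0.
Proof.
move=> a0 xy hy hw yxw [n].
pose w_ k := iter k (lie y) w.
have hw_ k : lie h (w_ k) = - (a *+ k.+1) *: w_ k.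
  elim: k => [|k IH] /=; first by rewrite hw mulr1n.
  rewrite lieJ hy -/(w_ k) IH lieZl lieZr -scalerDl; congr (_ *: _).
  by rewrite [in RHS]mulrS opprD.
have xw k : lie x (w_ k.+1) = - (a *+ 'C(k.+2, 2)) *: w_ k.
  elim: k => [|k IH].
    by rewrite /= lieJ xy yxw addr0 hw.
  rewrite [w_ k.+2]/(lie y (w_ k.+1)) lieJ xy hw_ IH lieZr -scalerDl -opprD.
  by rewrite -mulrnDr [in RHS]binS bin1 addnC.
elim: n => // n IH E; apply: IH.
have := xw n; rewrite [w_ n.+1]E lie0r => /esym/eqP.
rewrite scaler_eq0 oppr_eq0 -mulr_natr mulf_eq0 (negPf a0) /= pnatr_eq0.
by rewrite -leqn0 leqNgt bin_gt0 /= => /eqP.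
Qed.

Section Cartan.
Variables (F : numClosedFieldType) (g : lieAlgType F) (m H : set g).
Hypotheses (red : reductive m) (car : cartan_subalgebra H m).
Implicit Types (x y z u v w : g) (c d : F) (al be : g -> F).

Let am : subalgebra m. Proof. by case: red. Qed.
Let sm : subspace m. Proof. by case: am. Qed.
Let fm : finite_dim m. Proof. by case: red. Qed.
Let mlie x y : m x -> m y -> m (lie x y). Proof. by case: am => _; apply. Qed.
Let oad x : m x -> operator m (lie x). Proof. exact: operator_ad. Qed.
Let aH : subalgebra H. Proof. by case: car. Qed.
Let sH : subspace H. Proof. by case: aH. Qed.
Let Hm : H `<=` m. Proof. by case: car. Qed.
Let Hlie x y : H x -> H y -> H (lie x y). Proof. by case: aH => _; apply. Qed.

Lemma cartan_normalizer u : m u -> (forall y, H y -> H (lie u y)) -> H u.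
Proof. by move=> mu uH; case: car => _ _ _ <-. Qed.

Lemma cartan_centralizer u : m u -> (forall y, H y -> lie y u = 0) -> H u.
Proof.
by move=> mu uH; apply: cartan_normalizer => // y /uH/lie_eq0C->; exact: subspace0.
Qed.

Lemma cartan_ad_nil x y : H x -> H y -> exists n, iter n (lie x) y = 0.
Proof.
move=> Hx Hy; have [_ _ [n nE] _] := car; exists n.
suff : iter n (lie_set H) H (iter n (lie x) y) by rewrite nE.
by elim: (n) => //= k; apply: sub_lie_set.
Qed.

(** By nilpotency, [H] lies in the generalized eigenspace of [ad h] for 0, which [s] annihilates. So
    [s] centralizes [H] and thus belongs to it. *)
Lemma cartan_semisimple_part h : H h -> exists s,
  [/\ H s, forall y, H y -> lie s y = 0, diag_on m (lie s) &
   nil_on m (lie (h - s)) /\ forall c u, m u -> gen_eigen (lie h) c u -> lie s u = c *: u].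
Proof.
move=> Hh; have mh := Hm Hh; have [lh mlh] := oad mh.
have [s [ms nhs sgen]] := inner_semisimple_part red mh.
have sH0 y : H y -> lie s y = 0.
  move=> Hy; rewrite (sgen 0) ?scale0r//; first exact: Hm.
  have [n nE] := cartan_ad_nil Hh Hy; exists n.
  by rewrite (papply_XsubC0_exp _ _ lh).
exists s; split=> //; first by apply: cartan_centralizer => // y /sH0/lie_eq0C.
move=> u mu; apply: spanS (span_gen_eigen fm (oad mh) mu) => w [mw [c cw]].
by split=> //; exists c; apply: sgen.
Qed.

(* [H] acts nilpotently on the centralizer of the set [A] of semisimple parts, so by
   Engel's theorem this centralizer is not larger than the self-normalizing [H]. *)
Let A := [set s | [/\ H s, forall y, H y -> lie s y = 0 & diag_on m (lie s)]].

Let centralizer_A u : m u -> (forall s, A s -> lie s u = 0) -> H u.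
Proof.
move=> mu uA; apply: contrapT => nHu.
pose C := [set u | m u /\ forall s, A s -> lie s u = 0].
have sC : subspace C.
  split; first by split; [exact: subspace0|move=> s _; exact: lie0r].
  move=> c x y [mx xA] [my yA]; split; first by apply: subspaceD => //; apply: subspaceZ.
  by move=> s As; rewrite lieDr lieZr xA// yA// scaler0 addr0.
have HC : H `<=` C by move=> x Hx; split; [exact: Hm|move=> s [_ sH0 _]; exact: sH0].
have Cst x v : H x -> C v -> C (lie x v).
  move=> Hx [mv vA]; split; first by apply: mlie => //; apply: Hm.
  by move=> s As; rewrite lieJ (vA s)// lie0r addr0; case: As => _ -> //; rewrite lie0l.
have [||||||v [[mv vA] nHv Hv]] := engel (k := H) (U := C) (W := H) _ aH sC sH HC.
- exact: finite_dimS fm sH Hm.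
- by move=> /(_ u); apply: contra_not nHu; apply.
- exact: Cst.
- exact: Hlie.
- move=> x v Hx Cv; have fC : finite_dim C by apply: (finite_dimS fm sC) => w [].
  have oC : operator C (lie x) by split; [exact: lie_linear|move=> w; apply: Cst].
  suff : gen_eigen (lie x) 0 v.
    move=> [n]; rewrite (papply_XsubC0_exp _ _ (lie_linear x)) => E.
    by exists n; rewrite E; apply: subspace0.
  apply: (span_min (gen_eigen_subspace 0 (lie_linear x)) _ (span_gen_eigen fC oC Cv)).
  move=> w [[mw wA] [c cw]] /=.
  have [s [Hs sH0 ds [_ sgen]]] := cartan_semisimple_part Hx.
  have := sgen _ _ mw cw; rewrite wA; last by split.
  move=> /esym/eqP; rewrite scaler_eq0 => /orP[/eqP<-//|/eqP->].
  by apply: gen_eigen0; exact: lie_linear.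
- by move=> x y; apply: cartan_ad_nil.
by apply: nHv; apply: cartan_normalizer => // y Hy; rewrite lieC; apply: subspaceN => //; apply: Hv.
Qed.

Section WithTrace.
Variable tr : (g -> g) -> F.
Hypothesis Htr : trace_on m tr.
Local Notation kappa := (killing tr).

(** [m] is spanned by joint eigenvectors of [A]. Those of weight 0 lie in [H], and invariance makes
    [h] orthogonal to the others because it commutes with [A]. *)
Lemma cartan_killing h : H h -> (forall y, H y -> kappa h y = 0) -> center m h.
Proof.
move=> Hh hH; have mh := Hm Hh; apply: (killing_radical_center red Htr); split=> // u mu.
have Jm : span (joint_eigen A (@lie F g) m) u.
  apply: joint_eigen_span => //.
  - by move=> x _; exact: lie_linear.
  - by move=> x [/Hm mx _ _] v mv; apply: mlie.
  - by move=> x [].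
  - by move=> x y v [_ xH _] [Hy _ _] mv; rewrite lieJ xH// lie0l add0r.
have [] // := span_min (killing_kerr red Htr mh) _ Jm => w [mw wJ]; split=> //.
have [wA|] := pselect (forall s, A s -> lie s w = 0).
  by apply: hH; apply: centralizer_A.
move=> /existsNP[s /not_implyP[As sw]]; have [c sc] := wJ _ As.
have [Hs sH0 _] := As; have ms := Hm Hs.
have : c * kappa h w = 0.
  have := killing_linr red Htr 0 mw (subspace0 sm) mh; rewrite addr0 => E.
  have -> : c * kappa h w = kappa h (c *: w).
    have := killing_linr red Htr c mw (subspace0 sm) mh; rewrite addr0 => ->.
    by have [_ ->] := subspace0 (killing_kerr red Htr mh); rewrite addr0.
  rewrite -sc -(killing_inv red Htr)//; rewrite (lie_eq0C (sH0 _ Hh)).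
  by have [_ ->] := subspace0 (killing_kerl red Htr mw).
move=> /eqP; rewrite mulf_eq0 => /orP[/eqP c0|/eqP//].
by case: sw; rewrite sc c0 scale0r.
Qed.

Lemma killing_nil_comm x y : m x -> m y -> lie x y = 0 -> nil_on m (lie x) -> kappa x y = 0.
Proof.
move=> mx my xy nx; apply: (trace_nil Htr); first by apply: operator_comp => //; apply: oad.
by apply: nil_on_comp => //; [exact: oad|exact: oad|move=> u mu; rewrite lieJ xy lie0l add0r].
Qed.

End WithTrace.

(* Otherwise the last nonzero term of the lower central series of [H] would consist
   of elements in the radical of the trace form. *)
Lemma cartan_abelian x y : H x -> H y -> lie x y = 0.
Proof.
move=> Hx Hy; apply: contrapT => xy0; have [tr Htr] := trace_exists fm.
have [_ _ [n0 n0E] _] := car.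
have exn : exists n, `[< iter n (lie_set H) H `<=` [set 0] >].
  by exists n0; apply/asboolP; rewrite n0E.
have LH n : iter n (lie_set H) H `<=` H.
  by elim: n => //= n IH; apply: lie_set_min => // u v Hu /IH; apply: Hlie.
case: (ex_minnP exn) => -[|[|n]] /asboolP /= Ln minn.
- by apply: xy0; have /Ln -> := Hx; rewrite lie0l.
- by apply: xy0; apply: Ln; apply: sub_lie_set.
have [c Lc c0] : exists2 c, iter n.+1 (lie_set H) H c & c <> 0.
  apply: contrapT => nc; suff /minn : `[< iter n.+1 (lie_set H) H `<=` [set 0] >] by rewrite ltnn.
  by apply/asboolP => c Lc; apply: contrapT => c0; apply: nc; exists c.
have cH z : H z -> lie c z = 0 by move=> Hz; apply/lie_eq0C/Ln; apply: sub_lie_set.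
have HHc : lie_set H H c by move: Lc => /=; apply: lie_setS.
have Hc : H c by apply: LH Lc.
have nc : nil_on m (lie c) by apply: (nil_of_central_bracket red Htr Hm).
apply: c0; apply: (center_derived red); last by move: HHc; apply: lie_setS.
apply: (cartan_killing Htr) => // z Hz.
by apply: (killing_nil_comm Htr) => //; [exact: Hm|exact: Hm|exact: cH].
Qed.

(** [ad h] commutes with [ad z] for [z] in [H], so their product is nilpotent and has trace 0: [h]
    is orthogonal to [H]. *)
Lemma cartan_nil_center h : H h -> nil_on m (lie h) -> center m h.
Proof.
move=> Hh nh; have [tr Htr] := trace_exists fm.
apply: (cartan_killing Htr) => // z Hz.
by apply: (killing_nil_comm Htr) => //; [exact: Hm|exact: Hm|exact: cartan_abelian].
Qed.

Lemma cartan_diag h : H h -> diag_on m (lie h).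
Proof.
move=> Hh; have [s [Hs sH0 ds [nhs sgen]]] := cartan_semisimple_part Hh.
have [_ hsc] : center m (h - s) by apply: cartan_nil_center => //; exact: subspaceB.
move=> u mu; apply: spanS (ds u mu) => w [mw [c sw]]; split=> //; exists c.
by rewrite -sw; apply/eqP; rewrite -subr_eq0 -lieBl hsc.
Qed.

Lemma cartan_joint B u : subspace B -> B `<=` m ->
  (forall h v, H h -> B v -> B (lie h v)) -> B u -> span (joint_eigen H (@lie F g) B) u.
Proof.
move=> sB Bm HB; apply: joint_eigen_span => //.
- exact: finite_dimS fm sB Bm.
- by move=> x _; exact: lie_linear.
- by move=> x Hx v; apply: HB.
- move=> x Hx; apply: (diag_onS sm sB (lie_linear x)) => //.
  + by move=> v; apply: mlie; apply: Hm.
  + by move=> v; apply: HB.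
  + exact: cartan_diag.
- by move=> x y v Hx Hy _; rewrite lieJ (cartan_abelian Hx Hy) lie0l add0r.
Qed.

(** The weight is a function on all of [g] of which only the values on [H] matter; this avoids
    dependent types when weights are added. The vector may be 0. *)
Definition weight_vector al w := m w /\ forall h, H h -> lie h w = al h *: w.

Lemma joint_weight B w : B `<=` m -> joint_eigen H (@lie F g) B w ->
  exists al, weight_vector al w.
Proof.
move=> Bm [Bw wJ]; have /choice[al alP] : forall h, exists c, H h -> lie h w = c *: w.
  by move=> h; have [/wJ[c]|] := pselect (H h); [exists c|exists 0].
by exists al; split=> //; exact: Bm.
Qed.

Lemma weight_vector_lie al be u v : weight_vector al u -> weight_vector be v ->
  weight_vector (fun h => al h + be h) (lie u v).
Proof.
move=> [mu uE] [mv vE]; split; first exact: mlie.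
by move=> h Hh; rewrite lieJ (uE _ Hh) (vE _ Hh) lieZl lieZr scalerDl.
Qed.

Section Roots.
Variable tr : (g -> g) -> F.
Hypothesis Htr : trace_on m tr.
Local Notation kappa := (killing tr).

Lemma killing_scalel x y c : m x -> m y -> kappa (c *: x) y = c * kappa x y.
Proof.
move=> mx my; have := killing_linl red Htr c mx (subspace0 sm) my.
by have [_ ->] := subspace0 (killing_kerl red Htr my); rewrite !addr0.
Qed.

Lemma killing_scaler x y c : m x -> m y -> kappa x (c *: y) = c * kappa x y.
Proof.
by move=> mx my; rewrite !(killing_sym red Htr mx)// ?killing_scalel//; exact: subspaceZ.
Qed.

Lemma killing_weights al be u v h : weight_vector al u -> weight_vector be v -> H h ->
  (al h + be h) * kappa u v = 0.
Proof.
move=> [mu uE] [mv vE] Hh; have mh := Hm Hh.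
rewrite mulrDl -killing_scalel// -killing_scaler// -(uE _ Hh) -(vE _ Hh).
rewrite -(killing_inv red Htr)// [lie u h]lieC -scaleN1r killing_scalel//; last exact: mlie.
by rewrite mulN1r subrr.
Qed.

(** The trace form is nondegenerate modulo the center and pairs only opposite weights. *)
Lemma opposite_weight al v : weight_vector al v -> ~ center m v ->
  exists2 u, weight_vector (fun h => - al h) u & kappa v u != 0.
Proof.
move=> av ncv; have [mv vE] := av; apply: contrapT => nu.
apply: ncv; apply: (killing_radical_center red Htr); split=> // y my.
have Jy : span (joint_eigen H (@lie F g) m) y.
  by apply: cartan_joint => // h w /Hm mh; apply: mlie.
have [] // := span_min (killing_kerr red Htr mv) _ Jy => w wJ.
have [be bw] := joint_weight (@subset_refl _ m) wJ; have [mw wE] := bw.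
split=> //; apply/eqP/negPn/negP => k0; apply: nu; exists w => //; split=> // h Hh.
have /eqP := killing_weights av bw Hh; rewrite mulf_eq0 (negPf k0) orbF addrC addr_eq0.
by move=> /eqP <-; apply: wE.
Qed.

(** [[e, f]] lies in [H] and its product with [h] is [al h] times that of [e] and [f], so it is
    central, and also a bracket. *)
Lemma opposite_bracket_eq0 al e f : weight_vector al e ->
  weight_vector (fun h => - al h) f -> kappa e f = 0 -> lie e f = 0.
Proof.
move=> ae af kef; have [me eE] := ae; have [mf fE] := af.
have Hef : H (lie e f).
  apply: cartan_centralizer; first exact: mlie.
  move=> h Hh; have [_ ->] // := weight_vector_lie ae af.
  by rewrite subrr scale0r.
apply: (center_derived red); last exact: sub_lie_set.
apply: (cartan_killing Htr) => // h Hh; rewrite (killing_sym red Htr)//; [|exact: Hm|exact: Hm].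
by rewrite -(killing_inv red Htr)// ?eE// ?killing_scalel ?kef ?mulr0//; exact: Hm.
Qed.

(** If [al [e, f]] were 0, then [[e, f]] would commute with [e] and [f], hence be ad-nilpotent,
    central and finally 0. But its product with [h0] is [al h0] times that of [e] and [f]. *)
Lemma root_coroot al e : weight_vector al e -> e != 0 -> (exists2 h, H h & al h != 0) ->
  exists f, [/\ weight_vector (fun h => - al h) f, kappa e f != 0,
    H (lie e f) & al (lie e f) != 0].
Proof.
move=> ae e0 [h0 Hh0 alh0]; have [me eE] := ae; have mh0 := Hm Hh0.
have nce : ~ center m e.
  move=> [_ ec]; have := eE _ Hh0; rewrite lieC ec// oppr0 => /esym/eqP.
  by rewrite scaler_eq0 (negPf e0) (negPf alh0).
have [f af kef] := opposite_weight ae nce; have [mf fE] := af.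
have Hef : H (lie e f).
  apply: cartan_centralizer; first exact: mlie.
  by move=> h Hh; have [_ ->] // := weight_vector_lie ae af; rewrite subrr scale0r.
exists f; split=> //; apply/negP => /eqP ah0.
have nh : nil_on m (lie (lie e f)).
  apply: (nil_of_central_bracket red Htr (a := [set e; f])).
  - by move=> x [->|->].
  - by apply: sub_lie_set; [left|right].
  - by move=> y [->|->]; rewrite ?(eE _ Hef) ?(fE _ Hef) ah0 ?oppr0 scale0r.
have : lie e f = 0.
  by apply: (center_derived red); [exact: cartan_nil_center|exact: sub_lie_set].
move=> ef0; have : kappa h0 (lie e f) = 0.
  by rewrite ef0; have [_] := subspace0 (killing_kerr red Htr mh0).
rewrite -(killing_inv red Htr)// eE// killing_scalel// => /eqP.
by rewrite mulf_eq0 (negPf alh0) (negPf kef).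
Qed.

Lemma root_vector_nil al e h w : weight_vector al e -> H h -> al h != 0 -> m w ->
  (exists c, lie h w = c *: w) -> exists n, iter n (lie e) w = 0.
Proof.
move=> [me eE] Hh ah0 mw [c wE].
have mit k : m (iter k (lie e) w) by elim: k => //= k; apply: mlie.
apply: (eigenvalues_finite (A := m) (f := lie h) (c := fun k => c + al h *+ k)) => //.
- exact/oad/Hm.
- move=> i j /addrI /eqP; rewrite -!(mulr_natr (al h)) (inj_eq (mulfI ah0)) eqr_nat.
  by move/eqP.
- elim=> [|k IH] /=; first by rewrite mulr0n addr0.
  by rewrite lieJ eE// IH lieZl lieZr -scalerDl addrCA mulrS.
Qed.

(** Subtracting a multiple of [e] makes [e'] orthogonal to [f], so the difference [w] commutes with
    [f]. For the [sl_2] of [e] and [f] it is a lowest weight vector of positive weight, hence 0. *)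
Lemma root_dim1 al e e' : weight_vector al e -> e != 0 -> (exists2 h, H h & al h != 0) ->
  weight_vector al e' -> exists c, e' = c *: e.
Proof.
move=> ae e0 ah ae'; have [f [af kef Hef aef]] := root_coroot ae e0 ah.
have [me eE] := ae; have [me' e'E] := ae'; have [mf fE] := af.
exists (kappa e' f / kappa e f); apply/eqP; rewrite -subr_eq0; apply/eqP.
set c := _ / _; set w := e' - _.
have aw : weight_vector al w.
  split; first by apply: subspaceB => //; apply: subspaceZ.
  by move=> h Hh; rewrite /w lieBr lieZr eE// e'E// scalerBr !scalerA mulrC.
have [mw wE] := aw.
have kwf : kappa w f = 0.
  rewrite /w addrC -scaleNr (killing_linl red Htr)// mulNr /c divfK//.
  by rewrite addNr.
(* The roles are exchanged: [f] raises and [e] lowers, which accounts for the sign of the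
   bracket. *)
apply: (@sl2_negative_weight _ _ f e (- lie e f) w (al (lie e f))) => //.
- by rewrite [LHS]lieC.
- by rewrite lieNl eE// scaleNr.
- by rewrite lieNl wE// scaleNr.
- by rewrite (lieC f) (opposite_bracket_eq0 aw af kwf) oppr0 lie0r.
- by apply: (root_vector_nil ae Hef aef) => //; exists (al (lie e f)); apply: wE.
Qed.

End Roots.
End Cartan.

Lemma scaler_inj_scalar (F : fieldType) (U : lmodType F) (e : U) : e != 0 ->
  injective (fun a : F => a *: e).
Proof.
move=> e0 a b /eqP; rewrite -subr_eq0 -scalerBl scaler_eq0 (negPf e0) orbF subr_eq0.
by move/eqP.
Qed.

Section RootInclusion.
Variables (F : numClosedFieldType) (g : lieAlgType F) (H l m : set g).
Hypotheses (redl : reductive l) (redm : reductive m) (ri : root_inclusion_wrt H l m).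
Implicit Types (x y z u v w e f n s : g) (c : F) (al be : g -> F).

Local Notation Hl := (l `&` H).

Let lm : l `<=` m. Proof. by case: ri. Qed.
Let carm : cartan_subalgebra H m. Proof. by case: ri. Qed.
Let carl : cartan_subalgebra Hl l. Proof. by case: ri. Qed.
Let am : subalgebra m. Proof. by case: redm. Qed.
Let sm : subspace m. Proof. by case: am. Qed.
Let fm : finite_dim m. Proof. by case: redm. Qed.
Let mlie x y : m x -> m y -> m (lie x y). Proof. by case: am => _; apply. Qed.
Let al_ : subalgebra l. Proof. by case: redl. Qed.
Let sl : subspace l. Proof. by case: al_. Qed.
Let llie x y : l x -> l y -> l (lie x y). Proof. by case: al_ => _; apply. Qed.
Let Hm : H `<=` m. Proof. by case: carm. Qed.

(** Root spaces of [l] are root spaces of [m], so the whole of [H], not only its part in [l], acts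
    on [e] by scalars. *)
Lemma root_vector_inclusion al e : weight_vector l Hl al e -> e != 0 ->
  (exists2 h, Hl h & al h != 0) -> exists be, weight_vector m H be e.
Proof.
move=> [le eE] e0 [h0 Hh0 alh0].
pose alpha := fun y : Hl => al (val y).
have mem (t : Hl) : Hl (val t) by apply: set_mem; exact: (valP t).
have rsE : root_space l alpha e by split => // t; rewrite eE.
have [_ _ _ /(_ alpha) rootP] := ri.
have [|be' _ rse] := rootP.
  split.
  - move=> a x y z xyz; apply: (scaler_inj_scalar e0).
    by rewrite scalerDl -scalerA -!eE// xyz lieDl lieZl.
  - move=> E; move: alh0; have /= -> : al h0 = alpha (exist _ h0 (mem_set Hh0)) by [].
    by rewrite E eqxx.
  - by move=> E; move: rsE e0; rewrite E => /= ->; rewrite eqxx.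
move: rsE; rewrite -rse => -[me eH].
have /choice[be beP] : forall h, exists c, H h -> lie h e = c *: e.
  move=> h; have [Hh|] := pselect (H h); last by exists 0.
  by exists (be' (exist _ h (mem_set Hh))) => _; rewrite -eH.
by exists be; split.
Qed.

(** Weight vectors of [l] span it: those of nonzero weight are eigenvectors of [H], and those of
    weight 0 lie in the abelian [H]. *)
Lemma normalizes_root_subalgebra h y : H h -> l y -> l (lie h y).
Proof.
move=> Hh ly.
have Jy : span (joint_eigen Hl (@lie F g) l) y.
  by apply: (cartan_joint redl carl) => // x v [lx _]; apply: llie.
apply: (span_min (subspace_preim (lie_linear h) sl) _ Jy) => e eJ /=.
have [al ale] := joint_weight (@subset_refl _ l) eJ; have [le eE] := ale.
have [->|e0] := eqVneq e 0; first by rewrite lie0r; exact: subspace0.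
have [ah|nah] := pselect (exists2 h, Hl h & al h != 0).
  have [be [me ->]] // := root_vector_inclusion ale e0 ah.
  exact: subspaceZ.
have [_ He] : Hl e.
  apply: (cartan_centralizer carl) => // x Hx; rewrite eE//.
  apply/eqP; rewrite scaler_eq0; apply/orP; left; apply/negPn/negP => ax.
  by apply: nah; exists x.
by rewrite (cartan_abelian redm carm)//; exact: subspace0.
Qed.

(* If [e] is a root vector of [l] with [[e, f] <> 0], pick [u] of weight opposite to
   that of [[e, f]]: then [[e, u]] is a multiple of [z], which is invariant under the
   [sl_2] of [e], whereas [u] has weight [-2] for it. *)
Lemma centralizer_opposite z f be : weight_vector m H be z -> z != 0 ->
  (exists2 h, H h & be h != 0) -> (forall y, l y -> lie z y = 0) ->
  weight_vector m H (fun h => - be h) f -> forall y, l y -> lie y f = 0.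
Proof.
move=> bz z0 bh zl bf y ly; have [mz zE] := bz; have [mf fE] := bf.
have [trm Htrm] := trace_exists fm.
have [trl Htrl] := trace_exists (finite_dimS fm sl lm).
have be0 h : l h -> H h -> be h = 0.
  move=> lh Hh; apply: (scaler_inj_scalar z0).
  by rewrite -zE// scale0r; apply/lie_eq0C/zl.
have Jy : span (joint_eigen Hl (@lie F g) l) y.
  by apply: (cartan_joint redl carl) => // x v [lx _]; apply: llie.
apply: (span_min (subspace_lie_ker f) _ Jy) => e eJ /=.
have [al ale] := joint_weight (@subset_refl _ l) eJ; have [le eE] := ale.
have [->|e0] := eqVneq e 0; first by rewrite lie0l.
have [ah|nah] := pselect (exists2 h, Hl h & al h != 0); last first.
  have [_ He] : Hl e.
    apply: (cartan_centralizer carl) => // x Hx; rewrite eE//.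
    apply/eqP; rewrite scaler_eq0; apply/orP; left; apply/negPn/negP => ax.
    by apply: nah; exists x.
  by rewrite fE// be0// oppr0 scale0r.
have [al' al'e] := root_vector_inclusion ale e0 ah.
have [f' [alf' _ [lh Hh] alh0]] := root_coroot redl carl Htrl ale e0 ah.
set h := lie e f' in lh Hh alh0; have [lf' f'E] := alf'.
have f'0 : f' != 0 by apply: contra_neq alh0 => f'0; have := eE h (conj lh Hh);
  rewrite /h f'0 lie0r lie0l => /esym/eqP; rewrite scaler_eq0 (negPf e0) orbF => /eqP.
have [|be' be'f'] := root_vector_inclusion alf' f'0.
  by exists h => //; rewrite oppr_eq0.
have [me eE'] := al'e; have [mf' f'E'] := be'f'.
have al'h : al' h = al h by apply: (scaler_inj_scalar e0); rewrite -eE'// eE.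
have be'h : be' h = - al h by apply: (scaler_inj_scalar f'0); rewrite -f'E'// f'E.
apply: contrapT => ef0.
have vE := weight_vector_lie redm al'e bf.
have [|u uE kvu] := opposite_weight redm carm Htrm vE.
  by move=> ce; apply: ef0; apply: (center_derived redm ce); apply: sub_lie_set.
have [mu uH] := uE.
have [c euE] : exists c, lie e u = c *: z.
  apply: (root_dim1 redm carm Htrm bz z0 bh); split; first exact: mlie.
  move=> x Hx; have [_ ->] // := weight_vector_lie redm al'e uE.
  by congr (_ *: _); rewrite opprB addrC subrK.
suff u0 : u = 0.
  have := killing_scaler redm Htrm 0 (mlie me mf) mu.
  by rewrite scale0r mul0r -u0 => /eqP; rewrite (negPf kvu).
apply: (@sl2_negative_weight _ _ e f' h u (al h)) => //.
- by rewrite f'E.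
- by rewrite uH// al'h be0// oppr0 addr0.
- by rewrite euE lieZr (lie_eq0C (zl _ lf')) scaler0.
- apply: (root_vector_nil redm carm be'f' Hh _ mu).
    by rewrite be'h oppr_eq0.
  by exists (- (al' h - be h)); apply: uH.
Qed.

(* [n = x - s] lies in the centralizer [Z] of [l] and commutes with [Z]; opposite roots
   occur together in [Z], so [n] has no component outside [H]. *)
Theorem diag_root_inclusion x : l x -> diag_on l (lie x) -> diag_on m (lie x).
Proof.
move=> lx dx; have mx := lm lx.
have [s [ms nn sgen]] := inner_semisimple_part redm mx.
set n := x - s in nn; have mn : m n by apply: subspaceB.
have [trm Htrm] := trace_exists fm.
have nl y : l y -> lie n y = 0.
  move=> ly; apply: (span_min (subspace_ker (lie_linear n)) _ (dx _ ly)) => w [lw [c wc]] /=.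
  rewrite lieBl wc (sgen c) ?subrr//; first exact: lm.
  by apply: gen_eigen_eigen => //; exact: lie_linear.
pose Z := centralizer m l.
have sZ : subspace Z by apply: centralizer_subspace.
have nZ z : Z z -> lie n z = 0.
  move=> [mz zl]; have xz : lie x z = 0 by apply/lie_eq0C/zl.
  rewrite lieBl xz (sgen 0) ?scale0r ?subr0//.
  by apply: gen_eigen_eigen; [exact: lie_linear|rewrite scale0r].
have HZ h u : H h -> Z u -> Z (lie h u).
  move=> Hh [mu ul]; split; first by apply: mlie => //; exact: Hm.
  move=> y ly; rewrite lie_lie ul// lie0r (ul (lie h y)) ?subrr//.
  exact: normalizes_root_subalgebra.
pose Y := [set u | Z u /\ forall h, H h -> Z h -> lie h u = 0].
have sY : subspace Y.
  split; first by split; [exact: subspace0|move=> *; exact: lie0r].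
  move=> c u v [Zu uh] [Zv vh]; split; first by apply: subspaceD => //; exact: subspaceZ.
  by move=> h Hh Zh; rewrite lieDr lieZr uh// vh// scaler0 addr0.
have Yn : Y n.
  by split; [split|move=> h Hh Zh; apply/lie_eq0C/nZ].
have HY h u : H h -> Y u -> Y (lie h u).
  move=> Hh [Zu uh]; split; first exact: HZ.
  move=> k Hk Zk; rewrite lieJ (cartan_abelian redm carm Hk Hh) lie0l add0r.
  by rewrite uh// lie0r.
have Jn : span (joint_eigen H (@lie F g) Y) n.
  by apply: (cartan_joint redm carm) => // u [[]].
have sH : subspace H by case: carm => -[].
have Hn : H n.
  apply: (span_min sH _ Jn) => z zJ.
  have [|be bz] := joint_weight (m := m) _ zJ; first by move=> u [[]].
  have [mz zE] := bz; have [[[_ zl] zh] _] := zJ.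
  have [->|z0] := eqVneq z 0; first exact: subspace0.
  have [bh|nbh] := pselect (exists2 h, H h & be h != 0); last first.
    apply: (cartan_centralizer carm) => // h Hh; rewrite zE//.
    apply/eqP; rewrite scaler_eq0; apply/orP; left; apply/negPn/negP => bh.
    by apply: nbh; exists h.
  (* The vector [f] centralizes [l] as well, so [[z, f]] is in the part of [Z] inside [H] and
     commutes with [z] by the choice of [Y]; but it acts on [z] by a nonzero scalar. *)
  have [f [bf _ Hzf bzf]] := root_coroot redm carm Htrm bz z0 bh.
  have fl := centralizer_opposite bz z0 bh zl bf; have [mf _] := bf.
  exfalso; move: bzf; rewrite (_ : be (lie z f) = 0) ?eqxx//.
  apply: (scaler_inj_scalar z0); rewrite -zE// scale0r; apply: zh => //.
  split; first exact: mlie.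
  by move=> y ly; rewrite lie_lie (zl _ ly) (lie_eq0C (fl _ ly)) !lie0r subrr.
have [_ nc] := cartan_nil_center redm carm Hn nn.
move=> u mu; apply: spanS (span_gen_eigen fm (operator_ad am mx) mu) => w [mw [c cw]].
split=> //; exists c; rewrite -(sgen c)//; apply/eqP; rewrite -subr_eq0 -lieBl.
by rewrite nc.
Qed.

End RootInclusion.

(** * The orthogonal Lie algebra *)

Section Forms.
Variables (F : numClosedFieldType) (V : lmodType F) (form : {biscalar V}).
Hypotheses (infV : countably_infinite_dim V) (formC : form_symmetric form)
  (form_nd : form_nondegenerate form).
Implicit Types (u v w : V) (s : seq V) (c : F).

Lemma span_range_sum (e : nat -> V) v : span (range e) v ->
  exists N (c : nat -> F), v = \sum_(i < N) c i *: e i.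
Proof.
apply: (@span_min _ _ _ [set v | exists N (c : nat -> F), v = \sum_(i < N) c i *: e i]); last first.
  move=> _ [n _ <-]; exists n.+1, (fun i => (i == n)%:R).
  rewrite big_ord_recr /= eqxx scale1r big1 ?add0r// => i _.
  by rewrite (ltn_eqF (ltn_ord i)) scale0r.
have wide (c : nat -> F) N M : (N <= M)%N -> exists d : nat -> F,
    \sum_(i < N) c i *: e i = \sum_(i < M) d i *: e i.
  move=> NM; exists (fun i => if (i < N)%N then c i else 0).
  rewrite (big_ord_widen M (fun i => c i *: e i))// [LHS]big_mkcond.
  by apply: eq_bigr => i _; case: ifP; rewrite // scale0r.
split; first by exists 0, (fun=> 0); rewrite big_ord0.
move=> a _ _ [N [c ->]] [M [d ->]].
have [c' ->] := wide c N (N + M)%N (leq_addr _ _).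
have [d' ->] := wide d M (N + M)%N (leq_addl _ _).
exists (N + M)%N, (fun i => a * c' i + d' i).
by rewrite scaler_sumr -big_split; apply: eq_bigr => i _; rewrite scalerDl scalerA.
Qed.

Lemma not_spanned s : exists w, ~ span [set` s] w.
Proof.
have [e [eT eI]] := infV; apply: contrapT => nw.
have sT v : span [set` s] v by apply: contrapT => nv; apply: nw; exists v.
have [n eN] : exists N, forall v, v \in s -> exists c : nat -> F, v = \sum_(i < N) c i *: e i.
  elim: s {sT nw} => [|v s [N IH]]; first by exists 0.
  have : span (range e) v by rewrite eT.
  move=> /span_range_sum[M [c vE]]; exists (N + M)%N => w.
  have wide (d : nat -> F) K : (K <= N + M)%N -> exists d' : nat -> F,
      \sum_(i < K) d i *: e i = \sum_(i < N + M) d' i *: e i.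
    move=> NM; exists (fun i => if (i < K)%N then d i else 0).
    rewrite (big_ord_widen (N + M) (fun i => d i *: e i))// [LHS]big_mkcond.
    by apply: eq_bigr => i _; case: ifP; rewrite // scale0r.
  rewrite inE => /orP[/eqP->|/IH[d ->]]; last exact/wide/leq_addr.
  by rewrite vE; apply/wide/leq_addl.
have [c enE] : exists c : nat -> F, e n = \sum_(i < n) c i *: e i.
  have sub : subspace [set v | exists c : nat -> F, v = \sum_(i < n) c i *: e i].
    split; first by exists (fun=> 0); rewrite big1// => i _; rewrite scale0r.
    move=> a _ _ [c ->] [d ->]; exists (fun i => a * c i + d i).
    by rewrite scaler_sumr -big_split; apply: eq_bigr => i _; rewrite scalerDl scalerA.
  exact: (span_min sub _ (sT (e n))).
have := eI n.+1 (fun i => if val i == n then -1 else c i).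
rewrite big_ord_recr /= eqxx (eq_bigr (fun i : 'I_n => c i *: e i)); last first.
  by move=> i _; rewrite (ltn_eqF (ltn_ord i)).
rewrite -enE scaleN1r subrr => /(_ erefl ord_max) /=; rewrite eqxx => /eqP.
by rewrite oppr_eq0 oner_eq0.
Qed.

(** Elimination along the list: nondegeneracy settles the empty list, and a vector dual to [v]
    corrects the value at [v]. *)
Lemma dual_vector s w : ~ span [set` s] w ->
  exists2 u, (forall v, v \in s -> form u v = 0) & form u w = 1.
Proof.
elim: s w => [|v s IH] w nw.
  have [u uw] : exists u, form u w <> 0.
    apply: contrapT => nu; apply: nw; suff -> : w = 0 by apply: subspace0.
    by apply: form_nd => u; rewrite formC; apply: contrapT => wu; apply: nu; exists u.
  exists ((form u w)^-1 *: u) => //; rewrite linearZl_LR /= mulVf//; exact/eqP.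
have nws : ~ span [set` s] w.
  by apply: contra_not nw; apply: spanS => x /= xs; rewrite inE xs orbT.
have [vs|nvs] := pselect (span [set` s] v).
  have [u us uw] := IH _ nws; exists u => // x; rewrite inE => /orP[/eqP->|/us//].
  have sub : subspace [set x | form u x = 0].
    split; first exact: linear0r.
    by move=> a x' y /= Ex Ey; rewrite linearPr /= Ex Ey mulr0 addr0.
  by apply: (span_min sub _ vs) => y ys; apply: us.
have [uv uvs uvv] := IH _ nvs.
(* The shift of [w] anticipates the correction: [u - form u v *: uv] pairs with [w] as [u] does with
   the shifted vector. *)
have [|u us uw] := IH (w - form uv w *: v).
  move=> H; apply: nw; rewrite -[w](subrK (form uv w *: v)); apply: spanD.
    by apply: spanS H => x /= xs; rewrite inE xs orbT.
  by apply: spanZ; apply: sub_span; rewrite /= mem_head.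
exists (u - form u v *: uv).
  move=> x; rewrite inE linearBl /= linearZl_LR /= => /orP[/eqP->|xs].
    by rewrite uvv mulr1 subrr.
  by rewrite us// uvs// mulr0 subr0.
by rewrite linearBl /= linearZl_LR /= -uw linearBr /= linearZr_LR /= [X in _ - X]mulrC.
Qed.

(** The orthogonal complement of a finite list has finite codimension, expressed without quotients:
    each entry of [s] costs at most one vector of [r]. *)
Lemma orthogonal_cofinite s : exists r : seq V, forall x,
  exists2 y, (forall v, v \in s -> form y v = 0) & span [set` r] (x - y).
Proof.
elim: s => [|v s [r IH]].
  by exists [::] => x; exists x => //; rewrite subrr; apply: subspace0.
have [all0|] := pselect (forall y, (forall v, v \in s -> form y v = 0) -> form y v = 0).
  exists r => x; have [y ys xy] := IH x; exists y => // z.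
  by rewrite inE => /orP[/eqP->|/ys//]; apply: all0.
move=> /existsNP[y0 /not_implyP[y0s /eqP y0v]]; exists (y0 :: r) => x.
have [y ys xy] := IH x; exists (y - (form y v / form y0 v) *: y0).
  move=> z; rewrite inE linearBl /= linearZl_LR /= => /orP[/eqP->|zs].
    by rewrite divfK// subrr.
  by rewrite (ys _ zs) (y0s _ zs) mulr0 subr0.
rewrite opprB addrCA; apply: spanD.
  by apply: spanZ; apply: sub_span; rewrite /= mem_head.
by apply: spanS xy => z /= zr; rewrite inE zr orbT.
Qed.

Lemma orthogonal_not_spanned s : exists2 v, (forall x, x \in s -> form v x = 0) &
  ~ span [set` s] v.
Proof.
apply: contrapT => H; have [r rP] := orthogonal_cofinite s.
have [w] := not_spanned (s ++ r); apply.
have [y ys wy] := rP w; rewrite -[w](subrK y); apply: spanD.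
  by apply: spanS wy => z /= zr; rewrite mem_cat zr orbT.
have : span [set` s] y by apply: contrapT => ny; apply: H; exists y.
by apply: spanS => z /= zr; rewrite mem_cat zr.
Qed.

Lemma form_lin u : linear (fun v => (form u v : F^o)).
Proof. by move=> a x y; rewrite linearPr. Qed.

Lemma form_linl u : linear (fun v => (form v u : F^o)).
Proof. by move=> a x y; rewrite linearPl. Qed.

Lemma form_inj u v : (forall w, form u w = form v w) -> u = v.
Proof.
move=> uv; apply/eqP; rewrite -subr_eq0; apply/eqP/form_nd => w.
by rewrite linearBl /= uv subrr.
Qed.

Variable T : tensor_square form.
Local Notation act := (tens_act T).
Implicit Types (x y z : T).

Lemma act_linear x : linear (act x).
Proof. by move=> a u v; rewrite linearPr. Qed.

Lemma act_linearl u : linear (fun x => act x u).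
Proof. by move=> a x y; rewrite linearPl. Qed.

Lemma tens_ind (P : set T) : subspace P -> (forall v w, P (tens T v w)) -> forall x, P x.
Proof.
move=> sP Pt x; have : [set: T] x by []; rewrite -(tens_span T).
by apply: span_min => // _ [v _ [w _ <-]].
Qed.

Lemma act_tens_mul x y u : act (tens_mul T x y) u = act x (act y u).
Proof.
have sub1 y' : subspace [set x | forall u, act (tens_mul T x y') u = act x (act y' u)].
  split; first by move=> u'; rewrite !linear0l.
  by move=> a x1 x2 /= E1 E2 u'; rewrite !linearPl E1 E2.
move: x u; apply: (tens_ind (sub1 y)) => v w; move: y; apply: tens_ind.
  split; first by move=> u'; rewrite linear0r !linear0l linear0r.
  by move=> a x1 x2 /= E1 E2 u'; rewrite linearPr !linearPl linearPr E1 E2.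
move=> v' w' u; rewrite tens_mulE linearZl_LR /= !tens_actE scalerA.
by rewrite linearZl_LR /= mulrC.
Qed.

(** Write [x] as a sum of tensors of [e i] with [b i], for a basis [e]. Independence makes each
    [b i] orthogonal to all [u]. Identities in the tensor square can thus be checked on [V]. *)
Lemma act_faithful x : (forall u, act x u = 0) -> x = 0.
Proof.
have [e [eT eI]] := infV => x0.
have [N [b xE]] : exists N (b : nat -> V), x = \sum_(i < N) tens T (e i) (b i).
  move: x {x0}; pose P := [set x | exists N (b : nat -> V), x = \sum_(i < N) tens T (e i) (b i)].
  have wide (b : nat -> V) K M : (K <= M)%N -> exists b' : nat -> V,
      \sum_(i < K) tens T (e i) (b i) = \sum_(i < M) tens T (e i) (b' i).
    move=> NM; exists (fun i => if (i < K)%N then b i else 0).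
    rewrite (big_ord_widen M (fun i => tens T (e i) (b i)))// [LHS]big_mkcond.
    by apply: eq_bigr => i _; case: ifP; rewrite // linear0r.
  have sP : subspace P.
    split; first by exists 0, (fun=> 0); rewrite big_ord0.
    move=> a _ _ [K [b ->]] [M [d ->]].
    have [b' ->] := wide b K (K + M)%N (leq_addr _ _).
    have [d' ->] := wide d M (K + M)%N (leq_addl _ _).
    exists (K + M)%N, (fun i => a *: b' i + d' i).
    by rewrite scaler_sumr -big_split; apply: eq_bigr => i _; rewrite linearPr.
  apply: (tens_ind sP) => v w.
  have : span (range e) v by rewrite eT.
  move=> /span_range_sum[N [c ->]]; exists N, (fun i => c i *: w).
  by rewrite linear_sumlz; apply: eq_bigr => i _; rewrite linearZl_LR linearZr_LR.
rewrite xE big1// => i _; suff -> : b i = 0 by rewrite linear0r.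
apply: form_nd => u; rewrite formC.
apply: (eI N (fun i => form u (b i))) => //.
rewrite -[RHS](x0 u) xE (lin_sum _ _ _ (act_linearl u)).
by apply: eq_bigr => j _; rewrite tens_actE.
Qed.

Lemma act_inj x y : (forall u, act x u = act y u) -> x = y.
Proof.
move=> xy; apply/eqP; rewrite -subr_eq0; apply/eqP/act_faithful => u.
by rewrite linearBl /= xy subrr.
Qed.

Local Notation wedge := (wedge T).

Lemma act_wedge v w u : act (wedge v w) u = form u w *: v - form u v *: w.
Proof. by rewrite /wedge linearBl /= !tens_actE. Qed.

Lemma wedgeC v w : wedge v w = - wedge w v.
Proof. by rewrite /Defs.wedge opprB. Qed.

Lemma wedge_linear v : linear (wedge v).
Proof. by move=> a x y; rewrite /Defs.wedge linearPl linearPr scalerBr opprD addrACA. Qed.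

Lemma wedge_linearl w : linear (fun v => wedge v w).
Proof. by move=> a x y; rewrite /Defs.wedge linearPl linearPr scalerBr opprD addrACA. Qed.

Lemma wedge_setS (A A' B B' : set V) : A `<=` A' -> B `<=` B' ->
  wedge_set T A B `<=` wedge_set T A' B'.
Proof.
move=> AA BB; apply: spanS => _ [a /AA Aa [b /BB Bb <-]].
by exists a => //; exists b.
Qed.

Lemma sub_wedge_set (A B : set V) a b : A a -> B b -> wedge_set T A B (wedge a b).
Proof. by move=> Aa Bb; apply: sub_span; exists a => //; exists b. Qed.

Lemma wedge_set_min (A B : set V) (P : set T) : subspace P ->
  (forall a b, A a -> B b -> P (wedge a b)) -> wedge_set T A B `<=` P.
Proof. by move=> sP H; apply: span_min => // _ [a Aa [b Bb <-]]; apply: H. Qed.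

Lemma wedge_set_subspace (A B : set V) : subspace (wedge_set T A B).
Proof. exact: span_subspace. Qed.

Lemma so_wedge v w : so T (wedge v w).
Proof. exact: sub_wedge_set. Qed.

Lemma wedge_set_so (A B : set V) : wedge_set T A B `<=` so T.
Proof. exact: wedge_setS. Qed.

Lemma so_subspace : subspace (so T). Proof. exact: span_subspace. Qed.

Lemma so_skew x u v : so T x -> form (act x u) v = - form u (act x v).
Proof.
move=> sx; have sub : subspace [set x | forall u v, form (act x u) v + form u (act x v) = 0].
  split; first by move=> *; rewrite !linear0l linear0r addr0.
  move=> a y z /= Ey Ez u' v'; rewrite !linearPl /= linearPr /= addrACA -mulrDr.
  by rewrite Ey Ez mulr0 addr0.
apply/eqP; rewrite -addr_eq0; apply/eqP.
apply: (wedge_set_min sub _ sx) => a b _ _ /= u' v'; rewrite !act_wedge.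
rewrite linearBl /= !linearZl_LR /= linearBr /= !linearZr_LR /=.
by rewrite (formC u' a) (formC u' b) (formC b v') (formC a v'); ring.
Qed.

Lemma act_range_subspace x : subspace (range (act x)).
Proof.
split; first by exists 0 => //; rewrite linear0r.
by move=> a _ _ [u _ <-] [v _ <-]; exists (a *: u + v) => //; rewrite linearPr.
Qed.

Lemma act_range_finite x : finite_dim (range (act x)).
Proof.
suff [s sx] : exists s, forall u, span [set` s] (act x u).
  apply: (finite_dimS (A := span [set` s])); first by exists s.
    exact: act_range_subspace.
  by move=> _ [u _ <-].
move: x; apply: tens_ind; first split.
- by exists [::] => u; rewrite linear0l; apply: subspace0.
- move=> a x y [s sx] [r ry]; exists (s ++ r) => u; rewrite linearPl; apply: spanD.
    by apply: spanZ; apply: spanS (sx u) => z /= zr; rewrite mem_cat zr.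
  by apply: spanS (ry u) => z /= zr; rewrite mem_cat zr orbT.
- move=> v w; exists [:: v] => u; rewrite tens_actE; apply: spanZ; apply: sub_span.
  by rewrite /= mem_head.
Qed.

(* Half the sum of the wedges [x u_i /\ w_i], for [w_i] a basis of the image of
   [x] and [u_i] a dual family, recovers [x]. *)
Lemma so_wedge_range x : so T x -> wedge_set T (range (act x)) (range (act x)) x.
Proof.
move=> sx; set W := range (act x).
have [n [e We]] := finite_dimP (act_range_finite x); have [el ei _] := We.
pose w_ i := e (delta_mx 0 i).
have /choice[u_ uP] : forall i, exists u, forall j, form u (w_ j) = (i == j)%:R.
  move=> i; pose s := [seq w_ j | j <- enum 'I_n & j != i].
  have [|u us ui] := @dual_vector s (w_ i).
    move=> H; have sub : subspace [set v | exists c : 'rV[F]_n, c 0 i = 0 /\ v = e c].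
      split; first by exists 0; rewrite mxE (lin0 el).
      move=> a _ _ [c [ci ->]] [d [di ->]]; exists (a *: c + d).
      by rewrite !mxE ci di mulr0 addr0 el.
    have [|c [ci /ei E]] := span_min sub _ H.
      move=> _ /= /mapP[j + ->]; rewrite mem_filter => /andP[ji _].
      by exists (delta_mx 0 j); split=> //; rewrite mxE eqxx eq_sym (negPf ji).
    by move: ci; rewrite -E mxE !eqxx => /eqP; rewrite oner_eq0.
  exists u => j; have [<-//|ij] := eqVneq i j; apply: us.
  by apply/mapP; exists j => //; rewrite mem_filter eq_sym ij mem_enum.
have uc i (c : 'rV_n) : form (u_ i) (e c) = c 0 i.
  rewrite {1}(row_sum_delta c) (lin_sum _ _ _ el) (lin_sum _ _ _ (form_lin _)).
  rewrite (bigD1 i)//= big1 => [|j ji].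
    by rewrite addr0 (linZ _ _ el) linearZr_LR /= uP eqxx mulr1.
  by rewrite (linZ _ _ el) linearZr_LR /= uP eq_sym (negPf ji) mulr0.
have Wexp v : W v -> v = \sum_i form (u_ i) v *: w_ i.
  move=> /(coordinates_ex We)[c ->]; rewrite {1}(row_sum_delta c) (lin_sum _ _ _ el).
  by apply: eq_bigr => i _; rewrite (linZ _ _ el) uc.
have -> : x = \sum_i 2^-1 *: wedge (act x (u_ i)) (w_ i).
  apply: act_inj => u; rewrite (lin_sum _ _ _ (act_linearl u)).
  under eq_bigr do rewrite (linZ _ _ (act_linearl u)) act_wedge scalerBr.
  rewrite sumrB -!scaler_sumr -scalerBr.
  have -> : \sum_i form u (act x (u_ i)) *: w_ i = - act x u.
    rewrite [in RHS](Wexp (act x u)); last by exists u.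
    by rewrite -sumrN; apply: eq_bigr => i _; rewrite -scaleNr [form u _]formC so_skew.
  have -> : \sum_i form u (w_ i) *: act x (u_ i) = act x u.
    apply: form_inj => v; rewrite (lin_sum _ _ _ (form_linl v)) /=.
    rewrite (so_skew u v sx) [in RHS](Wexp (act x v)); last by exists v.
    rewrite (lin_sum _ _ _ (form_lin u)) -sumrN; apply: eq_bigr => i _.
    rewrite linearZl_LR linearZr_LR /= so_skew//.
    by rewrite mulrN mulrC.
  by rewrite opprK -mulr2n -scaler_nat scalerA mulVf ?scale1r// pnatr_eq0.
apply: (@subspace_sum _ _ (wedge_set T W W)) => [|i _]; first exact: wedge_set_subspace.
apply: spanZ; apply: sub_wedge_set; first by exists (u_ i).
exact: coordinates_mem We _.
Qed.

Lemma tens_comm_wedge x a b : so T x ->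
  tens_comm x (wedge a b) = wedge (act x a) b + wedge a (act x b).
Proof.
move=> sx; apply: act_inj => u; rewrite /tens_comm linearBl /= !act_tens_mul.
rewrite (linD _ _ (act_linearl u)) !act_wedge (linB _ _ (act_linear x)).
rewrite !(linZ _ _ (act_linear x)) (so_skew u a sx) (so_skew u b sx) !scaleNr !opprD !opprK.
by rewrite addrACA [RHS]addrACA; congr (_ + _); rewrite addrC.
Qed.

End Forms.

(** One way, a stable complement of the span of the eigenvectors would, if nonzero, contain another
    eigenvector. The other way, a maximal stable subspace disjoint from [w] is a complement. *)
Lemma ad_semisimple_diag (F : numClosedFieldType) (g : lieAlgType F) (m : set g) (x : g) :
  finite_dim m -> subalgebra m -> m x -> ad_semisimple [set x] m <-> diag_on m (lie x).
Proof.
move=> fm am mx; have [sm mlie] := am; have oad := operator_ad am mx.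
have [lx mlx] := oad; split=> [ss|dm st0 w [sw wm wst]].
  pose w := span [set u | m u /\ exists c, lie x u = c *: u].
  have wm : w `<=` m by apply: span_min => // u [].
  have [|w' [sw' w'm w'st] [mE ww'0]] := ss w.
    split; [exact: span_subspace|exact: wm|move=> _ y -> wy].
    apply: (span_min (subspace_preim lx (@span_subspace _ _ _)) _ wy) => u [mu [c uc]] /=.
    by rewrite uc; apply: spanZ; apply: sub_span; split=> //; exists c.
  move=> u mu; suff w'0 : forall v, w' v -> v = 0.
    by move: mu; rewrite [X in X u]mE => -[a wa [b /w'0 b0 <-]]; rewrite b0 addr0.
  move=> v w'v; apply/eqP/negPn/negP => v0.
  have ow' : operator w' (lie x) by split=> // z; apply: w'st.
  have [c [z [w'z z0 zc]]] := eigenvector_exists (finite_dimS fm sw' w'm) ow' w'v v0.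
  have : (w `&` w') z by split=> //; apply: sub_span; split; [exact: w'm|exists c].
  by rewrite ww'0 => /eqP; rewrite (negPf z0).
pose st (w' : set g) :=
  [/\ subspace w', w' `<=` m & forall x0 y, [set x] x0 -> w' y -> w' (lie x0 y)].
have [||w' [[sw' w'm w'st] ww'0] maxw'] :=
    @finite_dim_max _ _ m (fun w' => st w' /\ w `&` w' = [set 0]) fm.
- by move=> B [[sB Bm _] _].
- exists [set 0]; split; first split.
  + exact: subspace_set0.
  + by move=> _ ->; exact: subspace0.
  + by move=> x0 y _ ->; rewrite /= lie0r.
  + by apply/seteqP; split=> [z []|z ->]//; split=> //; exact: subspace0.
exists w' => //; split=> //.
pose s := [set a + b | a in w & b in w'].
have ss : subspace s.
  split; first by exists 0; [exact: subspace0|exists 0; [exact: subspace0|rewrite addr0]].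
  move=> c _ _ [a wa [b w'b <-]] [a' wa' [b' w'b' <-]]; exists (c *: a + a').
    by apply: subspaceD => //; exact: subspaceZ.
  exists (c *: b + b'); first by apply: subspaceD => //; exact: subspaceZ.
  by rewrite scalerDr addrACA.
apply/seteqP; split; last first.
  by move=> _ [a wa [b w'b <-]]; apply: subspaceD => //; [exact: wm|exact: w'm].
move=> u mu; apply: (span_min ss _ (dm _ mu)) => v [mv [c vc]]; apply: contrapT => nsv.
(* An eigenvector [v] outside the sum could be added to [w'] while still meeting [w] only in 0,
   against maximality. *)
pose w'' := [set a *: v + b | a in [set: F] & b in w'].
have w'w'' : w' `<=` w'' by move=> b w'b; exists 0 => //; exists b; rewrite ?scale0r ?add0r.
have w''v : w'' v by exists 1 => //; exists 0; rewrite ?scale1r ?addr0//; exact: subspace0.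
apply: (nsv); exists 0; first exact: subspace0.
exists v; last by rewrite add0r.
apply: (maxw' w'') => //; split; first split.
- split; first by apply: w'w''; exact: subspace0.
  move=> d _ _ [a _ [b w'b <-]] [a' _ [b' w'b' <-]]; exists (d * a + a') => //.
  exists (d *: b + b'); first by apply: subspaceD => //; exact: subspaceZ.
  by rewrite scalerDr scalerDl scalerA addrACA.
- move=> _ [a _ [b w'b <-]]; apply: subspaceD => //; [exact: subspaceZ|exact: w'm].
- move=> _ _ -> [a _ [b w'b <-]]; exists (a * c) => //; exists (lie x b); first exact: w'st.
  by rewrite lieDr lieZr vc scalerA.
- apply/seteqP; split=> [z [wz [a _ [b w'b abz]]]|_ ->]; last first.
    by split; [exact: subspace0|apply: w'w''; exact: subspace0].
  have [a0|a0] := eqVneq a 0.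
    by rewrite -ww'0; split=> //; rewrite -abz a0 scale0r add0r.
  exfalso; apply: nsv; exists (a^-1 *: z); first exact: subspaceZ.
  exists (- a^-1 *: b); first exact: subspaceZ.
  by rewrite -abz scalerDr scalerA mulVf// scale1r scaleNr addrK.
Qed.

(** * Toral subalgebras of a root-reductive Lie algebra *)

Section RootReductive.
Variables (F : numClosedFieldType) (g : lieAlgType F) (gs hs : nat -> set g).
Hypothesis rr : root_reductive gs hs.
Implicit Types (x y : g) (t : set g).

Lemma root_reductive_mono i j : (i <= j)%N -> gs i `<=` gs j.
Proof.
elim: j => [|j IH]; first by rewrite leqn0 => /eqP->.
rewrite leq_eqVlt => /orP[/eqP->//|]; rewrite ltnS => /IH ij.
by apply: (subset_trans ij); case: rr => _ _ _ /(_ j)[].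
Qed.

(** Diagonalizability goes up the chain by [diag_root_inclusion] and restricts to each [gs i], so
    the index in the definition is irrelevant. *)
Lemma semisimple_eltP x : semisimple_elt gs x <-> diag_on setT (lie x).
Proof.
have [red _ _ ri gT] := rr; split.
  move=> [i [gx ss]]; have dj j : (i <= j)%N -> diag_on (gs j) (lie x).
    elim: j => [|j IH].
      by rewrite leqn0 => /eqP i0; have [am fm _] := red i; rewrite i0 in gx ss am fm;
        apply/ad_semisimple_diag.
    rewrite leq_eqVlt => /orP[/eqP ij|]; last rewrite ltnS => ij.
      by have [am fm _] := red i; rewrite ij in gx ss am fm; apply/ad_semisimple_diag.
    apply: (diag_root_inclusion (red j) (red j.+1) (ri j)) (IH ij).
    exact: root_reductive_mono gx.
  move=> u _; have : (\bigcup_i gs i) u by rewrite gT.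
  move=> [j _ gu]; have := dj (maxn i j) (leq_maxl _ _) u.
  move=> /(_ (root_reductive_mono (leq_maxr _ _) gu)).
  by apply: spanS => w [_ wc].
move=> dx; have : (\bigcup_i gs i) x by rewrite gT.
move=> [i _ gx]; exists i; split=> //; have [am fm _] := red i.
apply/ad_semisimple_diag => //.
apply: (diag_onS (subspaceT g) (finite_dim_subspace fm) (lie_linear x)) => //.
by case: (operator_ad am gx).
Qed.

Lemma toral_diag t x : toral gs t -> t x -> diag_on setT (lie x).
Proof. by move=> [_ tt] /tt/semisimple_eltP. Qed.

(** If [[x, w] = c w], then [(ad w)^2 x = 0]; as [ad w] is diagonalizable, already [[w, x] = 0]. *)
Lemma toral_abelian t x y : toral gs t -> t x -> t y -> lie x y = 0.
Proof.
move=> tt tx ty; have [[st tlie] _] := tt.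
have dt : diag_on t (lie x).
  apply: (diag_onS (subspaceT g) st (lie_linear x)) => //; last exact: toral_diag tx.
  by move=> z tz; apply: tlie.
apply: (span_min (subspace_ker (lie_linear x)) _ (dt _ ty)) => w [tw [c wc]] /=.
apply: lie_eq0C; rewrite -(scale0r x).
apply: (diag_on_gen (subspaceT g) (lie_linear w) _ (toral_diag tt tw)) => //.
exists 2; rewrite (papply_XsubC0_exp _ _ (lie_linear w)) /= (lieC w x) wc.
by rewrite -scaleNr lieZr lie_alternating scaler0.
Qed.

Lemma toral_extension t y : toral gs t -> diag_on setT (lie y) ->
  (forall x, t x -> lie x y = 0) ->
  toral gs [set x + c *: y | x in t & c in [set: F]].
Proof.
move=> tt dy ty; have [[st tlie] _] := tt; split; first split; first split.
- by exists 0; [exact: subspace0|exists 0; rewrite // scale0r addr0].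
- move=> a _ _ [x tx [c _ <-]] [x' tx' [c' _ <-]]; exists (a *: x + x').
    by apply: subspaceD => //; exact: subspaceZ.
  by exists (a * c + c') => //; rewrite scalerDr scalerDl scalerA addrACA.
- move=> _ _ [x tx [c _ <-]] [x' tx' [c' _ <-]]; exists (lie x x'); first exact: tlie.
  exists 0 => //; rewrite lieDl !lieDr !lieZr !lieZl lie_alternating ty//.
  by rewrite (lie_eq0C (ty _ tx')) scale0r !scaler0 !addr0.
- move=> _ [x tx [c _ <-]]; apply/semisimple_eltP.
  move=> u Tu; have := @diag_on_comm _ _ setT (lie x) (lie y) c (subspaceT g).
  move=> /(_ (lie_linear x) (lie_linear y)) H.
  have {}H : diag_on setT (fun u => lie x u + c *: lie y u).
    apply: H => //; last exact: toral_diag tx.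
    by move=> v _; rewrite lieJ ty// lie0l add0r.
  by apply: spanS (H u Tu) => w [_ [d wd]]; split=> //; exists d; rewrite lieDl lieZl.
Qed.

Lemma maximal_toral_mem t y : maximal_toral gs t -> diag_on setT (lie y) ->
  (forall x, t x -> lie x y = 0) -> t y.
Proof.
move=> [tt maxt] dy ty; have tE := maxt _ (toral_extension tt dy ty).
have [[st _] _] := tt; rewrite -tE.
  by exists 0; [exact: subspace0|exists 1; rewrite // scale1r add0r].
by move=> x tx; exists x => //; exists 0; rewrite // scale0r addr0.
Qed.

End RootReductive.

(** * The summand [so(V)] and the action of [g] on [V] *)

Section OrthogonalSummand.
Variables (F : numClosedFieldType) (V : lmodType F) (form : {biscalar V})
  (T : tensor_square form) (g : lieAlgType F) (iota : T -> g) (k : set g)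
  (rho : {bilinear g -> V -> V}).
Hypotheses (infV : countably_infinite_dim V) (formC : form_symmetric form)
  (form_nd : form_nondegenerate form) (sds : so_direct_summand iota k)
  (rhoM : lie_module rho) (rhoE : extends_natural_module rho iota k)
  (formI : invariant_form rho form).
Implicit Types (u v w a b : V) (x y z : g) (s r : T) (c : F).

Local Notation act := (tens_act T).
Local Notation wedge := (wedge T).
Local Notation J := (iota @` so T).

Let so_sub : subspace (so T) := so_subspace T.
Let act_inj s r : (forall u, act s u = act r u) -> s = r := @act_inj _ _ _ infV formC form_nd T s r.

Lemma iota_linear c s r : so T s -> so T r -> iota (c *: s + r) = c *: iota s + iota r.
Proof. by case: sds => H _ _ _; apply: H. Qed.

Lemma iota_inj s r : so T s -> so T r -> iota s = iota r -> s = r.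
Proof. by case: sds => _ H _ _; apply: H. Qed.

Lemma iota_comm s r : so T s -> so T r -> iota (tens_comm s r) = lie (iota s) (iota r).
Proof. by case: sds => _ _ H _; apply: H. Qed.

Lemma iota0 : iota 0 = 0.
Proof.
have := iota_linear (-1) (subspace0 so_sub) (subspace0 so_sub).
by rewrite scaler0 addr0 scaleN1r addNr.
Qed.

Lemma iotaD s r : so T s -> so T r -> iota (s + r) = iota s + iota r.
Proof. by move=> ss sr; rewrite -[s in LHS]scale1r iota_linear// scale1r. Qed.

Lemma iotaZ c s : so T s -> iota (c *: s) = c *: iota s.
Proof.
move=> ss; have := iota_linear c ss (subspace0 so_sub).
by rewrite iota0 !addr0.
Qed.

Lemma iotaN s : so T s -> iota (- s) = - iota s.
Proof. by move=> ss; rewrite -scaleN1r iotaZ// scaleN1r. Qed.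

Lemma iota_image_subspace (P : set T) : subspace P -> P `<=` so T -> subspace (iota @` P).
Proof.
move=> sP Pso; split; first by exists 0; [exact: subspace0|exact: iota0].
move=> c _ _ [s Ps <-] [r Pr <-]; exists (c *: s + r); first by apply sP.
by rewrite iota_linear//; apply: Pso.
Qed.

Lemma iota_preim_subspace (A : set g) : subspace A -> subspace [set s | so T s /\ A (iota s)].
Proof.
move=> sA; split; first by split; [exact: subspace0|rewrite iota0; exact: subspace0].
move=> c s r [ss As] [sr Ar]; split; first by apply so_sub.
by rewrite iota_linear//; apply sA.
Qed.

Lemma iota_wedge_linear v : linear (fun w => iota (wedge v w)).
Proof. by move=> c u w; rewrite wedge_linear iota_linear//; exact: so_wedge. Qed.

Lemma iota_wedge_linearl w : linear (fun v => iota (wedge v w)).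
Proof. by move=> c u v; rewrite (wedge_linearl T w) iota_linear//; exact: so_wedge. Qed.

Lemma rho_linear x : linear (rho x).
Proof. by move=> c u v; rewrite linearPr. Qed.

Lemma rho_linearl u : linear (fun x => rho x u).
Proof. by move=> c x y; rewrite linearPl. Qed.

Lemma rho_iota s u : so T s -> rho (iota s) u = act s u.
Proof. by case: rhoE => H _; apply: H. Qed.

Lemma rho_skew x u v : form (rho x u) v = - form u (rho x v).
Proof. by apply/eqP; rewrite -addr_eq0 formI. Qed.

Lemma tens_comm_linear s : linear (tens_comm s).
Proof.
move=> c r r'; rewrite /tens_comm linearPr linearPl scalerBr opprD.
by rewrite addrACA.
Qed.

Lemma so_comm s r : so T s -> so T r -> so T (tens_comm s r).
Proof.
move=> ss sr.
apply: (wedge_set_min (subspace_preim (tens_comm_linear s) so_sub) _ sr) => a b _ _ /=.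
by rewrite tens_comm_wedge//; apply: (subspaceD so_sub); apply: so_wedge.
Qed.

(** For [v], [v'] orthogonal to [a], [b] with [<v, v'> = 1], the bracket of [a /\ v] and [v' /\ b]
    is [a /\ b - <a, b> v' /\ v]. Exchanging [v] and [v'] and averaging removes the last term. *)
Lemma so_perfect : so T `<=` span [set tens_comm s r | s in so T & r in so T].
Proof.
apply: wedge_set_min; first exact: span_subspace.
move=> a b _ _; have [v vab nv] := orthogonal_not_spanned form infV [:: a; b].
have [v' v'ab v'v] := dual_vector formC form_nd nv.
have E (u u' : V) : form u a = 0 -> form u b = 0 -> form u' a = 0 -> form u' b = 0 ->
    form u u' = 1 -> tens_comm (wedge a u) (wedge u' b) = wedge a b - form a b *: wedge u' u.
  move=> ua ub u'a u'b uu'; rewrite tens_comm_wedge//; last exact: so_wedge.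
  rewrite !act_wedge (formC u' u) uu' u'a scale1r scale0r subr0.
  rewrite (formC b u) ub scale0r sub0r (linN _ (wedge_linear T _)).
  by rewrite (linZ _ _ (wedge_linear T _)) (formC b a).
have vv' : form v v' = 1 by rewrite formC.
have [va vb] : form v a = 0 /\ form v b = 0 by rewrite !vab ?inE ?eqxx ?orbT.
have [v'a v'b] : form v' a = 0 /\ form v' b = 0 by rewrite !v'ab ?inE ?eqxx ?orbT.
have E1 := E v v' va vb v'a v'b vv'; have E2 := E v' v v'a v'b va vb v'v.
have -> : wedge a b = 2^-1 *: (tens_comm (wedge a v) (wedge v' b) +
    tens_comm (wedge a v') (wedge v b)).
  rewrite E1 E2 (wedgeC T v v') scalerN opprK addrACA addNr addr0 -mulr2n.
  by rewrite -scaler_nat scalerA mulVf ?scale1r// pnatr_eq0.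
apply: spanZ; apply: spanD; apply: sub_span.
  by exists (wedge a v); [exact: so_wedge|exists (wedge v' b) => //; exact: so_wedge].
by exists (wedge a v'); [exact: so_wedge|exists (wedge v b) => //; exact: so_wedge].
Qed.

(** The hypothesis gives an ideal of [[g, g]] only. Perfectness extends this to [g]: in [[y,
    [s1, s2]]] the Jacobi identity leaves brackets of [so(V)] with elements [[y, s1]], [[y, s2]] of
    [[g, g]]. *)
Lemma so_ideal y s : so T s -> exists2 r, so T r & lie y (iota s) = iota r.
Proof.
have [_ _ _ [[sJ Jgg JI] _ _]] := sds.
move=> ss; suff : J (lie y (iota s)) by move=> [r sr <-]; exists r.
have sP := iota_preim_subspace (subspace_preim (lie_linear y) sJ).
have [] // := span_min sP _ (so_perfect ss) => _ [s1 s1s [s2 s2s <-]].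
split; first exact: so_comm.
have JM z r : J z -> so T r -> J (lie z (iota r)).
  by move=> /Jgg ggz sr; apply: JI => //; exists r.
have ggy z : lie_set [set: g] [set: g] (lie y z) by apply: sub_lie_set.
rewrite /= iota_comm// lieJ; apply: (subspaceD sJ).
  by apply: JI => //; exists s2.
rewrite lieC; apply: (subspaceN sJ); apply: JI => //.
Qed.

(** Both sides lie in [so(V)], where elements are determined by their action on [V]; the actions
    agree by invariance of the form. Everything about brackets with [so(V)] is computed through this
    formula. *)
Lemma lie_iota_wedge y a b :
  lie y (iota (wedge a b)) = iota (wedge (rho y a) b + wedge a (rho y b)).
Proof.
have sab : so T (wedge a b) by exact: so_wedge.
have [r sr E] := so_ideal y sab; rewrite E; congr iota.
apply: act_inj => u; rewrite -(rho_iota _ sr) -E rhoM !rho_iota; try exact: so_wedge.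
rewrite (linD _ _ (@act_linearl _ _ _ T u)) !act_wedge (linB _ _ (rho_linear y)).
rewrite !(linZ _ _ (rho_linear y)) !rho_skew !scaleNr !opprD !opprK.
by rewrite addrACA [RHS]addrACA; congr (_ + _); rewrite addrC.
Qed.

Lemma iota_eigen_act y s c u : so T s -> lie y (iota s) = c *: iota s ->
  rho y (act s u) = act s (rho y u) + c *: act s u.
Proof.
move=> ss E; rewrite -!(rho_iota _ ss); have := rhoM y (iota s) u.
rewrite E linearZl_LR /= => /eqP; rewrite eq_sym subr_eq => /eqP ->.
by rewrite addrC.
Qed.

Lemma act_transitive v : exists s u, so T s /\ act s u = v.
Proof.
have [w nw] := not_spanned infV [:: v].
have [u uv uw] := dual_vector formC form_nd nw.
exists (wedge v w), u; split; first exact: so_wedge.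
by rewrite act_wedge uw uv ?mem_head// scale1r scale0r subr0.
Qed.

Lemma gen_eigen_wedge x c d v w : gen_eigen (rho x) c v -> gen_eigen (rho x) d w ->
  gen_eigen (lie x) (c + d) (iota (wedge v w)).
Proof.
apply: (@gen_eigen_bilinear F V V g (fun v w => iota (wedge v w)) setT setT (rho x) (rho x)) => //.
- exact: iota_wedge_linear.
- exact: iota_wedge_linearl.
- exact: rho_linear.
- exact: rho_linear.
- exact: lie_linear.
- by move=> a b _ _; rewrite lie_iota_wedge iotaD//; exact: so_wedge.
Qed.

(** Write [v = s u] and decompose [s] into eigenvectors [r] of [ad x]. The range of such an [r] is
    finite-dimensional and stable under [x]. *)
Lemma semisimple_span_gen x v : diag_on setT (lie x) ->
  span [set w | exists c, gen_eigen (rho x) c w] v.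
Proof.
move=> dx; have [s [u [ss <-]]] := act_transitive v.
have sJ : subspace J by apply: iota_image_subspace.
have dJ : diag_on J (lie x).
  apply: (diag_onS (subspaceT g) sJ (lie_linear x)) => // _ [r sr <-].
  by have [r' sr' ->] := so_ideal x sr; exists r'.
rewrite -(rho_iota _ ss).
have sP := subspace_preim (rho_linearl u)
  (@span_subspace _ _ [set w | exists c, gen_eigen (rho x) c w]).
apply: (span_min sP _ (dJ (iota s) _)); last by exists s.
move=> _ [[r sr <-] [c rc]] /=; rewrite rho_iota//.
have oW : operator (range (act r)) (rho x).
  split; first exact: rho_linear.
  move=> _ [u' _ <-]; rewrite (iota_eigen_act u' sr rc).
  by apply: subspaceD; [exact: act_range_subspace|exists (rho x u')|
    apply: subspaceZ; [exact: act_range_subspace|exists u']].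
have Wu : range (act r) (act r u) by exists u.
by apply: spanS (span_gen_eigen (act_range_finite r) oW Wu) => w [].
Qed.

(* If [v1 = (x - c) v2] is a nonzero eigenvector, then semisimplicity of [x] on
   [v2 /\ w] gives [v1 /\ w + v2 /\ (x - d) w = 0] for every generalized eigenvector
   [w] of eigenvalue [d]; this is impossible when [w] is not in the span of [v1], [v2]. *)
Lemma semisimple_diag_module x : diag_on setT (lie x) -> diag_on setT (rho x).
Proof.
move=> dx v _; have lX := rho_linear x.
suff H w c : gen_eigen (rho x) c w -> rho x w = c *: w.
  by apply: spanS (semisimple_span_gen v dx) => w [c /H wc]; split=> //; exists c.
move=> cw; apply: contrapT => nwc.
have [v2 [c2 v10 v1c]] : exists v2, [/\ gen_eigen (rho x) c v2, rho x v2 - c *: v2 <> 0 &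
    rho x (rho x v2 - c *: v2) = c *: (rho x v2 - c *: v2)].
  (* From a minimal exponent [n + 2], the vector [(x - c)^n w] starts a Jordan chain of length 2. *)
  have ex : exists n, papply (('X - c%:P) ^+ n) (rho x) w == 0.
    by case: cw => n E; exists n; apply/eqP.
  case: (ex_minnP ex) => -[|[|n]].
  - rewrite expr0 -polyC1 papplyC scale1r => /eqP w0; case: nwc.
    by rewrite w0 (lin0 lX) scaler0.
  - by rewrite expr1 papplyXsubC subr_eq0 => /eqP.
  move=> /eqP E minn; exists (papply (('X - c%:P) ^+ n) (rho x) w).
  rewrite -papplyXsubC -papplyM// -exprS; split.
  - by exists 2; rewrite -papplyM// -exprD.
  - by move=> E'; have := minn n.+1; rewrite E' eqxx ltnn => /(_ isT).
  - by apply/eqP; rewrite -subr_eq0 -papplyXsubC -papplyM// -exprS; apply/eqP.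
set v1 := rho x v2 - c *: v2 in v10 v1c.
have [w' [d dw'] nw'] : exists2 w', (exists d, gen_eigen (rho x) d w') &
    ~ span [set` [:: v1; v2]] w'.
  apply: contrapT => H; have [z] := not_spanned infV [:: v1; v2]; apply.
  apply: (span_min (@span_subspace _ _ _) _ (semisimple_span_gen z dx)) => w' dw'.
  by apply: contrapT => nw'; apply: H; exists w'.
have [u uv uw'] := dual_vector formC form_nd nw'.
have uv1 : form u v1 = 0 by apply: uv; rewrite mem_head.
have uv2 : form u v2 = 0 by apply: uv; rewrite !inE eqxx orbT.
have := diag_on_gen (subspaceT g) (lie_linear x) _ dx _ (gen_eigen_wedge c2 dw').
move=> /(_ (fun _ _ => I) I); rewrite lie_iota_wedge -iotaZ; last exact: so_wedge.
move=> /iota_inj E; have {E}E : wedge (rho x v2) w' + wedge v2 (rho x w') =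
    (c + d) *: wedge v2 w'.
  by apply: E; [apply: (subspaceD so_sub)|apply: (subspaceZ _ so_sub)]; exact: so_wedge.
have xv2 : rho x v2 = v1 + c *: v2 by rewrite subrK.
have uxv2 : form u (rho x v2) = 0.
  by rewrite xv2 linearDr /= linearZr_LR /= uv1 uv2 mulr0 addr0.
(* Since [u] is orthogonal to [v1], [v2] and dual to [w'], this gives [v1 = e v2]. As [v1] is an
   eigenvector, either [e = 0] or [v2] is one too, and [v1 = 0] in both cases. *)
have := congr1 (fun s => act s u) E.
rewrite (linD _ _ (@act_linearl _ _ _ T u)) (linZ _ _ (@act_linearl _ _ _ T u)).
rewrite !act_wedge uv2 uxv2 uw'.
rewrite !scale0r !subr0 !scale1r => {}E.
have v1e : v1 = (d - form u (rho x w')) *: v2.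
  rewrite /v1 scalerBl -[d](addKr c) [- c + _]addrC scalerBl -E.
  by rewrite [RHS]addrAC addrK.
apply: v10; rewrite v1e; move: v1c; rewrite v1e (linZ _ _ lX).
set e := d - _; have [->|e0] := eqVneq e 0; first by rewrite !scale0r.
rewrite scalerA [c * e]mulrC -scalerA => /(scalerI e0) E'.
by rewrite -v1e /v1 E' subrr.
Qed.

End OrthogonalSummand.

Lemma span1P (F : fieldType) (U : lmodType F) (v u : U) : span [set v] u -> exists c, u = c *: v.
Proof.
apply: (@span_min _ _ _ [set u | exists c, u = c *: v]); last first.
  by move=> _ ->; exists 1; rewrite scale1r.
split; first by exists 0; rewrite scale0r.
by move=> a _ _ [c ->] [d ->]; exists (a * c + d); rewrite scalerDl scalerA.
Qed.

(** * Weight spaces of a toral subalgebra *)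

Section ToralWeights.
Variables (F : numClosedFieldType) (V : lmodType F) (form : {biscalar V})
  (T : tensor_square form) (g : lieAlgType F) (gs hs : nat -> set g)
  (iota : T -> g) (k : set g) (rho : {bilinear g -> V -> V}).
Hypotheses (infV : countably_infinite_dim V) (formC : form_symmetric form)
  (form_nd : form_nondegenerate form) (rr : root_reductive gs hs)
  (sds : so_direct_summand iota k)
  (rhoM : lie_module rho) (rhoE : extends_natural_module rho iota k)
  (formI : invariant_form rho form).
Implicit Types (u v w a b e : V) (x y z : g) (s r : T) (c : F).

Local Notation act := (tens_act T).
Local Notation wedge := (wedge T).
Local Notation J := (iota @` so T).
Local Notation "''V^' alpha" := (weight_space rho alpha)
  (at level 8, alpha at level 2, format "''V^' alpha").

Let rho_lin x : linear (rho x) := rho_linear rho x.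
Let lie_wedge y a b : lie y (iota (wedge a b)) = iota (wedge (rho y a) b + wedge a (rho y b)) :=
  lie_iota_wedge infV formC form_nd sds rhoM rhoE formI y a b.
Let so_sub : subspace (so T) := so_subspace T.
Let sow a b : so T (wedge a b). Proof. exact: so_wedge. Qed.

(** Invariance makes the form an equivariant map to the trivial module, where only the eigenvalue 0
    occurs. *)
Lemma gen_pairing x c d v w : gen_eigen (rho x) c v -> gen_eigen (rho x) d w ->
  c + d != 0 -> form v w = 0.
Proof.
move=> cv dw cd0; have l0 : linear (fun _ : F^o => 0 : F^o).
  by move=> a y z; rewrite scaler0 addr0.
have [n] : gen_eigen (fun _ : F^o => 0 : F^o) (c + d) (form v w : F^o).
  apply: (@gen_eigen_bilinear F V V (F^o) (fun v w => form v w) setT setT (rho x) (rho x)) => //.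
  - exact: form_lin.
  - exact: form_linl.
rewrite (papply_eigen _ l0 (c := 0)) ?scale0r// horner_exp hornerXsubC sub0r => /eqP.
by rewrite scaler_eq0 expf_eq0 oppr_eq0 (negPf cd0) andbF => /eqP.
Qed.

Section Weights.
Variable t : set g.

Lemma weight_space_gen (alpha : t -> F) v (x : t) : 'V^alpha v ->
  gen_eigen (rho (val x)) (alpha x) v.
Proof. by move=> [n _ /(_ x) E]; apply/gen_eigen_iterP => //; exists n. Qed.

Lemma weight_space_eigen (alpha : t -> F) v :
  (forall x : t, rho (val x) v = alpha x *: v) -> 'V^alpha v.
Proof. by move=> vE; exists 1 => // x /=; rewrite vE subrr. Qed.

Lemma weight_space_pairing (alpha beta : t -> F) v w : 'V^alpha v -> 'V^beta w ->
  form v w != 0 -> beta = - alpha.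
Proof.
move=> av bw; apply: contra_neqP => nab; apply: contrapT => vw; apply: nab.
apply/funext => x; apply/eqP; rewrite -addr_eq0; apply/negPn/negP; rewrite addrC => ab.
by apply: vw; apply: gen_pairing (weight_space_gen x av) (weight_space_gen x bw) ab.
Qed.

Lemma weight_isotropic (alpha : t -> F) v w : alpha <> 0 -> 'V^alpha v -> 'V^alpha w ->
  form v w = 0.
Proof.
move=> a0 av aw; apply/eqP/negPn/negP => /(weight_space_pairing av aw) aa; apply: a0.
apply/funext => x; have := congr1 (fun f => f x) aa => /= /eqP.
by rewrite -addr_eq0 -mulr2n mulrn_eq0 => /eqP.
Qed.

Lemma dual_opp (alpha : t -> F) : dual alpha -> dual (- alpha).
Proof. by move=> da c x y z xyz; rewrite /= !opprfctE (da c x y z xyz) opprD mulrN. Qed.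

End Weights.

Section Toral.
Variable t : set g.
Hypothesis tt : toral gs t.

Let st : subspace t. Proof. by case: tt => -[]. Qed.
Let tmem (x : t) : t (val x). Proof. exact: set_mem (valP x). Qed.

Lemma toral_module_diag x : t x -> diag_on setT (rho x).
Proof.
move=> tx; apply: (semisimple_diag_module infV formC form_nd sds rhoM rhoE formI).
exact: (toral_diag rr tt tx).
Qed.

Lemma toral_gen_eigen x c v : t x -> gen_eigen (rho x) c v -> rho x v = c *: v.
Proof.
by move=> tx; apply: (diag_on_gen (subspaceT V) (rho_lin x) _ (toral_module_diag tx)).
Qed.

Lemma weight_spaceP (alpha : t -> F) v :
  'V^alpha v <-> forall x : t, rho (val x) v = alpha x *: v.
Proof.
split; last exact: weight_space_eigen.
by move=> av x; apply: toral_gen_eigen => //; exact: weight_space_gen.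
Qed.

Lemma weight_space_subspace (alpha : t -> F) : subspace 'V^alpha.
Proof.
split; first by apply/weight_spaceP => x; rewrite linear0r scaler0.
move=> c u v /weight_spaceP uE /weight_spaceP vE; apply/weight_spaceP => x.
by rewrite linearPr uE vE scalerDr !scalerA mulrC.
Qed.

Lemma toral_module_comm x y v : t x -> t y -> rho x (rho y v) = rho y (rho x v).
Proof.
move=> tx ty; apply/eqP; rewrite -subr_eq0 -rhoM (toral_abelian rr tt tx ty).
by rewrite linear0l.
Qed.

Lemma toral_joint_weight v : v != 0 -> (forall x, t x -> exists c, rho x v = c *: v) ->
  exists2 alpha : t -> F, dual alpha & 'V^alpha v.
Proof.
move=> v0 vJ; have /choice[alpha aP] : forall x : t, exists c, rho (val x) v = c *: v.
  by move=> x; apply: vJ.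
exists alpha; last exact: weight_space_eigen.
move=> c x y z xyz; apply: (scaler_inj_scalar v0).
by rewrite scalerDl -scalerA -!aP xyz linearPl.
Qed.

Lemma range_joint s v : so T s -> (forall x, t x -> lie x (iota s) = 0) ->
  range (act s) v -> span (joint_eigen t (fun x => rho x) (range (act s))) v.
Proof.
move=> ss ts.
have st' x : t x -> stable (range (act s)) (rho x).
  move=> tx _ [u _ <-]; exists (rho x u) => //.
  by rewrite (iota_eigen_act (c := 0) rhoM rhoE u ss) ?scale0r ?addr0// ts.
apply: joint_eigen_span => //.
- exact: act_range_finite.
- move=> x tx; apply: (diag_onS (subspaceT V) (act_range_subspace s) (rho_lin x)) => //.
    exact: st'.
  exact: toral_module_diag.
- by move=> x y u tx ty _; apply: toral_module_comm.
Qed.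

Lemma wedge_weight_comm (alpha : t -> F) a b x : 'V^alpha a -> 'V^(- alpha) b -> t x ->
  lie x (iota (wedge a b)) = 0.
Proof.
move=> /weight_spaceP aE /weight_spaceP bE tx; rewrite lie_wedge.
have := aE (exist _ x (mem_set tx)); have := bE (exist _ x (mem_set tx)) => /= -> ->.
rewrite (linZ _ _ (wedge_linear T a)) (linZ _ _ (wedge_linearl T b)).
by rewrite opprfctE /= scaleNr addrN (iota0 sds).
Qed.

(** The range of [s] is spanned by weight vectors and [s] lies in its exterior square, so [s] is a
    sum of wedges of weight vectors. Commuting with [t] leaves those of total weight 0. *)
Lemma centralizer_span s : so T s -> (forall x, t x -> lie x (iota s) = 0) ->
  span [set r | exists alpha : t -> F, dual alpha /\ exists a b,
    [/\ 'V^alpha a /\ range (act s) a, 'V^(- alpha) b /\ range (act s) b & r = wedge a b]] s.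
Proof.
move=> ss ts; set Q := [set r | _].
pose K := [set v | joint_eigen t (fun x => rho x) (range (act s)) v].
pose J0 := [set iota (wedge a b) | a in K & b in K].
have KZ c v : K v -> K (c *: v).
  move=> [Wv vJ]; split; first by apply: subspaceZ => //; exact: act_range_subspace.
  move=> x tx; have [d xv] := vJ x tx; exists d.
  by rewrite (linZ _ _ (rho_lin x)) xv !scalerA mulrC.
have J0s : span J0 (iota s).
  have sP := iota_preim_subspace sds (@span_subspace _ _ J0).
  have [] // := wedge_set_min sP _ (so_wedge_range infV formC form_nd ss) => a b Wa Wb.
  split; first exact: sow.
  have sPb := subspace_preim (iota_wedge_linearl sds b) (@span_subspace _ _ J0).
  apply: (span_min sPb _ (range_joint ss ts Wa)) => a' Ka' /=.
  have sPa := subspace_preim (iota_wedge_linear sds a') (@span_subspace _ _ J0).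
  apply: (span_min sPa _ (range_joint ss ts Wb)) => b' Kb' /=.
  by apply: sub_span; exists a' => //; exists b'.
have J0Z c j : J0 j -> J0 (c *: j).
  move=> [a Ka [b Kb <-]]; exists (c *: a); first exact: KZ.
  by exists b => //; rewrite (linZ _ _ (iota_wedge_linearl sds b)).
have J0e j x : J0 j -> t x -> exists c, lie x j = c *: j.
  move=> [a [_ aJ] [b [_ bJ] <-]] tx; have [c xa] := aJ x tx; have [d xb] := bJ x tx.
  exists (c + d); rewrite lie_wedge xa xb (linZ _ _ (wedge_linear T a)).
  by rewrite (linZ _ _ (wedge_linearl T b)) -scalerDl (iotaZ sds).
have J1s := span_weight0 (fun x _ => lie_linear x) J0Z J0e J0s ts.
have Qso : span Q `<=` so T by apply: span_min => // _ [al [_ [a [b [_ _ ->]]]]].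
have [s' Qs' /(iota_inj sds)] : (iota @` span Q) (iota s); last first.
  by move=> E; rewrite -E//; exact: Qso.
apply: (span_min (iota_image_subspace sds (@span_subspace _ _ Q) Qso) _ J1s).
move=> j [[a [Wa aJ] [b [Wb bJ] <-]] jt]; exists (wedge a b) => //.
have [ab0|ab0] := eqVneq (wedge a b) 0; first by rewrite ab0; apply: subspace0.
have a0 : a != 0 by apply: contra_neq ab0 => ->; rewrite (lin0 (wedge_linearl T b)).
have b0 : b != 0 by apply: contra_neq ab0 => ->; rewrite (lin0 (wedge_linear T a)).
have [al dal aal] := toral_joint_weight a0 aJ.
have [be dbe bbe] := toral_joint_weight b0 bJ.
apply: sub_span; exists al; split=> //; exists a, b; split=> //; split=> //.
suff -> : - al = be by [].
apply/funext => x; apply/eqP; rewrite eq_sym -addr_eq0 addrC.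
have := jt _ (tmem x); rewrite lie_wedge.
move/weight_spaceP: aal => ->; move/weight_spaceP: bbe => ->.
rewrite (linZ _ _ (wedge_linear T a)) (linZ _ _ (wedge_linearl T b)) -scalerDl.
rewrite -(iota0 sds) => /(iota_inj sds) E.
have /eqP := E (subspaceZ _ so_sub (sow a b)) (subspace0 so_sub).
by rewrite scaler_eq0 (negPf ab0) orbF.
Qed.

(** For any [y] the bracket of [v /\ w] with [y] is minus the sum of eigenvectors [P] and [Q] for
    [-c] and [c]. Correcting [y] by multiples of them gives an element commuting with [v /\ w]. *)
Lemma hyperbolic_diag v w : form v v = 0 -> form w w = 0 -> form v w != 0 ->
  diag_on setT (lie (iota (wedge v w))).
Proof.
move=> vv ww vw0; set c := form v w in vw0 *; move=> y _.
have skew0 u : form (rho y u) u = 0.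
  have := rho_skew formI y u u; rewrite [form u (rho y u)]formC => /eqP.
  by rewrite -addr_eq0 -mulr2n mulrn_eq0 => /eqP.
have rhoS u : rho (iota (wedge v w)) u = form u w *: v - form u v *: w.
  by rewrite (rho_iota rhoE)// act_wedge.
(* This [a] makes [v' = y v - a v] orthogonal to [w]; as [y] is skew, [w' = y w + a w] is then
   orthogonal to [v]. *)
pose a := form (rho y v) w / c.
have aE : form (rho y w) v / c = - a by rewrite (rho_skew formI) formC mulNr.
set v' := rho y v - a *: v; set w' := rho y w + a *: w.
have v'v : form v' v = 0 by rewrite /v' linearBl /= linearZl_LR /= vv skew0 mulr0 subr0.
have v'w : form v' w = 0 by rewrite /v' linearBl /= linearZl_LR /= -/c /a divfK// subrr.
have w'w : form w' w = 0 by rewrite /w' linearDl /= linearZl_LR /= ww skew0 mulr0 addr0.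
have w'v : form w' v = 0.
  rewrite /w' linearDl /= linearZl_LR /= [form w v]formC -/c /a divfK//.
  by rewrite (rho_skew formI y w) [form w _]formC addNr.
pose P := iota (wedge v' w); pose Q := iota (wedge v w').
have rv : rho y v = v' + a *: v by rewrite subrK.
have rw : rho y w = w' - a *: w by rewrite addrK.
have Sy : lie (iota (wedge v w)) y = - (P + Q).
  rewrite lieC lie_wedge rv rw -(iotaD sds)//; congr (- iota _).
  rewrite (linD _ _ (wedge_linearl T w)) (linB _ _ (wedge_linear T v)).
  rewrite (linZ _ _ (wedge_linearl T w)) (linZ _ _ (wedge_linear T v)).
  by rewrite addrACA addrN addr0.
have SP : lie (iota (wedge v w)) P = - c *: P.
  rewrite lie_wedge !rhoS v'v v'w ww [form w v]formC -/c !scale0r subrr sub0r.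
  rewrite (lin0 (wedge_linearl T w)) add0r (linN _ (wedge_linear T v')).
  by rewrite (linZ _ _ (wedge_linear T v')) -scaleNr (iotaZ sds).
have SQ : lie (iota (wedge v w)) Q = c *: Q.
  rewrite lie_wedge !rhoS w'v w'w vv -/c !scale0r subrr subr0.
  rewrite (lin0 (wedge_linear T v)) addr0.
  by rewrite (linZ _ _ (wedge_linearl T w')) (iotaZ sds).
have -> : y = (y - c^-1 *: P + c^-1 *: Q) + (c^-1 *: P - c^-1 *: Q).
  by rewrite -addrA [c^-1 *: Q + _]addrCA subrr addr0 subrK.
apply: spanD; last first.
  by rewrite -scaleNr; apply: spanD; apply: spanZ; apply: sub_span; split=> //;
    [exists (- c)|exists c].
apply: sub_span; split=> //; exists 0; rewrite scale0r lieDr lieBr !lieZr Sy SP SQ.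
rewrite !scalerA mulrN mulVf// scaleN1r scale1r opprK.
by rewrite -addrA addNr.
Qed.

(* The form on [V^0] has rank at most 1. *)
Definition zero_weight_rank1 := exists2 e, 'V^(0 : t -> F) e &
  (forall v w, 'V^(0 : t -> F) v -> 'V^(0 : t -> F) w -> form v w = 0) \/
  (form e e != 0 /\ forall v w, 'V^(0 : t -> F) v -> 'V^(0 : t -> F) w ->
     form v w = form v e * form w e / form e e).

(** Such an [s] maps [V] to [V^0] and acts there with rank at most 1, with image orthogonal to [e].
    So products of two such elements vanish on [V^0], and [s^3 = 0] on [V]. *)
Lemma zero_wedge_act : zero_weight_rank1 -> exists e, forall s,
  wedge_set T 'V^(0 : t -> F) 'V^(0 : t -> F) s ->
  (forall u, 'V^(0 : t -> F) (act s u)) /\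
  exists2 sg, 'V^(0 : t -> F) sg /\ form sg e = 0 &
    forall u, 'V^(0 : t -> F) u -> act s u = form u e *: sg.
Proof.
have sV := weight_space_subspace (0 : t -> F); move=> [e e0 eP]; exists e.
apply: wedge_set_min; last first.
  move=> a b a0 b0; split.
    by move=> u; rewrite act_wedge; apply: subspaceB => //; apply: subspaceZ.
  case: eP => [iso|[ee rk]].
    exists 0; first by split; [exact: subspace0|rewrite linear0l].
    by move=> u u0; rewrite act_wedge iso// iso// !scale0r subrr scaler0.
  exists ((form b e / form e e) *: a - (form a e / form e e) *: b).
    split; first by apply: subspaceB => //; apply: subspaceZ.
    by rewrite linearBl /= !linearZl_LR /= mulrAC [X in _ - X]mulrAC [form b e * _]mulrC subrr.
  move=> u u0; rewrite act_wedge (rk _ _ u0 b0) (rk _ _ u0 a0) scalerBr !scalerA.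
  by rewrite -!mulrA.
split.
  split; first by move=> u; rewrite linear0l; apply: subspace0.
  exists 0; first by split; [exact: subspace0|rewrite linear0l].
  by move=> u _; rewrite linear0l scaler0.
move=> c s r [s0 [sg [sg0 sge] sE]] [r0 [sg' [sg0' sge'] rE]]; split.
  by move=> u; rewrite linearPl; apply: subspaceD => //; apply: subspaceZ.
exists (c *: sg + sg').
  split; first by apply: subspaceD => //; apply: subspaceZ.
  by rewrite linearPl /= sge sge' mulr0 addr0.
by move=> u u0; rewrite linearPl sE// rE// scalerDr !scalerA mulrC.
Qed.

End Toral.

(** * Maximal toral subalgebras in general *)

Section MaximalToral.
Variable t : set g.
Hypothesis mt : maximal_toral gs t.

Let tt : toral gs t. Proof. by case: mt. Qed.

Lemma hyperbolic_mem (alpha : t -> F) v w : 'V^alpha v -> 'V^(- alpha) w ->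
  form v v = 0 -> form w w = 0 -> form v w != 0 -> t (iota (wedge v w)).
Proof.
move=> av aw vv ww vw; apply: (maximal_toral_mem rr mt); first exact: hyperbolic_diag.
by move=> x tx; apply: wedge_weight_comm av aw tx.
Qed.

Lemma weight_line (alpha : t -> F) v w : alpha <> 0 -> 'V^alpha v -> 'V^(- alpha) w ->
  form v w != 0 -> 'V^alpha = span [set v].
Proof.
move=> a0 av aw vw; have aN0 : - alpha <> 0 by move=> /eqP; rewrite oppr_eq0 => /eqP.
have tvw : t (iota (wedge v w)).
  have vv := weight_isotropic a0 av av; have ww := weight_isotropic aN0 aw aw.
  exact: (hyperbolic_mem av aw vv ww vw).
pose x : t := exist _ (iota (wedge v w)) (mem_set tvw).
(* The element [v /\ w] of [t] acts on [u] by its weight, and by [u] to [<u, w> v]; taking [u = v]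
   shows that the weight is nonzero. *)
have xE u : 'V^alpha u -> alpha x *: u = form u w *: v.
  move=> au; have /(weight_spaceP tt)/(_ x) := au; rewrite /= (rho_iota rhoE)// act_wedge.
  by rewrite (weight_isotropic a0 au av) scale0r subr0.
have v0 : v != 0 by apply: contra_neq vw => ->; rewrite linear0l.
have ax : alpha x = form v w by apply: (scaler_inj_scalar v0); rewrite xE.
apply/seteqP; split=> [u au|].
  have -> : u = (alpha x)^-1 *: (form u w *: v) by rewrite -xE// scalerA mulVf ?scale1r// ax.
  by apply: spanZ; apply: spanZ; apply: sub_span.
by apply: span_min => [|_ ->//]; exact: weight_space_subspace.
Qed.

Theorem maximal_toral_pairing : weight_pairing form rho t.
Proof.
move=> alpha beta da db.
move=> /existsNP[v /existsNP[w /not_implyP[av /not_implyP[bw /eqP vw]]]].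
have ba := weight_space_pairing av bw vw; split=> // a0; rewrite ba in bw.
have v0 : v != 0 by apply: contra_neq vw => ->; rewrite linear0l.
have w0 : w != 0 by apply: contra_neq vw => ->; rewrite linear0r.
split; first by exists v => //; apply: weight_line av bw vw.
exists w => //; apply: (weight_line (w := v)) => //; last by rewrite formC.
- by move=> /eqP; rewrite oppr_eq0 => /eqP.
- by rewrite opprK.
Qed.

Local Notation zso := (centralizer J t).

Lemma zso_span s : so T s -> zso (iota s) ->
  span [set r | exists alpha : t -> F, dual alpha /\ exists a b,
    [/\ 'V^alpha a /\ range (act s) a, 'V^(- alpha) b /\ range (act s) b & r = wedge a b]] s.
Proof. by move=> ss [_ zs]; apply: centralizer_span => // x tx; apply/lie_eq0C/zs. Qed.

Lemma zso_wedge (alpha : t -> F) a b : 'V^alpha a -> 'V^(- alpha) b -> zso (iota (wedge a b)).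
Proof.
move=> aa ab; split; first by exists (wedge a b).
by move=> x tx; apply: lie_eq0C; exact: (wedge_weight_comm tt aa ab tx).
Qed.

Lemma zso_subspace : subspace zso.
Proof. exact/centralizer_subspace/(iota_image_subspace sds so_sub). Qed.

Lemma zso_kills y : (forall (alpha : t -> F) a b, dual alpha -> 'V^alpha a ->
    'V^(- alpha) b -> lie y (iota (wedge a b)) = 0) ->
  forall z, zso z -> lie y z = 0.
Proof.
move=> H z zz; have [[s ss sz] _] := zz; rewrite -sz in zz *.
have [|_ //] := span_min (iota_preim_subspace sds (subspace_ker (lie_linear y))) _ (zso_span ss zz).
by move=> _ [alpha [da [a [b [[aa _] [ab _] ->]]]]]; split=> //; apply: H aa ab.
Qed.

(** The spaces [V^alpha] and [V^(-alpha)] could only pair with each other, so they are orthogonal to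
    every weight space. *)
Lemma isotropic_pair_kills (alpha beta : t -> F) a b u :
  orthogonal_sets form 'V^alpha 'V^(- alpha) -> 'V^alpha a -> 'V^(- alpha) b ->
  'V^beta u -> act (wedge a b) u = 0.
Proof.
move=> orth aa ab bu; rewrite act_wedge.
have -> : form u b = 0.
  rewrite formC; apply/eqP/negPn/negP => bu0.
  have ba := weight_space_pairing ab bu bu0; rewrite ba opprK in bu.
  by move: bu0; rewrite formC orth ?eqxx.
have -> : form u a = 0.
  rewrite formC; apply/eqP/negPn/negP => au0.
  have ba := weight_space_pairing aa bu au0; rewrite ba in bu.
  by move: au0; rewrite orth ?eqxx.
by rewrite !scale0r subrr.
Qed.

Theorem maximal_toral_isotropic : isotropic_pairs_central iota rho t.
Proof.
move=> alpha da orth _ [s + <-].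
have sP := iota_preim_subspace sds (centralizer_subspace zso zso_subspace).
move=> ws; have [] // := wedge_set_min sP _ ws => a b aa ab; split=> //.
split; first exact: zso_wedge ab.
apply: zso_kills => beta c d db bc bd; rewrite lie_wedge !(rho_iota rhoE)//.
rewrite (isotropic_pair_kills orth aa ab bc) (isotropic_pair_kills orth aa ab bd).
by rewrite (lin0 (wedge_linear T c)) (lin0 (wedge_linearl T d)) addr0 (iota0 sds).
Qed.

(** Otherwise [v /\ w] lies in [t] and has [v] as eigenvector with eigenvalue [<v, w>], although [v]
    has weight 0. *)
Let isotropic_zero_pair v w : 'V^(0 : t -> F) v -> 'V^(0 : t -> F) w ->
  form v v = 0 -> form w w = 0 -> form v w = 0.
Proof.
move=> v0 w0 vv ww; apply/eqP/negPn/negP => vw.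
have w0' : 'V^(- (0 : t -> F)) w by rewrite oppr0.
have tvw := hyperbolic_mem v0 w0' vv ww vw.
have /(weight_spaceP tt)/(_ (exist _ (iota (wedge v w)) (mem_set tvw))) := v0.
rewrite /= (rho_iota rhoE)// act_wedge vv scale0r subr0 scale0r => /eqP.
by rewrite scaler_eq0 (negPf vw) /= => /eqP v00; rewrite v00 linear0l eqxx in vw.
Qed.

(** Isotropic vectors of [V^0] are mutually orthogonal. If [e] is not isotropic, its orthogonal in
    [V^0] consists of isotropic vectors, so projecting along [e] determines the form. *)
Lemma zero_weight_form : zero_weight_rank1 t.
Proof.
have sV := weight_space_subspace tt (0 : t -> F).
have [[e [e0 /eqP ee]]|H] := pselect (exists e, 'V^(0 : t -> F) e /\ form e e <> 0); last first.
  exists 0; first exact: subspace0.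
  left=> v w v0 w0; have iso u : 'V^(0 : t -> F) u -> form u u = 0.
    by move=> u0; apply: contrapT => uu; apply: H; exists u.
  exact: isotropic_zero_pair (iso _ v0) (iso _ w0).
exists e => //; right; split=> //.
have orth u : 'V^(0 : t -> F) u -> form u e = 0 -> form u u = 0.
  move=> u0 ue; apply/eqP/negPn/negP => uu.
  (* If [<u, u>] were nonzero, this scaling would make [e + l u] and [e - l u] isotropic, with
     product [2 <e, e>] different from 0. *)
  pose l := sqrtC (- (form e e / form u u)).
  have l2 : l * l * form u u = - form e e.
    by rewrite -expr2 sqrtCK mulNr divfK.
  have lu0 : 'V^(0 : t -> F) (l *: u) by apply: subspaceZ.
  have eu : form e u = 0 by rewrite formC.
  have : form (e + l *: u) (e - l *: u) = 0.
    apply: isotropic_zero_pair.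
    - exact: subspaceD.
    - exact: subspaceB.
    - rewrite linearDl /= !linearDr /= !linearZl_LR /= !linearZr_LR /= ue eu.
      by rewrite !mulr0 addr0 add0r mulrA l2 addrN.
    - rewrite linearBl /= !linearBr /= !linearZl_LR /= !linearZr_LR /= ue eu.
      by rewrite !mulr0 subr0 sub0r opprK mulrA l2 addrN.
  rewrite linearDl /= !linearBr /= !linearZl_LR /= !linearZr_LR /= ue eu.
  rewrite !mulr0 subr0 sub0r mulrA l2 opprK -mulr2n => /eqP.
  by rewrite mulrn_eq0 /= (negPf ee).
move=> v w v0 w0; pose p u := u - (form u e / form e e) *: e.
have p0 u : 'V^(0 : t -> F) u -> 'V^(0 : t -> F) (p u).
  by move=> u0; apply: subspaceB => //; apply: subspaceZ.
have pe u : form (p u) e = 0 by rewrite /p linearBl /= linearZl_LR /= divfK// subrr.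
have : form (p v) (p w) = 0.
  by apply: isotropic_zero_pair; try exact: p0; apply: orth => //; exact: p0.
rewrite [in X in form _ X]/p linearBr /= linearZr_LR /= pe mulr0 subr0.
rewrite /p linearBl /= linearZl_LR /= => /eqP; rewrite subr_eq0 => /eqP ->.
by rewrite (formC e w) mulrAC.
Qed.

Theorem maximal_toral_zero_weight : zero_weight_condition iota rho t.
Proof.
have sV := weight_space_subspace tt (0 : t -> F); split.
  have [e e0 [iso|[ee rk]]] := zero_weight_form.
    left; exists (fun=> 0); first by case.
    move=> v v0; exists [ffun=> 0]; split; last by move=> c _; apply/ffunP => -[].
    by move=> w w0; rewrite big_ord0 subr0 iso.
  right; exists (fun=> e) => // v v0; exists [ffun=> form v e / form e e]; split.
    move=> w w0; rewrite big_ord1 ffunE linearBl /= linearZl_LR /=.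
    by rewrite (rk _ _ v0 w0) (formC e w) [X in X - _]mulrAC subrr.
  move=> c /(_ e e0); rewrite big_ord1 linearBl /= linearZl_LR /= => /eqP.
  rewrite subr_eq0 => /eqP ->; apply/ffunP => i; rewrite ffunE mulfK// (ord1 i) //.
apply/seteqP; split=> [_ [[s ss <-] ts]|_ ->]; last first.
  split; last by case: tt => -[[? _] _].
  by exists 0; [exact: (subspace0 (wedge_set_subspace T _ _))|exact: (iota0 sds)].
have [e /(_ s ss)[s0 _]] := zero_wedge_act tt zero_weight_form.
have sso : so T s by apply: wedge_set_so ss.
suff -> : s = 0 by exact: iota0 sds.
apply: (act_faithful infV formC form_nd) => u.
rewrite -(rho_iota rhoE u sso) -(scale0r u).
(* The image of [s] is in [V^0], which [s] annihilates as an element of [t]. So [s^2 = 0], and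
   [s = 0] by semisimplicity. *)
apply: (toral_gen_eigen tt ts); exists 2.
rewrite (papply_XsubC0_exp _ _ (rho_lin _)) /=.
have /(weight_spaceP tt)/(_ (exist _ (iota s) (mem_set ts))) := s0 u.
by rewrite /= scale0r -(rho_iota rhoE u sso).
Qed.

(** A wedge of weights [alpha] and [-alpha], with [alpha] nonzero, is central in the centralizer:
    either the pair is orthogonal, or both spaces are lines and the wedge is a multiple of an
    element of [t]. *)
Let zso_decomposition p : zso p -> exists z s,
  [/\ zso z, forall y, zso y -> lie z y = 0, wedge_set T 'V^(0 : t -> F) 'V^(0 : t -> F) s &
   p = z + iota s].
Proof.
move=> zp; have [[s ss sp] _] := zp; rewrite -sp in zp *.
pose K := [set p | exists z s, [/\ zso z, forall y, zso y -> lie z y = 0,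
   wedge_set T 'V^(0 : t -> F) 'V^(0 : t -> F) s & p = z + iota s]].
have sW := wedge_set_subspace T 'V^(0 : t -> F) 'V^(0 : t -> F).
have sz := zso_subspace.
have sK : subspace K.
  split.
    exists 0, 0; split; [exact: subspace0|by move=> y _; rewrite lie0l|exact: subspace0|].
    by rewrite (iota0 sds) addr0.
  move=> c _ _ [z [r [zz zc wr ->]]] [z' [r' [zz' zc' wr' ->]]].
  exists (c *: z + z'), (c *: r + r'); split.
  - by apply: (subspaceD sz) => //; apply: (subspaceZ _ sz).
  - by move=> y zy; rewrite lieDl lieZl zc// zc'// scaler0 addr0.
  - by apply: (subspaceD sW) => //; apply: (subspaceZ _ sW).
  - rewrite (iota_linear sds c (wedge_set_so wr) (wedge_set_so wr')) scalerDr.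
    exact: addrACA.
have [|_ //] := span_min (iota_preim_subspace sds sK) _ (zso_span ss zp).
move=> _ [alpha [da [a [b [[aa _] [ab _] ->]]]]]; split=> //.
have zab := zso_wedge aa ab.
have [al0|al0] := eqVneq alpha 0.
  exists 0, (wedge a b); split; rewrite ?add0r//; first exact: subspace0.
    by move=> y _; rewrite lie0l.
  by rewrite al0 oppr0 in aa ab; apply: sub_wedge_set.
exists (iota (wedge a b)), 0; split=> //; last by rewrite (iota0 sds) addr0.
  2: exact: subspace0.
have [orth|north] := pselect (orthogonal_sets form 'V^alpha 'V^(- alpha)).
  have [_ cz //] : center zso (iota (wedge a b)).
    apply: (maximal_toral_isotropic da orth).
    by exists (wedge a b) => //; apply: sub_wedge_set.
have [_ /(_ (elimN eqP al0))[[v v0 vE] [w w0 wE]]] :=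
  maximal_toral_pairing da (dual_opp da) north.
have vv : 'V^alpha v by rewrite vE; apply: sub_span.
have ww : 'V^(- alpha) w by rewrite wE; apply: sub_span.
have a0 : alpha <> 0 by exact/eqP.
have aN0 : - alpha <> 0 by move=> /eqP; rewrite oppr_eq0 => /eqP.
have vw : form v w != 0.
  apply/negP => /eqP vw; apply: north => u u'; rewrite vE wE => /span1P[c ->] /span1P[d ->].
  by rewrite linearZl_LR /= linearZr_LR /= vw !mulr0.
have tvw := hyperbolic_mem vv ww (weight_isotropic a0 vv vv) (weight_isotropic aN0 ww ww) vw.
move: aa ab; rewrite vE wE => /span1P[c ->] /span1P[d ->] y [_ yt].
rewrite (linZ _ _ (wedge_linear T _)) (linZ _ _ (wedge_linearl T w)) !(iotaZ sds)//.
  by rewrite !lieZl (lie_eq0C (yt _ tvw)) !scaler0.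
exact: (subspaceZ _ so_sub).
Qed.

(** Modulo central elements only the exterior square of [V^0] remains. A bracket of two of its
    elements annihilates [V^0], hence commutes with all wedges of vectors of [V^0]. *)
Theorem maximal_toral_centralizer : centralizer_condition iota t.
Proof.
rewrite /centralizer_condition /nilpotent_depth_le2; apply: span0.
move=> _ [p zzp [q zq <-]] /=; move: p zzp.
apply: (lie_set_min (subspace_lie_ker q)) => x y zx zy /=.
have wedge_zso s : wedge_set T 'V^(0 : t -> F) 'V^(0 : t -> F) s -> zso (iota s).
  move=> ws; have [] // := wedge_set_min (iota_preim_subspace sds zso_subspace) _ ws.
  by move=> a b a0 b0; split=> //; apply: zso_wedge a0 _; rewrite oppr0.
have [z1 [s1 [zz1 zc1 ws1 xE]]] := zso_decomposition zx.
have [z2 [s2 [zz2 zc2 ws2 yE]]] := zso_decomposition zy.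
have [z3 [s3 [zz3 zc3 ws3 qE]]] := zso_decomposition zq.
have -> : lie x y = lie (iota s1) (iota s2).
  rewrite xE yE lieDl lieDr zc1// zc1 ?add0r; last exact: wedge_zso.
  by rewrite lieDr (lie_eq0C (zc2 _ (wedge_zso _ ws1))) !add0r.
have so1 := wedge_set_so ws1; have so2 := wedge_set_so ws2; have so3 := wedge_set_so ws3.
rewrite qE lieDr lie_lie (lie_eq0C (zc3 _ (wedge_zso _ ws2))).
rewrite (lie_eq0C (zc3 _ (wedge_zso _ ws1))) !lie0r subrr add0r.
rewrite -(iota_comm sds)//.
have so12 : so T (tens_comm s1 s2) by apply: so_comm.
rewrite -(iota_comm sds)// (_ : tens_comm _ s3 = 0) ?(iota0 sds)//.
have [e eP] := zero_wedge_act tt zero_weight_form.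
have [_ [sg1 [sg10 sg1e] s1E]] := eP _ ws1; have [_ [sg2 [sg20 sg2e] s2E]] := eP _ ws2.
have kill u : 'V^(0 : t -> F) u -> act (tens_comm s1 s2) u = 0.
  move=> u0; rewrite /tens_comm linearBl /= !act_tens_mul (s2E _ u0) (s1E _ u0).
  rewrite (linZ _ _ (act_linear s1)) (linZ _ _ (act_linear s2)) (s1E _ sg20) (s2E _ sg10).
  by rewrite sg1e sg2e !scale0r !scaler0 subrr.
have : [set r | tens_comm (tens_comm s1 s2) r = 0] s3; last by [].
apply: (wedge_set_min (subspace_ker (tens_comm_linear (tens_comm s1 s2))) _ ws3) => a b a0 b0 /=.
rewrite (tens_comm_wedge infV formC form_nd _ _ so12) (kill _ a0) (kill _ b0).
by rewrite (lin0 (wedge_linear T a)) (lin0 (wedge_linearl T b)) addr0.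
Qed.

End MaximalToral.

(** * Maximal toral subalgebras of [so(V)]: support and decomposition *)

Section Forward.
Hypothesis surj : iota @` so T = [set: g].
Variable t : set g.
Hypothesis mt : maximal_toral gs t.

Let tt : toral gs t. Proof. by case: mt. Qed.
Let st : subspace t. Proof. by case: tt => -[]. Qed.
Let tmem (x : t) : t (val x). Proof. exact: set_mem (valP x). Qed.

(** Some [x] in [t], which is an [s] of [so(V)], acts on [v] by a nonzero scalar, so [v] pairs
    nontrivially with some [s u]. The range of [s] is spanned by weight vectors, and one of them
    pairs with [v]. *)
Lemma nonzero_weight_partner (alpha : t -> F) v : alpha <> 0 -> 'V^alpha v -> v != 0 ->
  exists2 w, 'V^(- alpha) w & form v w != 0.
Proof.
move=> a0 av v0; have [x ax] : exists x : t, alpha x != 0.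
  apply: contrapT => H; apply: a0; apply/funext => x; apply/eqP/negPn/negP => ax.
  by apply: H; exists x.
have [s ss sx] : (iota @` so T) (val x) by rewrite surj.
have ts y : t y -> lie y (iota s) = 0.
  by move=> ty; rewrite sx; apply: (toral_abelian rr tt).
have sv : act s v = alpha x *: v.
  by rewrite -(rho_iota rhoE)// sx; move/(weight_spaceP tt): av => ->.
have [u vu] : exists u, form v u <> 0.
  apply: contrapT => nu; move/eqP: v0; apply; apply: form_nd => u; apply: contrapT => vu.
  by apply: nu; exists u.
have vsu : form v (act s u) <> 0.
  have := so_skew formC v u ss; rewrite sv linearZl_LR /= => E vsu.
  move: E; rewrite vsu oppr0 => /eqP; rewrite mulf_eq0 (negPf ax) /= => /eqP.
  exact: vu.
have Wsu : range (act s) (act s u) by exists u.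
apply: contrapT => H; apply: vsu.
have sub : subspace [set w | form v w = 0].
  split; first exact: linear0r.
  by move=> c y z /= Ey Ez; rewrite linearPr /= Ey Ez mulr0 addr0.
apply: (span_min sub _ (range_joint tt ss ts Wsu)).
move=> w [_ wJ] /=; have [->|w0] := eqVneq w 0; first exact: linear0r.
have [be _ bw] := toral_joint_weight w0 wJ.
apply/eqP/negPn/negP => vw; apply: H; exists w => //.
by rewrite -(weight_space_pairing av bw vw).
Qed.

Lemma supp_vector (alpha : t -> F) : supp rho t alpha <->
  dual alpha /\ exists2 v, 'V^alpha v & v != 0.
Proof.
split=> [[da an]|[da [v av v0]]]; split=> //.
  apply: contrapT => H; apply: an; apply/seteqP; split=> [v av|_ ->].
    by apply: contrapT => /eqP v0; apply: H; exists v.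
  by exists 1 => // x /=; rewrite linear0r scaler0 subrr.
by move=> E; move: av v0; rewrite E => /= ->; rewrite eqxx.
Qed.

Lemma supp_opp (alpha : t -> F) : supp rho t alpha -> supp rho t (- alpha).
Proof.
have [->|/eqP a0] := eqVneq alpha 0; first by rewrite oppr0.
move=> /supp_vector[da [v av v0]]; apply/supp_vector; split; first exact: dual_opp.
have [w aw vw] := nonzero_weight_partner a0 av v0; exists w => //.
by apply: contra_neq vw => ->; rewrite linear0r.
Qed.

Theorem maximal_toral_support : support_condition rho t.
Proof.
split.
  apply/seteqP; split=> [alpha sa|_ [alpha sa <-]]; last exact: supp_opp.
  by exists (- alpha); [exact: supp_opp|rewrite opprK].
move=> alpha [/supp_vector[da [v av v0]] a0].
have [w aw vw] := nonzero_weight_partner a0 av v0.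
exists v => //; apply: (weight_line mt a0 av aw vw).
Qed.

Theorem maximal_toral_decomposition : decomposition_condition iota rho t.
Proof.
pose P (alpha : t -> F) := [set beta | beta = alpha \/ beta = - alpha].
(* The choice depends only on the set [P alpha], which is the same for [alpha] and [- alpha]; so one
   weight of each pair is selected. *)
pose rep alpha := xget 0 (P alpha).
have PN alpha : P (- alpha) = P alpha.
  by apply/seteqP; split=> be [->|->]; rewrite /P /= ?opprK; [right|left|right|left].
have repP alpha : rep alpha = alpha \/ rep alpha = - alpha.
  by apply: (@xgetPex _ 0 (P alpha)); exists alpha; left.
have repN alpha : rep (- alpha) = rep alpha by rewrite /rep PN.
pose I := [set alpha | (supp rho t `\ 0) alpha /\ rep alpha = alpha].
have oppI alpha : I alpha -> ~ I (- alpha).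
  move=> [[_ a0] ra] [_]; rewrite repN ra => E; apply: a0; apply/funext => x.
  by have /eqP := congr1 (fun f => f x) E; rewrite /= -addr_eq0 -mulr2n mulrn_eq0 => /eqP.
have suppI alpha : supp rho t alpha -> alpha <> 0 -> I alpha \/ I (- alpha).
  move=> sa a0; have aN0 : - alpha <> 0 by move=> /eqP; rewrite oppr_eq0 => /eqP.
  have [ra|ra] := repP alpha; [left|right]; split=> //.
    by split=> //; exact: supp_opp.
  by rewrite repN.
exists I; split.
- apply/seteqP; split=> // alpha [Ia [be Ib ba]].
  by apply: (oppI _ Ib); rewrite ba.
- apply/seteqP; split=> [alpha [[]//|[be [[sb b0] _] <-]]|alpha [sa a0]].
    split; first exact: supp_opp.
    by move=> /eqP; rewrite oppr_eq0 => /eqP.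
  have [Ia|Ia] := suppI _ sa a0; [by left|right].
  by exists (- alpha) => //; rewrite opprK.
have lineI alpha : I alpha -> exists v w, [/\ 'V^alpha = span [set v],
    'V^(- alpha) = span [set w], form v w != 0, form v v = 0 & t (iota (wedge v w))].
  move=> [[/supp_vector[da [v av v0]] a0] _].
  have aN0 : - alpha <> 0 by move=> /eqP; rewrite oppr_eq0 => /eqP.
  have [w aw vw] := nonzero_weight_partner a0 av v0; exists v, w; split=> //.
  - exact: (weight_line mt a0 av aw vw).
  - apply: (weight_line mt aN0 aw (w := v)).
      by rewrite opprK.
    by rewrite formC.
  - exact: (weight_isotropic a0 av av).
  - apply: (hyperbolic_mem mt av aw _ _ vw).
      exact: (weight_isotropic a0 av av).
    exact: (weight_isotropic aN0 aw aw).
pose A alpha := iota @` wedge_set T 'V^alpha 'V^(- alpha).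
split.
  apply/seteqP; split=> [y ty|].
    have [s ss sy] : (iota @` so T) y by rewrite surj.
    have ts x : t x -> lie x (iota s) = 0.
      by move=> tx; rewrite sy; apply: (toral_abelian rr tt).
    have Qs := centralizer_span tt ss ts.
    rewrite -sy; set B := span _.
    have sB : subspace B by exact: span_subspace.
    have [|_ //] := span_min (iota_preim_subspace sds sB) _ Qs.
    move=> _ [alpha [da [a [b [[aa [u _ ua]] [ab _] ->]]]]]; split=> //.
    have [->|ab0] := eqVneq (wedge a b) 0; first by rewrite (iota0 sds); exact: subspace0.
    have a0 : a != 0 by apply: contra_neq ab0 => ->; rewrite (lin0 (wedge_linearl T b)).
    (* For weight 0, [a = y u] is killed by [y], so [y^2 u = 0] and [a = 0]. This is why
       [centralizer_span] keeps [a] in the range of [s]. *)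
    have al0 : alpha <> 0.
      move=> al0; move/eqP: a0; apply; rewrite -ua -(rho_iota rhoE)// sy -(scale0r u).
      apply: (toral_gen_eigen tt ty); exists 2.
      rewrite (papply_XsubC0_exp _ _ (rho_lin y)) /= -{2}sy (rho_iota rhoE)// ua.
      move/(weight_spaceP tt): aa.
      by move=> /(_ (exist _ y (mem_set ty))) /= ->; rewrite al0 scale0r.
    have sa : supp rho t alpha by apply/supp_vector; split=> //; exists a.
    have [Ia|Ia] := suppI _ sa al0; apply: sub_span.
      by exists alpha => //; exists (wedge a b) => //; apply: sub_wedge_set.
    exists (- alpha) => //; exists (wedge a b) => //.
    rewrite wedgeC; apply: (subspaceN (wedge_set_subspace T _ _)).
    by apply: sub_wedge_set; rewrite ?opprK.
  apply: span_min => // _ [alpha Ia [s ws <-]].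
  have [v [w [vE wE _ _ tvw]]] := lineI _ Ia.
  have [|_ //] := wedge_set_min (iota_preim_subspace sds st) _ ws.
  move=> a b; rewrite vE wE => /span1P[c ->] /span1P[d ->]; split=> //.
  rewrite (linZ _ _ (iota_wedge_linear sds _)) (linZ _ _ (iota_wedge_linearl sds w)).
  by apply: subspaceZ => //; apply: subspaceZ.
move=> j Ij _ [[s ws <-] Bs].
have [v [w [vE wE vw vv tvw]]] := lineI _ Ij.
have [c sE] : exists c, s = c *: wedge v w.
  have sub : subspace [set s | exists c, s = c *: wedge v w].
    split; first by exists 0; rewrite scale0r.
    by move=> a _ _ [c ->] [d ->]; exists (a * c + d); rewrite scalerDl scalerA.
  apply: (wedge_set_min sub _ ws) => a b; rewrite vE wE => /span1P[c ->] /span1P[d ->].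
  exists (d * c); rewrite (linZ _ _ (wedge_linear T _)) (linZ _ _ (wedge_linearl T w)).
  by rewrite scalerA.
have jv : 'V^j v by rewrite vE; apply: sub_span.
(* The sum is direct because the other summands annihilate [v], whereas [v /\ w] sends it to
   [<v, w> v]. *)
have : rho (iota s) v = 0.
  apply: (span_min (subspace_ker (rho_linearl rho v)) _ Bs) => _ [al [Ial alj] [r wr <-]] /=.
  rewrite (rho_iota rhoE); last exact: wedge_set_so wr.
  apply: (wedge_set_min (subspace_ker (@act_linearl _ _ _ T v)) _ wr) => a b aa ab /=.
  rewrite act_wedge (_ : form v b = 0) 1?(_ : form v a = 0) ?scale0r ?subrr//.
    apply/eqP/negPn/negP => va; have E := weight_space_pairing jv aa va.
    by apply: (oppI _ Ij); rewrite -E.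
  apply/eqP/negPn/negP => vb; have /oppr_inj E := weight_space_pairing jv ab vb.
  exact: alj.
rewrite (rho_iota rhoE); last exact: wedge_set_so ws.
rewrite sE (linZ _ _ (@act_linearl _ _ _ T v)) act_wedge vv scale0r subr0 scalerA => /eqP.
rewrite scaler_eq0 mulf_eq0 (negPf vw) orbF => /orP[/eqP->|/eqP v0].
  by rewrite scale0r; exact: iota0 sds.
by move: vw; rewrite v0 linear0l eqxx.
Qed.

End Forward.

Lemma restricted_rank_form (t : set g) :
  restricted_rank form 'V^(0 : t -> F) 0 \/ restricted_rank form 'V^(0 : t -> F) 1 ->
  zero_weight_rank1 t.
Proof.
move=> [[e _ eP]|[e e0 eP]].
  exists 0; first by exists 1 => // x /=; rewrite linear0r scaler0 subrr.
  left=> v w v0 w0; have [c [/(_ w w0) + _]] := eP v v0.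
  by rewrite big_ord0 subr0.
exists (e ord0) => //; have E v : 'V^(0 : t -> F) v -> exists c, forall w,
    'V^(0 : t -> F) w -> form v w = c * form (e ord0) w.
  move=> v0; have [c [cP _]] := eP v v0; exists (c ord0) => w w0.
  have := cP w w0; rewrite big_ord1 linearBl /= linearZl_LR /= => /eqP.
  by rewrite subr_eq0 => /eqP.
(* An isotropic [e] falls under the first alternative: every product is a multiple of [<e, e>]. *)
have [ee|ee] := eqVneq (form (e ord0) (e ord0)) 0; [left|right; split=> //] => v w v0 w0.
  have [c ->] // := E v v0; have [d dP] := E w w0.
  by rewrite formC dP// ee !mulr0.
have [c cP] := E v v0; rewrite !cP// (formC w (e ord0)).
by rewrite mulrAC mulfK.
Qed.

(** * The converse for [so(V)] *)

Section Backward.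
Hypothesis surj : iota @` so T = [set: g].
Variable t : set g.
Hypotheses (at_ : subalgebra t) (rank1 : zero_weight_rank1 t)
  (supp_t : support_condition rho t).

Let st : subspace t. Proof. by case: at_. Qed.

Variable I : set (t -> F).
Hypotheses (IN0 : I `&` [set - alpha | alpha in I] = set0)
  (IU : I `|` [set - alpha | alpha in I] = supp rho t `\ 0)
  (tI : t = span (\bigcup_(alpha in I) (iota @` wedge_set T 'V^alpha 'V^(- alpha)))).

Let G := [set x | exists alpha, I alpha /\ exists a b,
  [/\ 'V^alpha a, 'V^(- alpha) b & x = iota (wedge a b)]].

Let tG : t `<=` span G.
Proof.
rewrite [X in X `<=` _]tI; apply: span_min; first exact: span_subspace.
move=> _ [alpha Ia [s ws <-]].
have sG : subspace (span G) by exact: span_subspace.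
have [|_ //] := wedge_set_min (iota_preim_subspace sds sG) _ ws.
move=> a b aa ab; split=> //; apply: sub_span; exists alpha; split=> //.
by exists a, b.
Qed.

Let Gt : G `<=` t.
Proof.
move=> _ [alpha [Ia [a [b [aa ab ->]]]]]; rewrite [X in X _]tI; apply: sub_span.
by exists alpha => //; exists (wedge a b) => //; apply: sub_wedge_set.
Qed.

Let lineI alpha : I alpha -> exists v w, [/\ alpha <> 0, v != 0, w != 0,
  'V^alpha = span [set v] & 'V^(- alpha) = span [set w]].
Proof.
move=> Ia; have sa : (supp rho t `\ 0) alpha by rewrite -IU; left.
have sN : (supp rho t `\ 0) (- alpha) by rewrite -IU; right; exists alpha.
have [_ d1] := supp_t; have [v v0 vE] := d1 _ sa; have [w w0 wE] := d1 _ sN.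
by exists v, w; split=> //; case: sa.
Qed.

Let oppI alpha : I alpha -> ~ I (- alpha).
Proof.
move=> Ia INa; have : (I `&` [set - alpha | alpha in I]) (- alpha).
  by split=> //; exists alpha.
by rewrite IN0.
Qed.

Let other_kills alpha beta a b u : I alpha -> I beta -> alpha <> beta ->
  'V^alpha a -> 'V^(- alpha) b -> 'V^beta u \/ 'V^(- beta) u -> act (wedge a b) u = 0.
Proof.
move=> Ia Ib ab aa ab' bu; rewrite act_wedge.
have -> : form u b = 0.
  rewrite formC; apply/eqP/negPn/negP => bu0; case: bu => bu.
    by apply: ab; rewrite (weight_space_pairing ab' bu bu0) opprK.
  have E := weight_space_pairing ab' bu bu0; apply: (oppI Ib).
  by rewrite E opprK.
have -> : form u a = 0.
  rewrite formC; apply/eqP/negPn/negP => au0; case: bu => bu.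
    by apply: (oppI Ia); rewrite -(weight_space_pairing aa bu au0).
  by apply: ab; rewrite -[beta]opprK (weight_space_pairing aa bu au0) opprK.
by rewrite !scale0r subrr.
Qed.

Let G_comm x y : G x -> G y -> lie x y = 0.
Proof.
move=> [alpha [Ia [a [b [aa ab ->]]]]] [beta [Ib [c [d [bc bd ->]]]]].
have [E|/eqP ne] := eqVneq alpha beta.
  have [v [w [_ _ _ vE wE]]] := lineI Ia.
  rewrite -E vE in bc; rewrite -E wE in bd; rewrite vE in aa; rewrite wE in ab.
  move: aa ab bc bd => /span1P[c1 ->] /span1P[c2 ->] /span1P[c3 ->] /span1P[c4 ->].
  rewrite !(linZ _ _ (iota_wedge_linear sds _)) !(linZ _ _ (iota_wedge_linearl sds w)).
  by rewrite !lieZl !lieZr lie_alternating !scaler0.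
rewrite lie_wedge !(rho_iota rhoE)//.
rewrite (other_kills Ia Ib ne aa ab (or_introl bc)) (other_kills Ia Ib ne aa ab (or_intror bd)).
by rewrite (lin0 (wedge_linearl T d)) (lin0 (wedge_linear T c)) addr0 (iota0 sds).
Qed.

Let t_abelian x y : t x -> t y -> lie x y = 0.
Proof.
move=> /tG tx /tG ty; apply: (span_min (subspace_lie_ker y) _ tx) => x' Gx /=.
by apply: (span_min (subspace_ker (lie_linear x')) _ ty) => y' Gy /=; apply: G_comm.
Qed.

(** If [v] and [w] were orthogonal, every generator of [t] would annihilate [V^alpha], forcing
    [alpha = 0]. *)
Let paired alpha v w : I alpha -> 'V^alpha = span [set v] -> 'V^(- alpha) = span [set w] ->
  form v w != 0.
Proof.
move=> Ia vE wE; apply/negP => /eqP vw.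
have [v' [w' [a0 v'0 _ v'E _]]] := lineI Ia.
have av' : 'V^alpha v' by rewrite v'E; apply: sub_span.
have [c v'v] : exists c, v' = c *: v by apply: span1P; rewrite -vE.
have kill x : t x -> rho x v' = 0.
  move=> /tG tx; apply: (span_min (subspace_ker (rho_linearl rho v')) _ tx).
  move=> _ [beta [Ib [a [b [ba bb ->]]]]] /=; rewrite (rho_iota rhoE)//.
  have [E|/eqP ne] := eqVneq beta alpha; last exact: (other_kills Ib Ia ne ba bb (or_introl av')).
  rewrite E wE in ba bb; have [d bw] := span1P bb.
  rewrite act_wedge bw (weight_isotropic a0 av' ba) v'v linearZl_LR /= linearZr_LR /= vw.
  by rewrite !mulr0 !scale0r subrr.
apply: a0; apply/funext => x; have [n] := weight_space_gen x av'.
rewrite (papply_eigen _ (rho_lin _) (c := 0)); last first.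
  by rewrite scale0r kill//; exact: set_mem (valP x).
rewrite horner_exp hornerXsubC sub0r => /eqP; rewrite scaler_eq0 (negPf v'0) orbF.
by rewrite expf_eq0 oppr_eq0 => /andP[_ /eqP].
Qed.

Let G_diag x : G x -> diag_on setT (lie x).
Proof.
move=> [alpha [Ia [a [b [aa ab ->]]]]]; have [v [w [a0 _ _ vE wE]]] := lineI Ia.
have aN0 : - alpha <> 0 by move=> /eqP; rewrite oppr_eq0 => /eqP.
have [fab|fab] := eqVneq (form a b) 0; last first.
  exact: (hyperbolic_diag (weight_isotropic a0 aa aa) (weight_isotropic aN0 ab ab) fab).
have -> : wedge a b = 0.
  have vw := paired Ia vE wE; move: fab; rewrite vE in aa; rewrite wE in ab.
  move: aa ab => /span1P[c ->] /span1P[d ->].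
  rewrite linearZl_LR /= linearZr_LR /= mulrCA => /eqP; rewrite mulf_eq0 => /orP[/eqP->|].
    by rewrite scale0r (lin0 (wedge_linear T _)).
  rewrite mulf_eq0 (negPf vw) orbF => /eqP->.
  by rewrite scale0r (lin0 (wedge_linearl T _)).
by move=> u _; apply: sub_span; split=> //; exists 0; rewrite (iota0 sds) lie0l scale0r.
Qed.

Lemma decomposed_toral : toral gs t.
Proof.
split=> // x tx; apply/(semisimple_eltP rr).
have sub : subspace [set x | t x /\ diag_on setT (lie x)].
  split.
    split; first exact: subspace0.
    by move=> u _; apply: sub_span; split=> //; exists 0; rewrite lie0l scale0r.
  move=> c y z [ty dy] [tz dz]; split; first by apply: subspaceD => //; exact: subspaceZ.
  move=> u Tu; have := @diag_on_comm _ _ setT (lie z) (lie y) c (subspaceT g)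
    (lie_linear z) (lie_linear y) (fun _ _ => Logic.I) (fun _ _ => Logic.I).
  move=> /(_ _ dz dy u Tu) H.
  have {}H : span [set w | [set: g] w /\ exists c0, lie z w + c *: lie y w = c0 *: w] u.
    by apply: H => v _; rewrite lieJ (t_abelian tz ty) lie0l add0r.
  by apply: spanS H => w [_ [d wd]]; split=> //; exists d; rewrite lieDl lieZl addrC.
by have [] := span_min sub (fun y Gy => conj (Gt Gy) (G_diag Gy)) (tG tx).
Qed.

(** An element of a larger toral [t'] commutes with [t], so it is the sum of an element of [t] and
    some [r] in the exterior square of [V^0]. Then [r] lies in [t'] and is nilpotent on [V], hence
    0. *)
Theorem decomposed_maximal_toral : maximal_toral gs t.
Proof.
have tt := decomposed_toral; split=> // t' tt' tt'S; apply/seteqP; split=> // y t'y.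
have [s ss sy] : (iota @` so T) y by rewrite surj.
have ts x : t x -> lie x (iota s) = 0.
  by move=> /tt'S t'x; rewrite sy; apply: (toral_abelian rr tt').
pose W0 := wedge_set T 'V^(0 : t -> F) 'V^(0 : t -> F).
have sW : subspace W0 by exact: wedge_set_subspace.
pose K := [set x | exists2 x1, t x1 & exists2 r, W0 r & x = x1 + iota r].
have sK : subspace K.
  split.
    exists 0; first exact: subspace0.
    by exists 0; [exact: subspace0|rewrite (iota0 sds) addr0].
  move=> c _ _ [x1 tx1 [r wr ->]] [x2 tx2 [r' wr' ->]].
  exists (c *: x1 + x2); first by apply: subspaceD => //; exact: subspaceZ.
  exists (c *: r + r'); first by apply: (subspaceD sW) => //; exact: (subspaceZ _ sW).
  rewrite (iota_linear sds c (wedge_set_so wr) (wedge_set_so wr')) scalerDr.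
  exact: addrACA.
have [|_ [y1 ty1 [r wr yE]]] :=
    span_min (iota_preim_subspace sds sK) _ (centralizer_span tt ss ts).
  move=> _ [alpha [da [a [b [[aa _] [ab _] ->]]]]]; split=> //.
  have [->|ab0] := eqVneq (wedge a b) 0.
    by rewrite (iota0 sds); exact: subspace0.
  have [al0|al0] := eqVneq alpha 0.
    exists 0; first exact: subspace0.
    exists (wedge a b); last by rewrite add0r.
    by rewrite al0 oppr0 in aa ab; apply: sub_wedge_set.
  have a0 : a != 0 by apply: contra_neq ab0 => ->; rewrite (lin0 (wedge_linearl T b)).
  have sa : (supp rho t `\ 0) alpha.
    split; last exact/eqP.
    by split=> // E; move: aa a0; rewrite E => /= ->; rewrite eqxx.
  exists (iota (wedge a b)); last first.
    by exists 0; [exact: subspace0|rewrite (iota0 sds) addr0].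
  move: sa; rewrite -IU => -[Ia|[be Ib bE]].
    by apply: Gt; exists alpha; split=> //; exists a, b.
  rewrite -bE opprK in aa ab; rewrite wedgeC (iotaN sds)//; apply: subspaceN => //.
  by apply: Gt; exists be; split=> //; exists b, a.
have sor := wedge_set_so wr.
have t'r : t' (iota r).
  have -> : iota r = y - y1 by rewrite -sy yE addrC addKr.
  have [[st' _] _] := tt'; apply: subspaceB => //; exact: tt'S.
suff r0 : r = 0 by rewrite -sy yE r0 (iota0 sds) addr0.
have [e /(_ r wr)[rV [sg [sg0 sge] rE]]] := zero_wedge_act tt rank1.
apply: (act_faithful infV formC form_nd) => u.
rewrite -(rho_iota rhoE u sor) -(scale0r u).
(* Three applications are needed: [r] maps [V] into [V^0], then to multiples of [sg], then to 0. *)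
apply: (toral_gen_eigen tt' t'r); exists 3.
rewrite (papply_XsubC0_exp _ _ (rho_lin _)) /= !(rho_iota rhoE)//.
rewrite (rE _ (rV u)) (linZ _ _ (act_linear r)) (rE _ sg0) sge.
by rewrite scale0r scaler0.
Qed.

End Backward.

End ToralWeights.

Theorem theorem4p3 (R : realType)
    (V : lmodType R[i]) (form : {biscalar V}) (T : tensor_square form)
    (g : lieAlgType R[i]) (gs hs : nat -> set g)
    (iota : T -> g) (k : set g) (rho : {bilinear g -> V -> V}) :
  countably_infinite_dim V ->
  form_symmetric form ->
  form_nondegenerate form ->
  root_reductive gs hs ->
  so_direct_summand iota k ->
  lie_module rho ->
  extends_natural_module rho iota k ->
  invariant_form rho form ->
  (forall t : set g, maximal_toral gs t ->
    [/\ weight_pairing form rho t,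
        isotropic_pairs_central iota rho t,
        zero_weight_condition iota rho t &
        centralizer_condition iota t]) /\
  (iota @` so T = [set: g] ->
   forall t : set g, subalgebra t ->
     (maximal_toral gs t <->
      [/\ zero_weight_condition iota rho t,
          support_condition rho t &
          decomposition_condition iota rho t])).
Proof.
move=> infV formC form_nd rr sds rhoM rhoE formI; split=> [t mt|surj t at_].
  split.
  - exact: (maximal_toral_pairing infV formC form_nd rr sds rhoM rhoE formI mt).
  - exact: (maximal_toral_isotropic infV formC form_nd rr sds rhoM rhoE formI mt).
  - exact: (maximal_toral_zero_weight infV formC form_nd rr sds rhoM rhoE formI mt).
  - exact: (maximal_toral_centralizer infV formC form_nd rr sds rhoM rhoE formI mt).
split=> [mt|[[rk _] sc [I [IN0 IU [tI _]]]]].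
  split.
  - exact: (maximal_toral_zero_weight infV formC form_nd rr sds rhoM rhoE formI mt).
  - exact: (maximal_toral_support infV formC form_nd rr sds rhoM rhoE formI surj mt).
  - exact: (maximal_toral_decomposition infV formC form_nd rr sds rhoM rhoE formI surj mt).
have rk1 := restricted_rank_form formC rk.
exact: (decomposed_maximal_toral infV formC form_nd rr sds rhoM rhoE formI surj at_ rk1 sc
  IN0 IU tI).
Qed.
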